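(* (a) Complex Banach spaces which are uniformly smooth and uniformly convex satisfy the BPBp-nu. (b) In particular, for every measure $\mu$, the complex spaces $L_p(\mu)$ have the BPBp-nu for $1<p<\infty$. (c) For every measure $\mu$, the real spaces $L_p(\mu)$ have the BPBp-nu for $1<p<\infty$, $p\neq 2$.
   Context: For a real or complex Banach space $X$ with dual $X^*$ and unit sphere $S_X$, $\mathcal{L}(X)$ is the space of bounded linear operators on $X$ with the operator norm, $\Pi(X)=\{(x,x^* )\in S_X\times S_{X^*} : x^*(x)=1\}$, and the numerical radius of $T\in\mathcal{L}(X)$ is $v(T)=\sup\{|x^*(Tx)| : (x,x^* )\in\Pi(X)\}$. BPBp-nu (Bishop-Phelps-Bollobás property for numerical radius): for every $0<\varepsilon<1$ there exists $\eta(\varepsilon)>0$ such that whenever $T\in\mathcal{L}(X)$ and $(x,x^* )\in\Pi(X)$ satisfy $v(T)=1$ and $|x^*(Tx)|>1-\eta(\varepsilon)$, there exist $S\in\mathcal{L}(X)$ and $(y,y^* )\in\Pi(X)$ with $v(S)=|y^*(Sy)|=1$, $\|T-S\|<\varepsilon$, $\|x-y\|<\varepsilon$ and $\|x^*-y^*\|<\varepsilon$. *)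

(* Defs.v *)
From HB Require Import structures.
From mathcomp Require Import all_boot all_order all_algebra.
From mathcomp Require Import complex.
From mathcomp Require Import all_classical all_reals all_analysis.
From mathcomp Require Import measurable_realfun ess_sup_inf.

Set Implicit Arguments.
Unset Strict Implicit.
Unset Printing Implicit Defensive.

Import Order.TTheory GRing.Theory Num.Theory.
Import numFieldNormedType.Exports.

Local Open Scope classical_set_scope.
Local Open Scope ring_scope.

(* The scalar field K stands for R or R[i], with R : realType. The norm of a
   normedModType K takes its values in K. On R[i], z <= w means Im z = Im w and
   Re z <= Re w: the positive elements are exactly the positive reals, and a
   nonempty bounded set of reals has the same supremum in R[i] as in R
   (supremum_complex below), so that the epsilons and the suprema in K are the
   usual real ones. [supremum 0 A] has the default value 0 if A is empty or
   unbounded; for bounded operators the only such case is the empty set Pi_set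
   of the zero space. *)

Section numerical_radius.
Variable K : numFieldType.

Definition op_norm (X Y : normedModType K) (f : X -> Y) : K :=
  supremum 0 [set `|f x| | x in [set x : X | `|x| <= 1]].

(* Operators and functionals are linear maps whose continuity is a hypothesis
   of its own; K^o is K seen as a normed module over itself. *)
Definition Pi_set (X : normedModType K) : set (X * {linear X -> K^o}) :=
  [set z : X * {linear X -> K^o} | [/\ `|z.1| = 1,
    continuous (z.2 : X -> K^o), op_norm (z.2 : X -> K^o) = 1 & z.2 z.1 = 1]].

Definition num_radius (X : normedModType K) (T : X -> X) : K :=
  supremum 0 [set `|z.2 (T z.1) : K| | z in @Pi_set X].

Definition BPBp_nu (X : normedModType K) : Prop :=
  forall eps : K, 0 < eps -> eps < 1 ->
  exists2 eta : K, 0 < eta &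
  forall (T : {linear X -> X}) (x : X) (xs : {linear X -> K^o}),
    continuous T -> Pi_set (x, xs) ->
    num_radius T = 1 -> `|xs (T x)| > 1 - eta ->
  exists (S : {linear X -> X}) (y : X) (ys : {linear X -> K^o}),
    [/\ continuous S, Pi_set (y, ys),
        num_radius S = 1 /\ `|ys (S y)| = 1,
        op_norm (fun u => T u - S u) < eps &
        `|x - y| < eps /\ op_norm (fun u => xs u - ys u) < eps].

Definition uniformly_convex (X : normedModType K) : Prop :=
  forall eps : K, 0 < eps ->
  exists2 delta : K, 0 < delta &
  forall x y : X, `|x| = 1 -> `|y| = 1 -> eps <= `|x - y| ->
    `|2^-1 *: (x + y)| <= 1 - delta.

Definition uniformly_smooth (X : normedModType K) : Prop :=
  forall eps : K, 0 < eps ->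
  exists2 delta : K, 0 < delta &
  forall x y : X, `|x| = 1 -> `|y| <= delta ->
    `|x + y| + `|x - y| <= 2 + eps * `|y|.

End numerical_radius.

Lemma supremum_complex (R : realType) (A : set R) :
  has_sup A -> supremum 0 [set x%:C%C | x in A] = (sup A)%:C%C :> R[i].
Proof.
move=> supA; have [[a Aa] ubA] := supA.
have sA : supremums [set x%:C%C | x in A] ((sup A)%:C%C : R[i]).
  split.
    by move=> _ [x Ax <-]; rewrite lecR; exact: ub_le_sup.
  move=> [u v] ub; have := ub _ (ex_intro2 _ _ a Aa erefl).
  rewrite lecE/= => /andP[/eqP v0 _]; rewrite lecE/= v0 eqxx/=.
  apply: ge_sup; first by exists a.
  move=> x Ax; have := ub _ (ex_intro2 _ _ x Ax erefl).
  by rewrite lecE/= => /andP[].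
rewrite /supremum ifF; last first.
  by apply/negbTE/set0P; exists (a%:C%C); exists a.
by case: xgetP => [y _ sy|/(_ _ sA)//]; apply: is_subset1_supremums sy sA.
Qed.

(* The kernel of the seminorm is presented by a separate predicate sn_null,
   which for L_p is vanishing almost everywhere; sn_quot below identifies f and
   g when f - g satisfies it. *)
Record seminormed (K : numFieldType) := Seminormed {
  sn_sort :> lmodType K;
  sn_null : sn_sort -> Prop;
  snorm : sn_sort -> K;
  snormD : forall f g, snorm (f + g) <= snorm f + snorm g;
  snormZ : forall a f, snorm (a *: f) = `|a| * snorm f;
  snorm_eq0 : forall f, snorm f = 0 <-> sn_null f }.

Section seminormed_quotient.
Variables (K : numFieldType) (V : seminormed K).
Local Open Scope quotient_scope.

Definition sn_eqv : rel V := fun f g => `[< sn_null (f - g) >].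

Let snorm0 : snorm (0 : V) = 0.
Proof. by rewrite -(scale0r (0 : V)) snormZ normr0 mul0r. Qed.

Let snormN (f : V) : snorm (- f) = snorm f.
Proof. by rewrite -scaleN1r snormZ normrN1 mul1r. Qed.

Let snorm_ge0 (f : V) : 0 <= snorm f.
Proof.
have := snormD f (- f); rewrite subrr snorm0 snormN -mulr2n => h.
by rewrite -(pmulrn_lge0 _ (ltn0Sn 1)).
Qed.

Let eqvP (f g : V) : reflect (snorm (f - g) = 0) (sn_eqv f g).
Proof. by apply: (iffP (asboolP _)) => /snorm_eq0. Qed.

Let snorm_eq0D (f g : V) : snorm f = 0 -> snorm g = 0 -> snorm (f + g) = 0.
Proof.
move=> f0 g0; apply/eqP; rewrite eq_le snorm_ge0 andbT.
by rewrite (le_trans (snormD _ _))// f0 g0 addr0.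
Qed.

Let sn_eqv_refl : reflexive sn_eqv.
Proof. by move=> f; apply/eqvP; rewrite subrr. Qed.

Let sn_eqv_sym : symmetric sn_eqv.
Proof.
by move=> f g; apply/eqvP/eqvP => h; rewrite -opprB snormN.
Qed.

Let sn_eqv_trans : transitive sn_eqv.
Proof.
move=> g f h /eqvP fg /eqvP gh; apply/eqvP.
by rewrite -(subrKA g); exact: snorm_eq0D.
Qed.

Canonical sn_eqv_canonical :=
  EquivRel sn_eqv sn_eqv_refl sn_eqv_sym sn_eqv_trans.

Definition sn_quot : Type := {eq_quot sn_eqv}.
HB.instance Definition _ := Choice.on sn_quot.
HB.instance Definition _ := EqQuotient.on sn_quot.

Lemma sn_quotP (f g : V) : \pi_sn_quot f = \pi_sn_quot g <-> sn_null (f - g).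
Proof.
by split => [/eqP|h]; [|apply/eqP]; rewrite eqmodE => //; [move/asboolP|apply/asboolP].
Qed.

Let reprP (f : V) : snorm (repr (\pi_sn_quot f) - f) = 0.
Proof. by apply/snorm_eq0/sn_quotP; rewrite reprK. Qed.

Let piP (f g : V) : snorm (f - g) = 0 -> \pi_sn_quot f = \pi_sn_quot g.
Proof. by move=> h; apply/sn_quotP/snorm_eq0. Qed.

Definition sq_zero : sn_quot := \pi_sn_quot 0.
Definition sq_add (x y : sn_quot) : sn_quot := \pi_sn_quot (repr x + repr y).
Definition sq_opp (x : sn_quot) : sn_quot := \pi_sn_quot (- repr x).
Definition sq_scale (a : K) (x : sn_quot) : sn_quot := \pi_sn_quot (a *: repr x).
Definition sq_norm (x : sn_quot) : K := snorm (repr x).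

Let pi_add f g : sq_add (\pi_sn_quot f) (\pi_sn_quot g) = \pi_sn_quot (f + g).
Proof. by apply: piP; rewrite opprD addrACA; exact: snorm_eq0D. Qed.

Let pi_opp f : sq_opp (\pi_sn_quot f) = \pi_sn_quot (- f).
Proof. by apply: piP; rewrite -opprD snormN. Qed.

Let pi_scale a f : sq_scale a (\pi_sn_quot f) = \pi_sn_quot (a *: f).
Proof. by apply: piP; rewrite -scalerBr snormZ reprP mulr0. Qed.

Let pi_norm f : sq_norm (\pi_sn_quot f) = snorm f.
Proof.
apply/eqP; rewrite eq_le -{1}[X in _ <= X]add0r -{1}(reprP f).
rewrite -[X in _ && (_ <= X)]add0r -[X in _ && (_ <= X + _)](reprP f).
rewrite -[X in _ && (_ <= X + _)]snormN opprB.
by rewrite (le_trans _ (snormD _ _)) ?subrK//= (le_trans _ (snormD _ _)) ?subrK.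
Qed.

Let sq_ind (P : sn_quot -> Prop) :
  (forall f, P (\pi_sn_quot f)) -> forall x, P x.
Proof. by move=> h x; rewrite -[x]reprK. Qed.

Let addA : associative sq_add.
Proof.
by elim/sq_ind => f; elim/sq_ind => g; elim/sq_ind => h; rewrite !pi_add addrA.
Qed.
Let addC : commutative sq_add.
Proof. by elim/sq_ind => f; elim/sq_ind => g; rewrite !pi_add addrC. Qed.
Let add0 : left_id sq_zero sq_add.
Proof. by elim/sq_ind => f; rewrite pi_add add0r. Qed.
Let addN : left_inverse sq_zero sq_opp sq_add.
Proof. by elim/sq_ind => f; rewrite pi_opp pi_add addNr. Qed.

HB.instance Definition _ := GRing.isZmodule.Build sn_quot addA addC add0 addN.

Let scaleA a b x : sq_scale a (sq_scale b x) = sq_scale (a * b) x.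
Proof. by elim/sq_ind: x => f; rewrite !pi_scale scalerA. Qed.
Let scale1 : left_id 1 sq_scale.
Proof. by elim/sq_ind => f; rewrite pi_scale scale1r. Qed.
Let scaleDr : right_distributive sq_scale +%R.
Proof.
move=> a; elim/sq_ind => f; elim/sq_ind => g.
by rewrite [_ + _]pi_add !pi_scale [RHS]pi_add scalerDr.
Qed.
Let scaleDl x : {morph sq_scale^~ x : a b / a + b}.
Proof.
by move=> a b; elim/sq_ind: x => f; rewrite !pi_scale [RHS]pi_add scalerDl.
Qed.

HB.instance Definition _ := GRing.Zmodule_isLmodule.Build K sn_quot
  scaleA scale1 scaleDr scaleDl.

Let normD (x y : sn_quot) : sq_norm (x + y) <= sq_norm x + sq_norm y.
Proof.
elim/sq_ind: x => f; elim/sq_ind: y => g.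
by rewrite [_ + _]pi_add !pi_norm snormD.
Qed.
Let normZ (a : K) (x : sn_quot) : sq_norm (a *: x) = `|a| * sq_norm x.
Proof. by elim/sq_ind: x => f; rewrite [_ *: _]pi_scale !pi_norm snormZ. Qed.
Let norm_eq0 (x : sn_quot) : sq_norm x = 0 -> x = 0.
Proof.
by elim/sq_ind: x => f; rewrite pi_norm => h; apply: piP; rewrite subr0.
Qed.

HB.instance Definition _ := Lmodule_isNormed.Build K sn_quot
  normD normZ norm_eq0.

Lemma sn_quotD (f g : V) :
  \pi_sn_quot (f + g) = \pi_sn_quot f + \pi_sn_quot g.
Proof. by rewrite [RHS]pi_add. Qed.

Lemma sn_quotZ (a : K) (f : V) : \pi_sn_quot (a *: f) = a *: \pi_sn_quot f.
Proof. by rewrite [RHS]pi_scale. Qed.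

Lemma sn_quot_norm (f : V) : `|\pi_sn_quot f| = snorm f.
Proof. exact: pi_norm. Qed.

End seminormed_quotient.

(* The spaces L_p(mu), for an arbitrary measure mu, as normed spaces: classes
   modulo equality almost everywhere of measurable functions of finite p-norm.
   Completeness is not part of these definitions. *)
Section Lp.
Context d (T : measurableType d) (R : realType).
Variables (mu : {measure set T -> \bar R}) (p : \bar R) (p1 : (1 <= p)%E).

Let measurable_powr (f : T -> R) (r : R) : measurable_fun setT f ->
  measurable_fun setT (fun x => (`|f x| `^ r)%:E).
Proof.
move=> mf; apply: measurableT_comp => //.
by apply: (measurableT_comp (measurable_powR _)); exact: measurableT_comp.
Qed.

Let Lnorm_ae0 (f : T -> R) : measurable_fun setT f ->
  (\forall x \ae mu, f x = 0) -> 'N[mu]_p[EFin \o f]%E = 0%E.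
Proof.
move=> mf f0; rewrite unlock; case: p p1 => [r|_|//]; last first.
  case: ifPn => // mu0; apply: ess_sup_ae_cst => //.
  by apply: filterS f0 => x /= ->; rewrite normr0.
rewrite lee_fin => r1; have r0 : r != 0 by rewrite gt_eqF// (lt_le_trans _ r1).
rewrite (_ : \int[mu]_x _ = 0)%E ?poweR0r ?invr_neq0//.
rewrite -[RHS](integral0 mu setT); apply: ae_eq_integral => //.
  exact: measurable_powr.
by apply: filterS f0 => x /= -> _; rewrite normr0 powR0.
Qed.

Let Lnorm_le (f g : T -> R) :
  measurable_fun setT f -> measurable_fun setT g ->
  (forall x, `|f x| <= `|g x|) ->
  ('N[mu]_p[EFin \o f] <= 'N[mu]_p[EFin \o g])%E.
Proof.
move=> mf mg fg; rewrite unlock; case: p p1 => [r|_|//]; last first.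
  case: ifPn => // mu0; apply: le_ess_sup.
  by apply: nearW => x /=; rewrite lee_fin.
rewrite lee_fin => r1; have r0 : 0 < r by rewrite (lt_le_trans _ r1).
apply: gt0_ler_poweR.
- by rewrite invr_ge0 ltW.
- by rewrite in_itv/= leey integral_ge0.
- by rewrite in_itv/= leey integral_ge0.
apply: ge0_le_integral => //.
- by move=> x _; rewrite poweR_ge0.
- exact: measurable_powr.
- exact: measurable_powr.
by move=> x _ /=; rewrite lee_fin ge0_ler_powR ?nnegrE// ltW.
Qed.

Section real.

Definition Lp_norm (f : LfunType mu p1) : R := fine 'N[mu]_p[EFin \o f]%E.

Lemma Lp_normD f g : Lp_norm (f + g) <= Lp_norm f + Lp_norm g.
Proof. exact: ler_LnormD. Qed.

Lemma Lp_normZ a f : Lp_norm (a *: f) = `|a| * Lp_norm f.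
Proof.
apply: EFin_inj; rewrite /Lp_norm finite_norm_fine EFinM finite_norm_fine.
exact: LnormZ.
Qed.

Lemma Lp_norm_eq0 f : Lp_norm f = 0 <-> \forall x \ae mu, f x = 0.
Proof.
split=> [/fine_Lnormr_eq0|f0]; first by apply: filterS => x /(_ I).
by rewrite /Lp_norm Lnorm_ae0.
Qed.

Definition Lp_real : normedModType R :=
  sn_quot (Seminormed Lp_normD Lp_normZ Lp_norm_eq0).

End real.

Section complex.

Import ComplexField.Normc.

(* A complex function is measurable if its real and imaginary parts are;
   normc is the modulus with values in R, so this is || |f| ||_p < +oo. *)
Definition cfinite_norm (f : T -> R[i]) : Prop :=
  [/\ measurable_fun setT (fun t => complex.Re (f t)),
      measurable_fun setT (fun t => complex.Im (f t)) &
      finite_norm mu p (fun t => normc (f t))].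

Definition cLfun : {pred (T -> R[i])} := mem [set f | cfinite_norm f].

Let normcE (z : R[i]) :
  normc z = Num.sqrt (complex.Re z ^+ 2 + complex.Im z ^+ 2).
Proof. by case: z. Qed.

Let normr_normc (z : R[i]) : `|z| = (normc z)%:C%C.
Proof. by rewrite normcE normc_def. Qed.

Let normc_ge0 (z : R[i]) : 0 <= normc z.
Proof. by rewrite normcE sqrtr_ge0. Qed.

Let measurable_normc (f : T -> R[i]) :
  measurable_fun setT (fun t => complex.Re (f t)) ->
  measurable_fun setT (fun t => complex.Im (f t)) ->
  measurable_fun setT (fun t => normc (f t)).
Proof.
move=> mRe mIm; under eq_fun do rewrite normcE.
apply: (measurableT_comp (continuous_measurable_fun (@sqrt_continuous R))).
by apply: measurable_funD; exact: measurable_funX.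
Qed.

Let cLnormD (f g : T -> R[i]) : f \in cLfun -> g \in cLfun ->
  ('N[mu]_p[EFin \o (fun t => normc (f t + g t)%R)] <=
   'N[mu]_p[EFin \o (fun t => normc (f t))] +
   'N[mu]_p[EFin \o (fun t => normc (g t))])%E.
Proof.
rewrite !inE => -[fr fi _] [gr gi _].
have mf := measurable_normc fr fi; have mg := measurable_normc gr gi.
apply: (le_trans _ (eminkowski mu mf mg p1)).
apply: Lnorm_le.
- apply: measurable_normc.
    rewrite (_ : (fun _ => _) = fun t => complex.Re (f t) + complex.Re (g t)).
      exact: measurable_funD.
    by apply/funext => t; rewrite raddfD.
  rewrite (_ : (fun _ => _) = fun t => complex.Im (f t) + complex.Im (g t)).
    exact: measurable_funD.
  by apply/funext => t; rewrite raddfD.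
- exact: measurable_funD.
- by move=> x; rewrite !ger0_norm ?addr_ge0// le_normcD.
Qed.

Let normc_Lfun (f : T -> R[i]) : f \in cLfun ->
  (fun t => normc (f t)) \in Lfun mu p.
Proof.
rewrite !inE => -[fr fi ff]; apply/andP; split; rewrite inE//=.
exact: measurable_normc.
Qed.

Let cLnormZ (a : R[i]) (f : T -> R[i]) : f \in cLfun ->
  ('N[mu]_p[EFin \o (fun t => normc ((a *: f) t)%R)] =
   (normc a)%:E * 'N[mu]_p[EFin \o (fun t => normc (f t))])%E.
Proof.
move=> /normc_Lfun fL.
have := LnormZ (Lfun_Sub p1 fL) (normc a); rewrite ger0_norm// => <-.
apply: eq_Lnorm => t; congr EFin.
by rewrite -[(a *: f) t]/(a * f t) normcM.
Qed.

Let cLfun_submod_closed : submod_closed cLfun.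
Proof.
have ReZ a f : f \in cLfun -> a *: f \in cLfun.
  move=> fL; have := fL; rewrite !inE => -[fr fi ff]; split.
  - rewrite (_ : (fun _ => _) = fun t =>
      complex.Re a * complex.Re (f t) - complex.Im a * complex.Im (f t)).
      by apply: measurable_funB; apply: measurable_funM.
    apply/funext => t; rewrite -[(a *: f) t]/(a * f t).
    by case: a (f t) => [a b] [].
  - rewrite (_ : (fun _ => _) = fun t =>
      complex.Re a * complex.Im (f t) + complex.Im a * complex.Re (f t)).
      by apply: measurable_funD; apply: measurable_funM.
    apply/funext => t; rewrite -[(a *: f) t]/(a * f t).
    by case: a (f t) => [a b] [].
  - rewrite /finite_norm cLnormZ// lte_mul_pinfty// ?lee_fin//.
split.
  rewrite inE; split; try exact: measurable_cst.
  rewrite /finite_norm (_ : _ \o _ = cst 0%E).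
    by rewrite Lnorm0// gt_eqF// (lt_le_trans _ p1).
  by apply/funext => t /=; congr EFin; exact: normc0.
move=> a f g /(ReZ a) fL gL; move: (a *: f) fL => {}f fL.
have := fL; have := gL; rewrite !inE => -[gr gi gf] [fr fi ff]; split.
- rewrite (_ : (fun _ => _) = fun t => complex.Re (f t) + complex.Re (g t)).
    exact: measurable_funD.
  by apply/funext => t; rewrite raddfD.
- rewrite (_ : (fun _ => _) = fun t => complex.Im (f t) + complex.Im (g t)).
    exact: measurable_funD.
  by apply/funext => t; rewrite raddfD.
- by rewrite /finite_norm (le_lt_trans (cLnormD fL gL))// lte_add_pinfty.
Qed.

HB.instance Definition _ := GRing.isSubmodClosed.Build _ _ cLfun
  cLfun_submod_closed.

(* q1 only makes the vector space structure inferable from the type, as in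
   LfunType. *)
Record cLfunType_ (q1 : (1 <= p)%E) :=
  CLfun { cLfun_val :> T -> R[i]; _ : cLfun_val \in cLfun }.
Local Notation cLfunType := (cLfunType_ p1).
HB.instance Definition _ := [isSub of cLfunType for @cLfun_val p1].
HB.instance Definition _ := [Choice of cLfunType by <:].
HB.instance Definition _ := [SubChoice_isSubLmodule of cLfunType by <:].

Definition cLp_norm (f : cLfunType) : R[i] :=
  (fine 'N[mu]_p[EFin \o (fun t => normc (f t))]%E)%:C%C.

Let cLp_norm_fine (f : cLfunType) :
  ((fine 'N[mu]_p[EFin \o (fun t => normc (f t))])%:E =
   'N[mu]_p[EFin \o (fun t => normc (f t))])%E.
Proof. exact: finite_norm_fine (Lfun_Sub p1 (normc_Lfun (valP f))). Qed.

Lemma cLp_normD f g : cLp_norm (f + g) <= cLp_norm f + cLp_norm g.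
Proof.
rewrite -rmorphD lecR -lee_fin EFinD !cLp_norm_fine.
exact: cLnormD (valP f) (valP g).
Qed.

Let cLfun_valZ a (f : cLfunType) : cLfun_val (a *: f) = a *: cLfun_val f.
Proof. by []. Qed.

Lemma cLp_normZ a f : cLp_norm (a *: f) = `|a| * cLp_norm f.
Proof.
rewrite /cLp_norm cLfun_valZ cLnormZ ?(valP f)// -cLp_norm_fine -EFinM/=.
by rewrite normr_normc rmorphM.
Qed.

Lemma cLp_norm_eq0 f : cLp_norm f = 0 <-> \forall x \ae mu, f x = 0.
Proof.
have := Lp_norm_eq0 (Lfun_Sub p1 (normc_Lfun (valP f))).
move=> -[h1 h2]; split=> [[/h1]|f0].
  by apply: filterS => x /= /eq0_normc.
by congr (_%:C)%C; apply: h2; apply: filterS f0 => x /= ->; exact: normc0.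
Qed.

Definition Lp_complex : normedModType R[i] :=
  sn_quot (Seminormed cLp_normD cLp_normZ cLp_norm_eq0).

End complex.
End Lp.

Notation cLfunType mu p1 := (@cLfunType_ _ _ _ mu _ p1).

(* Main.v *)
Require Import Defs.
From HB Require Import structures.
From mathcomp Require Import all_boot all_order all_algebra.
From mathcomp Require Import cyclic separable cyclotomic complex.
From mathcomp Require Import all_classical all_reals all_analysis.
From mathcomp Require Import measurable_realfun ring lra.

Set Implicit Arguments.
Unset Strict Implicit.
Unset Printing Implicit Defensive.

Import Order.TTheory GRing.Theory Num.Theory.
Import numFieldNormedType.Exports.

Local Open Scope classical_set_scope.
Local Open Scope ring_scope.

(** The operator is perturbed by rank-one maps.  If [(x, xs)] almost attains the numerical radius
    of [T], put [T' = T + c w xs(.) x], with [w] the phase of [xs (T x)].  A pair [(z, zs)] which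
    almost attains the numerical radius of [T'] must have [|xs z|] close to [1]; after a rotation,
    uniform convexity makes [z] close to [x], and uniform smoothness makes [zs] close to [xs].  With
    geometrically decreasing [c] the iteration converges, and the limit operator attains its
    numerical radius.  Dividing it by its numerical radius is harmless as soon as the operator norm
    is bounded by a multiple of the numerical radius.

    For complex spaces such a bound comes from [|x - z T x| >= (1 - |z| v(T)) |x|], hence
    [|(1 + z T) x| <= (1 + |z|^2 |T|^2) / (1 - |z| v(T)) |x|]: the polynomial [(1 + z T)^m x] of [z]
    is bounded on the circle of radius [1/m], and Cauchy's estimate bounds its linear coefficient.

    For real [L_p], [p <> 2], splitting [f = a + b] with disjoint supports and testing the numerical
    radius on [a + t b], [t = 1, -1, 2, -2], bounds the integral of [|f|^(p-1) |T f|]; polarization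
    with functions comparable to a majorant of [|f|] and [|T f|] then bounds the norm of [T].

    Uniform convexity and smoothness of [L_p] are integrated scalar inequalities, which only use the
    parallelogram law and so hold for both scalar fields. *)

(** * Real and complex scalars *)

(** The final division is where the scalar field and [p] matter. Dividing the limit by its numerical
    radius [v] moves it by [|1 - v^-1|] times its norm, and [v(T) = 1] does not control that norm in
    general: on the real Hilbert plane a quarter turn has numerical radius 0, which is why [p = 2]
    is excluded over the reals. The order of quantifiers shapes the iteration. The tolerance
    required by a perturbation of size [c] depends on [c] and on the moduli of convexity and
    smoothness, never on [T]; so all tolerances, and with them [eta], are fixed before the operator
    is given. The functionals that bound the norm of [T] come from two sources. In complex spaces
    they are derivatives of the norm, which smoothness makes linear; in real L_p they are integrals
    against signed powers of functions, explicit on an arbitrary measure space. *)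

(* Both scalar fields are treated at once: [emb] embeds R into K, and [modulus] (hence [rnorm]) is
   the R-valued version of a norm with values in K. *)
Record real_scalars (R : realType) (K : numFieldType) := RealScalars {
  emb :> {rmorphism R -> K};
  modulus : K -> R;
  ler_emb : {mono emb : x y / x <= y};
  normE_modulus : forall z : K, `|z| = emb (modulus z);
  supremum_emb : forall A : set R, has_sup A ->
    supremum 0 [set emb x | x in A] = emb (sup A) }.

Arguments emb : simpl never.
Arguments modulus : simpl never.

Section real_norm.
Context (R : realType) (K : numFieldType) (s : real_scalars R K).
Implicit Types (r : R) (a b : K).

Lemma emb_inj : injective s.
Proof. by move=> x y xy; apply: le_anti; rewrite -!(ler_emb s) xy lexx. Qed.

Lemma ltr_emb : {mono s : x y / x < y}.
Proof. exact: leW_mono (ler_emb s). Qed.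

Lemma emb_ge0 r : (0 <= s r) = (0 <= r).
Proof. by rewrite -(rmorph0 s) ler_emb. Qed.

Lemma emb_gt0 r : (0 < s r) = (0 < r).
Proof. by rewrite -(rmorph0 s) ltr_emb. Qed.

Lemma modulus_ge0 a : 0 <= modulus s a.
Proof. by rewrite -emb_ge0 -(normE_modulus s). Qed.

Lemma modulus_emb r : modulus s (s r) = `|r|.
Proof.
apply: emb_inj; rewrite -(normE_modulus s); have [r0|r0] := leP 0 r.
  by rewrite !ger0_norm ?emb_ge0.
by rewrite (ltr0_norm r0) ltr0_norm ?rmorphN// -(rmorph0 s) ltr_emb.
Qed.

Lemma modulus0 : modulus s 0 = 0.
Proof. by rewrite -(rmorph0 s) modulus_emb normr0. Qed.

Lemma modulus1 : modulus s 1 = 1.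
Proof. by rewrite -(rmorph1 s) modulus_emb normr1. Qed.

Lemma modulusM a b : modulus s (a * b) = modulus s a * modulus s b.
Proof. by apply: emb_inj; rewrite rmorphM -!(normE_modulus s) normrM. Qed.

Lemma modulusN a : modulus s (- a) = modulus s a.
Proof. by apply: emb_inj; rewrite -!(normE_modulus s) normrN. Qed.

Lemma modulusD a b : modulus s (a + b) <= modulus s a + modulus s b.
Proof. by rewrite -(ler_emb s) rmorphD -!(normE_modulus s) ler_normD. Qed.

Lemma modulusB a b : modulus s (a - b) = modulus s (b - a).
Proof. by rewrite -modulusN opprB. Qed.

Lemma modulus_eq0 a : modulus s a = 0 -> a = 0.
Proof. by move=> a0; apply/eqP; rewrite -normr_eq0 (normE_modulus s) a0 rmorph0. Qed.

Lemma modulusV a : modulus s a^-1 = (modulus s a)^-1.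
Proof.
have [->|a0] := eqVneq a 0; first by rewrite invr0 modulus0 invr0.
have ma0 : modulus s a != 0 by apply: contra_neq a0 => /modulus_eq0.
by apply: (mulfI ma0); rewrite -modulusM !divff// modulus1.
Qed.

Lemma emb_modulus a : 0 <= a -> s (modulus s a) = a.
Proof. by move=> a0; rewrite -(normE_modulus s) ger0_norm. Qed.

Lemma modulus_gt0 a : 0 < a -> 0 < modulus s a.
Proof. by move=> a0; rewrite -emb_gt0 emb_modulus// ltW. Qed.

Lemma polar_form a : exists2 w, modulus s w = 1 & a = w * s (modulus s a).
Proof.
have [->|a0] := eqVneq a 0.
  by exists 1; rewrite ?modulus1// modulus0 rmorph0 mulr0.
have ma0 : modulus s a != 0 by apply: contra_neq a0 => /modulus_eq0.
exists (a / s (modulus s a)).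
  by rewrite modulusM modulusV modulus_emb ger0_norm ?modulus_ge0// divff.
by rewrite divfK// fmorph_eq0.
Qed.

(** [0 <= M] covers the empty set, whose supremum is 0 by default. *)
Lemma supremum_emb_le (A : set R) M : 0 <= M -> (forall x, A x -> x <= M) ->
  supremum 0 [set s x | x in A] <= s M.
Proof.
move=> M0 AM; have [->|/set0P A0] := eqVneq A set0.
  by rewrite image_set0 supremum0 emb_ge0.
by rewrite supremum_emb ?ler_emb ?ge_sup//; split => //; exists M => x /AM.
Qed.

Section normed_module.
Variable X : normedModType K.
Implicit Types x y z : X.

Definition rnorm x : R := modulus s `|x|.

Lemma emb_rnorm x : s (rnorm x) = `|x|.
Proof. by rewrite emb_modulus. Qed.

Lemma rnorm_ge0 x : 0 <= rnorm x. Proof. exact: modulus_ge0. Qed.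

Lemma rnorm0 : rnorm 0 = 0.
Proof. by rewrite /rnorm normr0 modulus0. Qed.

Lemma rnorm_eq0 x : rnorm x = 0 -> x = 0.
Proof. by move=> /modulus_eq0/normr0_eq0. Qed.

Lemma rnorm_gt0 x : x != 0 -> 0 < rnorm x.
Proof. by move=> x0; rewrite -emb_gt0 emb_rnorm normr_gt0. Qed.

Lemma rnormN x : rnorm (- x) = rnorm x.
Proof. by rewrite /rnorm normrN. Qed.

Lemma rnormB x y : rnorm (x - y) = rnorm (y - x).
Proof. by rewrite -rnormN opprB. Qed.

Lemma rnormD x y : rnorm (x + y) <= rnorm x + rnorm y.
Proof. by rewrite -(ler_emb s) rmorphD !emb_rnorm ler_normD. Qed.

Lemma rnormDB x y : rnorm x <= rnorm y + rnorm (x - y).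
Proof. by rewrite -{1}(subrK y x) addrC rnormD. Qed.

Lemma rnorm_trans y x z : rnorm (x - z) <= rnorm (x - y) + rnorm (y - z).
Proof. by rewrite -{1}(subrKA y) rnormD. Qed.

Lemma rnormZ a x : rnorm (a *: x) = modulus s a * rnorm x.
Proof. by apply: emb_inj; rewrite rmorphM !emb_rnorm -(normE_modulus s) normrZ. Qed.

Lemma rnormZr r x : rnorm (s r *: x) = `|r| * rnorm x.
Proof. by rewrite rnormZ modulus_emb. Qed.

End normed_module.

Lemma rnorm_regular (a : K) : rnorm (a : K^o) = modulus s a.
Proof. by apply: emb_inj; rewrite emb_rnorm (normE_modulus s). Qed.

Lemma continuous_rnorm_bound (X Y : normedModType K) (f : {linear X -> Y}) :
  continuous f -> exists2 M, 0 <= M & forall x, rnorm (f x) <= M * rnorm x.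
Proof.
move=> /linear_bounded_continuous/linear_boundedP/pinfty_ex_gt0[r r0 fr].
exists (modulus s r) => [|x]; first exact: modulus_ge0.
by rewrite -(ler_emb s) rmorphM !emb_rnorm emb_modulus; [exact: fr|exact: ltW].
Qed.

Lemma rnorm_bound_continuous (X Y : normedModType K) (f : {linear X -> Y}) M :
  (forall x, rnorm (f x) <= M * rnorm x) -> continuous f.
Proof.
move=> fM; apply/linear_bounded_continuous/linear_boundedP.
near=> r => x.
have r0 : s M <= r.
  near: r; apply: nbhs_pinfty_ge.
  by rewrite realE emb_ge0 -oppr_ge0 -rmorphN emb_ge0 oppr_ge0 le_total.
by rewrite (le_trans _ (ler_wpM2r _ r0))// -!emb_rnorm -rmorphM ler_emb.
Unshelve. all: by end_near. Qed.

Lemma op_norm_le (X Y : normedModType K) (f : X -> Y) M : 0 <= M ->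
  (forall x, rnorm (f x) <= M * rnorm x) -> op_norm f <= s M.
Proof.
move=> M0 fM; rewrite /op_norm.
rewrite (_ : [set _ | _ in _] =
  [set s r | r in [set rnorm (f x) | x in [set x | rnorm x <= 1]]]).
  apply: supremum_emb_le => // _ [x /= x1 <-].
  by rewrite (le_trans (fM x))// ler_piMr.
apply/seteqP; split => [_ [x /= x1 <-]|_ [_ [x /= x1 <-] <-]].
  exists (rnorm (f x)); last by rewrite emb_rnorm.
  by exists x => //=; rewrite -(ler_emb s) emb_rnorm rmorph1.
by exists x; rewrite ?emb_rnorm//= -emb_rnorm -(rmorph1 s) ler_emb.
Qed.

(** The value 1 at a unit vector already gives norm at least 1, so only the upper bound is left to
    state. Conversely, continuity makes the set of values bounded, hence its supremum a genuine one
    and not the default 0. *)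
Lemma op_norm1P (X : normedModType K) (f : {linear X -> K^o}) x :
  rnorm x = 1 -> f x = 1 ->
  (continuous f /\ op_norm f = 1) <-> forall h, modulus s (f h) <= rnorm h.
Proof.
move=> x1 fx1.
have opE : op_norm f = supremum 0 [set s r |
    r in [set modulus s (f x) | x in [set x : X | rnorm x <= 1]]].
  congr (supremum _ _); apply/seteqP; split.
    move=> _ [h /= h1 <-]; exists (modulus s (f h)); last by rewrite (normE_modulus s).
    by exists h => //=; rewrite -(ler_emb s) emb_rnorm rmorph1.
  move=> _ [_ [h /= h1 <-] <-]; exists h; last by rewrite -(normE_modulus s).
  by rewrite /= -emb_rnorm -(rmorph1 s) ler_emb.
have ne : [set modulus s (f x) | x in [set x : X | rnorm x <= 1]] !=set0.
  by exists (modulus s (f x)), x => //=; rewrite x1.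
split=> [[/continuous_rnorm_bound[M M0 fM]]|f1].
  rewrite opE supremum_emb; last first.
    split=> //; exists M => _ [h /= h1 <-].
    by rewrite -rnorm_regular (le_trans (fM h))// ler_piMr.
  move=> se h; have [->|h0] := eqVneq h 0.
    by rewrite linear0 modulus0 rnorm0.
  have := rnorm_gt0 h0 => rh0.
  have sup1 : sup [set modulus s (f x) | x in [set x : X | rnorm x <= 1]] = 1.
    by apply: emb_inj; rewrite se rmorph1.
  have : modulus s (f (s (rnorm h)^-1 *: h)) <= 1.
    rewrite -sup1; apply: ub_le_sup.
      exists M => _ [k /= k1 <-].
      by rewrite -rnorm_regular (le_trans (fM k))// ler_piMr.
    exists (s (rnorm h)^-1 *: h) => //=.
    by rewrite rnormZr ger0_norm ?invr_ge0 ?rnorm_ge0// mulVf// gt_eqF.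
  rewrite linearZ/= modulusM modulus_emb ger0_norm ?invr_ge0 ?rnorm_ge0//.
  by rewrite ler_pdivrMl// mulr1.
split.
  apply: (@rnorm_bound_continuous X K^o f 1) => h.
  by rewrite rnorm_regular mul1r.
have ub : ubound [set modulus s (f x) | x in [set x : X | rnorm x <= 1]] 1.
  by move=> _ [h /= h1 <-]; exact: le_trans h1.
rewrite opE supremum_emb; last by split=> //; exists 1.
rewrite -[RHS](rmorph1 s); congr (s _); apply/eqP; rewrite eq_le ge_sup//=.
by apply: ub_le_sup; [exists 1|exists x => //=; rewrite ?x1// fx1 modulus1].
Qed.

End real_norm.

Arguments rnorm : simpl never.

(** * Dual pairs and the numerical radius *)

Section numerical_radius_attainment.
Context (R : realType) (K : numFieldType) (s : real_scalars R K).

Local Notation "|: x :|" := (rnorm s x) (format "|: x :|").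
Local Notation modu := (modulus s).

(* Completeness, tested on sequences with geometrically small steps. *)
Definition complete_rnorm (X : normedModType K) := forall (u : nat -> X) (c : R),
  (forall n, |:u n - u n.+1:| <= c / 2 ^+ n) ->
  exists l, forall n, |:u n - l:| <= c *+ 2 / 2 ^+ n.

Definition rconvex (X : normedModType K) := forall e : R, 0 < e ->
  exists2 d, 0 < d & forall x y : X, |:x:| = 1 -> |:y:| = 1 ->
    e <= |:x - y:| -> |:x + y:| <= 2 - d.

Definition rsmooth (X : normedModType K) := forall e : R, 0 < e ->
  exists2 d, 0 < d & forall x y : X, |:x:| = 1 -> |:y:| <= d ->
    |:x + y:| + |:x - y:| <= 2 + e * |:y:|.

Definition mkLinear (U V : lmodType K) (f : U -> V) (lf : linear f) :
  {linear U -> V} := HB.pack f (GRing.isLinear.Build K U V *:%R f lf).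

Lemma geometric_small (c e : R) : 0 < e ->
  exists N, forall n, (N <= n)%N -> c / 2 ^+ n <= e.
Proof.
move=> e0; have c1 : 0 < 1 + `|c| by rewrite ltr_pwDl.
have [N _ hN] := near_infty_natSinv_expn_lt (PosNum (divr_gt0 e0 c1)).
exists N => n /hN/=; rewrite ltr_pdivlMr// div1r => lN.
have i0 : 0 <= (2 ^+ n)^-1 :> R by rewrite invr_ge0 exprn_ge0.
rewrite (le_trans _ (ltW lN))// mulrC ler_wpM2l//.
by rewrite (le_trans (ler_norm c))// lerDr.
Qed.

Lemma le_geometric (a b c : R) : (forall n, a <= b + c / 2 ^+ n) -> a <= b.
Proof.
move=> h; apply/ler_addgt0Pr => e /(geometric_small c)[N hN].
by rewrite (le_trans (h N))// lerD2l hN.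
Qed.

Lemma rnorm_limit_eq (X : normedModType K) (c : R) (x y : X) :
  (forall n, |:x - y:| <= c / 2 ^+ n) -> x = y.
Proof.
move=> h; apply/eqP; rewrite -subr_eq0; apply/eqP/(rnorm_eq0 (s := s)).
apply/eqP; rewrite eq_le rnorm_ge0 andbT.
by apply: (@le_geometric _ _ c) => n; rewrite add0r.
Qed.

Variable X : normedModType K.
Implicit Types (T S : {linear X -> X}) (x y z h : X) (xs ys zs : {linear X -> K^o}).

Lemma functionalZ xs (a : K) h : xs (a *: h) = a * xs h.
Proof. by rewrite linearZ. Qed.

Definition dual_pair x xs :=
  [/\ |:x:| = 1, forall h, modu (xs h) <= |:h:| & xs x = 1].

Lemma Pi_setP x xs : Pi_set (x, xs) <-> dual_pair x xs.
Proof.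
split=> [[/= x1 cxs n1 xsx]|[x1 nx xsx]].
  have x1' : |:x:| = 1 by apply: (@emb_inj _ _ s); rewrite emb_rnorm x1 rmorph1.
  by split=> //; apply/(op_norm1P x1' xsx).
have [cxs n1] := (op_norm1P x1 xsx).2 nx.
by split=> //=; rewrite -(emb_rnorm s) x1 rmorph1.
Qed.

Lemma num_radiusE T : num_radius T = supremum 0 [set s r |
  r in [set modu (z.2 (T z.1)) | z in [set z | dual_pair z.1 z.2]]].
Proof.
congr (supremum _ _); apply/seteqP; split.
  move=> _ [[x xs] /Pi_setP px <-]; exists (modu (xs (T x))).
    by exists (x, xs).
  by rewrite -(normE_modulus s).
move=> _ [_ [[x xs] px <-] <-]; exists (x, xs); first exact/Pi_setP.
by rewrite -(normE_modulus s).
Qed.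

Lemma dual_pair_le x xs T M : dual_pair x xs ->
  (forall h, |:T h:| <= M * |:h:|) -> modu (xs (T x)) <= M.
Proof.
by move=> [x1 nx _] TM; rewrite (le_trans (nx _))// (le_trans (TM _))// x1 mulr1.
Qed.

Lemma num_radius_eq T M x xs : dual_pair x xs ->
  (forall h, |:T h:| <= M * |:h:|) ->
  num_radius T = s (sup [set modu (z.2 (T z.1)) | z in [set z | dual_pair z.1 z.2]]).
Proof.
move=> px TM; rewrite num_radiusE supremum_emb//; split.
  by exists (modu (xs (T x))), (x, xs).
exists M => _ [[y ys] py <-]; exact: dual_pair_le TM.
Qed.

Lemma num_radius_ub T M x xs : dual_pair x xs ->
  (forall h, |:T h:| <= M * |:h:|) -> s (modu (xs (T x))) <= num_radius T.
Proof.
move=> px TM; rewrite (num_radius_eq px TM) ler_emb; apply: ub_le_sup.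
  by exists M => _ [[y ys] py <-]; exact: dual_pair_le TM.
by exists (x, xs).
Qed.

Lemma num_radius_attained T x xs : dual_pair x xs ->
  (forall z zs, dual_pair z zs -> modu (zs (T z)) <= modu (xs (T x))) ->
  num_radius T = s (modu (xs (T x))).
Proof.
move=> px Tx; rewrite num_radiusE supremum_emb.
  congr (s _); apply/eqP; rewrite eq_le ge_sup//=.
  - by apply: ub_le_sup; [exists (modu (xs (T x))) => _ [[z zs] pz <-]; exact: Tx|exists (x, xs)].
  - by exists (modu (xs (T x))), (x, xs).
  - by move=> _ [[z zs] pz <-]; exact: Tx.
split; first by exists (modu (xs (T x))), (x, xs).
by exists (modu (xs (T x))) => _ [[z zs] pz <-]; exact: Tx.
Qed.

Lemma dual_pair_near_sup T M x xs e : 0 < e -> dual_pair x xs ->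
  (forall h, |:T h:| <= M * |:h:|) ->
  exists z zs, [/\ dual_pair z zs, modu (xs (T x)) <= modu (zs (T z)) + e &
    forall y ys, dual_pair y ys -> modu (ys (T y)) < modu (zs (T z)) + e].
Proof.
move=> e0 px TM.
set E := [set modu (z.2 (T z.1)) | z in [set z | dual_pair z.1 z.2]].
have Eub : has_ubound E by exists M => _ [[y ys] py <-]; exact: dual_pair_le TM.
have supE : has_sup E by split=> //; exists (modu (xs (T x))), (x, xs).
have [_ [[z zs] /= pz <-] zsup] := sup_adherent e0 supE.
have near y ys : dual_pair y ys -> modu (ys (T y)) < modu (zs (T z)) + e.
  move=> py; rewrite -ltrBlDr (le_lt_trans _ zsup)// lerD2r.
  by apply: ub_le_sup => //; exists (y, ys).
by exists z, zs; split => //; exact/ltW/near.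
Qed.

Hypotheses (convX : rconvex X) (smoothX : rsmooth X).

(** If [xs z] is close to 1, then [|x + z| >= xs (x + z)] is close to 2 and convexity brings [z]
    near [x]. For the functionals, [xs (x + k) + zs (x - k) <= |x + k| + |x - k|], where the left
    side is [1 + zs x + (xs - zs) k] and smoothness bounds the right side; so [(xs - zs) k] is small
    for every [k] of norm [d]. *)
Lemma dual_pair_close c : 0 < c -> exists2 b, 0 < b &
  forall x xs z zs t, dual_pair x xs -> dual_pair z zs -> xs z = s t -> 1 - b <= t ->
    |:x - z:| <= c /\ forall h, modu (xs h - zs h) <= c * |:h:|.
Proof.
move=> c0; have [d d0 hd] := smoothX (divr_gt0 c0 (ltr0Sn R 1)).
(* The target for [(xs - zs) k] is [c * d]: one half is the smoothness error [c / 2 * d], the other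
   half is allotted to [|x - z|]. *)
have ed0 : 0 < Num.min c (c / 2 * d) by rewrite lt_min c0 mulr_gt0 ?divr_gt0.
have [b b0 hb] := convX ed0.
exists (b / 2); first by rewrite divr_gt0.
move=> x xs z zs t [x1 nxs xsx] [z1 nzs zsz] xsz tb.
have : |:x - z:| < Num.min c (c / 2 * d).
  rewrite ltNge; apply/negP => /(hb _ _ x1 z1); apply/negP; rewrite -ltNge.
  apply: (lt_le_trans _ (nxs _)); rewrite linearD xsx xsz -(rmorph1 s) -rmorphD.
  rewrite modulus_emb; apply: lt_le_trans (ler_norm _); lra.
rewrite lt_min => /andP[/ltW xzc /ltW xzd]; split=> // h.
have [->|h0] := eqVneq h 0; first by rewrite !linear0 addr0 modulus0 rnorm0 mulr0.
have rh0 := rnorm_gt0 s h0.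
have [w w1 hw] := polar_form s (xs h - zs h).
set m := modu (xs h - zs h) in hw *.
have w0 : w != 0 by apply/eqP => w0; move: w1; rewrite w0 modulus0 => /esym/eqP; rewrite oner_eq0.
(* The multiple of [h] of norm exactly [d] at which [xs - zs] is real and nonnegative. *)
pose k := (w^-1 * s (d / |:h:|)) *: h.
have nk : |:k:| = d.
  rewrite rnormZ modulusM modulusV w1 invr1 mul1r modulus_emb ger0_norm ?divr_ge0 ?ltW//.
  by rewrite divfK ?gt_eqF.
have := hd x k x1; rewrite nk => /(_ (lexx _)) le2.
have ek : xs k - zs k = s (d / |:h:| * m).
  by rewrite !functionalZ -mulrBr hw [RHS]rmorphM mulrACA mulVf// mul1r.
have zsx : zs x = 1 + zs (x - z) by rewrite linearB/= zsz addrC subrK.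
have : 2 + d / |:h:| * m <= |:x + k:| + |:x - k:| + |:x - z:|.
  have e2 : s (2 + d / |:h:| * m) = xs (x + k) + zs (x - k) - zs (x - z).
    rewrite rmorphD -ek !(linearD, linearN)/= xsx zsz rmorphD rmorph1; ring.
  have -> : 2 + d / |:h:| * m = modu (s (2 + d / |:h:| * m)).
    by rewrite modulus_emb ger0_norm// addr_ge0// mulr_ge0 ?modulus_ge0// divr_ge0 ?ltW.
  rewrite e2 (le_trans (modulusD _ _ _))// modulusN lerD//.
  by rewrite (le_trans (modulusD _ _ _))// lerD.
move=> le3.
have : d / |:h:| * m <= c * d by lra.
by rewrite mulrAC ler_pdivrMr// [c * d]mulrC -mulrA ler_pM2l.
Qed.

End numerical_radius_attainment.

(** * Perturbation *)

Section perturbation.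
Context (R : realType) (K : numFieldType) (s : real_scalars R K).

Local Notation "|: x :|" := (rnorm s x) (format "|: x :|").
Local Notation modu := (modulus s).

Lemma linear_limit (X Y : normedModType K) (f : nat -> {linear X -> Y}) (c : R) :
  complete_rnorm s Y ->
  (forall n h, |:f n h - f n.+1 h:| <= c / 2 ^+ n * |:h:|) ->
  exists F : {linear X -> Y}, forall n h, |:f n h - F h:| <= c *+ 2 / 2 ^+ n * |:h:|.
Proof.
move=> cY fc.
have /choice[F hF] : forall h, exists l, forall n, |:f n h - l:| <= c *+ 2 / 2 ^+ n * |:h:|.
  move=> h; have [|l hl] := cY (f ^~ h) (c * |:h:|).
    by move=> n; rewrite mulrAC.
  by exists l => n; rewrite (le_trans (hl n))// -mulrnAl mulrAC.
have linF : linear F.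
  move=> a x y; apply: (@rnorm_limit_eq _ _ s _
    (c *+ 2 * (|:a *: x + y:| + modu a * |:x:| + |:y:|))) => n.
  have -> : F (a *: x + y) - (a *: F x + F y) = (a *: (f n x - F x) + (f n y - F y))
     - (f n (a *: x + y) - F (a *: x + y)).
    by rewrite linearP scalerBr addrACA -opprD opprB [RHS]addrC addrA subrK.
  rewrite (le_trans (rnormD _ _ _))// rnormN.
  rewrite (le_trans (lerD (rnormD _ _ _) (hF _ _)))// rnormZ.
  rewrite (le_trans (lerD (lerD (ler_wpM2l (modulus_ge0 _ _) (hF _ _)) (hF _ _)) (lexx _)))//.
  rewrite le_eqVlt; apply/orP; left; apply/eqP; ring.
by exists (mkLinear linF).
Qed.

Variable X : normedModType K.
Implicit Types (T S : {linear X -> X}) (x y z h : X) (xs ys zs : {linear X -> K^o}).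

Definition state : Type := {linear X -> X} * X * {linear X -> K^o}.

Definition almost_attains (g : R) (a : state) := let: (T, x, xs) := a in
  [/\ exists M, forall h, |:T h:| <= M * |:h:|, dual_pair s x xs &
    forall z zs, dual_pair s z zs -> modu (zs (T z)) < modu (xs (T x)) + g].

Definition state_close (c : R) (a b : state) :=
  let: (T, x, xs) := a in let: (U, y, ys) := b in
  [/\ forall h, |:T h - U h:| <= c * |:h:|, |:x - y:| <= c &
      forall h, modu (xs h - ys h) <= c * |:h:|].

Lemma almost_attainsW g g' a : g <= g' -> almost_attains g a -> almost_attains g' a.
Proof.
case: a => [[T x] xs] gg' [TM px Tx]; split=> // z zs pz.
by rewrite (lt_le_trans (Tx z zs pz))// lerD2l.
Qed.

Hypotheses (convX : rconvex s X) (smoothX : rsmooth s X).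
Hypotheses (complX : complete_rnorm s X) (complK : complete_rnorm s K^o).

(** The phase [w] makes the value at [(x, xs)] grow by the full [c], while at [(z, zs)] it grows by
    at most [c |xs z|]. Since [(x, xs)] is nearly maximal for [T] and [(z, zs)] for [T'], with
    errors at most [b * c / 2] each, [1 - |xs z|] is at most [b], the closeness demanded by
    [dual_pair_close]. The next tolerance [g'] is free, so the step can be iterated. *)
Lemma perturbation_step c : 0 < c -> exists2 g, 0 < g & forall g', 0 < g' ->
  forall a, almost_attains g a ->
  exists2 b, almost_attains g' b & state_close c a b.
Proof.
move=> c0; have [b b0 close] := dual_pair_close convX smoothX c0.
exists (b * c / 2); first by rewrite divr_gt0 ?mulr_gt0.
move=> g' g'0 [[T x] xs] [[M TM] px Tx].
have [x1 nxs xsx] := px.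
have [w w1 Tw] := polar_form s (xs (T x)).
have linT' : linear (fun h => T h + (s c * w * xs h) *: x).
  move=> a h k; rewrite linearP linearD/= functionalZ scalerDr addrACA; congr (_ + _).
  by rewrite mulrDr scalerDl; congr (_ + _); rewrite scalerA; congr (_ *: _); ring.
pose T' := mkLinear linT'.
have T'E h : T' h = T h + (s c * w * xs h) *: x by [].
have nT h : |:T h - T' h:| <= c * |:h:|.
  rewrite T'E opprD addNKr rnormN rnormZ !modulusM modulus_emb w1 x1 !mulr1 gtr0_norm//.
  by rewrite ler_pM2l.
have T'M h : |:T' h:| <= (M + c) * |:h:|.
  rewrite mulrDl; apply: le_trans (lerD (TM h) (nT h)).
  by rewrite rnormB rnormDB.
pose g := Num.min g' (b * c / 2).
have g0 : 0 < g by rewrite lt_min g'0 divr_gt0 ?mulr_gt0.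
have [z [zs [pz zx zmax]]] := dual_pair_near_sup g0 px T'M.
have [z1 nzs zsz] := pz.
have xT'x : modu (xs (T' x)) = modu (xs (T x)) + c.
  rewrite T'E linearD functionalZ xsx !mulr1 {1}Tw [s c * w]mulrC -mulrDr modulusM w1.
  by rewrite mul1r -rmorphD modulus_emb ger0_norm// addr_ge0 ?modulus_ge0// ltW.
have zT'z : modu (zs (T' z)) <= modu (zs (T z)) + c * modu (xs z).
  rewrite T'E linearD functionalZ (le_trans (modulusD _ _ _))// lerD2l.
  rewrite !modulusM modulus_emb w1 mulr1 gtr0_norm// -[leRHS]mulr1.
  rewrite ler_wpM2l//; first by rewrite mulr_ge0 ?modulus_ge0// ltW.
  by rewrite (le_trans (nzs x))// x1.
have bz : 1 - b <= modu (xs z).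
  have := Tx z zs pz; have : g <= b * c / 2 by rewrite ge_min lexx orbT.
  rewrite -(ler_pM2l c0); move: xT'x zT'z zx; nra.
(* The rotated pair [(v^-1 z, v zs)] is again dual and has the same value under [T']; on it [xs]
   takes the nonnegative real value [|xs z|], as [dual_pair_close] requires. *)
have [v v1 xsz] := polar_form s (xs z).
have v0 : v != 0.
  by apply/eqP => v0; move: v1; rewrite v0 modulus0 => /esym/eqP; rewrite oner_eq0.
have linzs' : linear (fun h => v * zs h : K^o).
  by move=> a h k; rewrite linearD/= functionalZ mulrDr mulrCA.
pose zs' := mkLinear linzs'.
have zs'E h : zs' h = v * zs h by [].
have pz' : dual_pair s (v^-1 *: z) zs'.
  split; first by rewrite rnormZ modulusV v1 invr1 mul1r.
    by move=> h; rewrite zs'E modulusM v1 mul1r.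
  by rewrite functionalZ zs'E zsz mulr1 mulVf.
have vals : modu (zs' (T' (v^-1 *: z))) = modu (zs (T' z)).
  have -> : T' (v^-1 *: z) = v^-1 *: T' z by exact: linearZ.
  by rewrite zs'E functionalZ mulrA divff// mul1r.
exists (T', v^-1 *: z, zs').
  apply: (@almost_attainsW g); first by rewrite ge_min lexx.
  split=> //; first by exists (M + c).
  by move=> y ys py; rewrite vals zmax.
have [|? ?] := close _ _ _ _ (modu (xs z)) px pz' _ bz.
  by rewrite functionalZ {1}xsz mulrA mulVf// mul1r.
by split.
Qed.

(** Steps of size [c / 2 / 2 ^+ n] add up to [c]. The tolerance [g n] serves two purposes: it is
    small enough for the next perturbation, and it tends to 0, so that near-maximality becomes
    maximality in the limit. *)
Lemma attaining_limit c : 0 < c -> exists2 g, 0 < g & forall a, almost_attains g a ->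
  exists S y ys, [/\ exists M, forall h, |:S h:| <= M * |:h:|, dual_pair s y ys,
    forall z zs, dual_pair s z zs -> modu (zs (S z)) <= modu (ys (S y)) &
    state_close c a (S, y, ys)].
Proof.
move=> c0.
have cn n : 0 < c / 2 / 2 ^+ n by rewrite !divr_gt0 ?exprn_gt0.
have /choice[g0 hg0] : forall n, exists g, 0 < g /\ forall g', 0 < g' ->
    forall a, almost_attains g a ->
    exists2 b, almost_attains g' b & state_close (c / 2 / 2 ^+ n) a b.
  by move=> n; have [g g0 hg] := perturbation_step (cn n); exists g.
pose g n := Num.min (g0 n) (c / 2 / 2 ^+ n).
have gp n : 0 < g n by rewrite lt_min cn (hg0 n).1.
(* A state that is not almost attaining is sent to itself, a dummy value: the sequence [st] never
   meets such a state. *)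
have /choice[next hnext] : forall na : nat * state, exists b, almost_attains (g na.1) na.2 ->
    almost_attains (g na.1.+1) b /\ state_close (c / 2 / 2 ^+ na.1) na.2 b.
  move=> [n a]; have [an|an] := pselect (almost_attains (g n) a); last by exists a.
  have [|b ? ?] := (hg0 n).2 (g n.+1) (gp _) a.
    by apply: almost_attainsW an; rewrite ge_min lexx.
  by exists b.
exists (g 0%N); first exact: gp.
move=> a0 att0.
pose st := fix st n := if n is m.+1 then next (m, st m) else a0.
have att n : almost_attains (g n) (st n).
  by elim: n => // n IH; have [] := hnext (n, st n) IH.
have cl n : state_close (c / 2 / 2 ^+ n) (st n) (st n.+1).
  by have [] := hnext (n, st n) (att n).
pose Tn n : {linear X -> X} := (st n).1.1.
pose xn n : X := (st n).1.2.
pose fn n : {linear X -> K^o} := (st n).2.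
have stE n : st n = (Tn n, xn n, fn n) by rewrite /Tn /xn /fn; case: (st n) => [[]].
have {}cl n : [/\ forall h, |:Tn n h - Tn n.+1 h:| <= c / 2 / 2 ^+ n * |:h:|,
    |:xn n - xn n.+1:| <= c / 2 / 2 ^+ n &
    forall h, modu (fn n h - fn n.+1 h) <= c / 2 / 2 ^+ n * |:h:|].
  by have := cl n; rewrite !stE.
have {}att n : [/\ exists M, forall h, |:Tn n h:| <= M * |:h:|, dual_pair s (xn n) (fn n) &
    forall z zs, dual_pair s z zs -> modu (zs (Tn n z)) < modu (fn n (Tn n (xn n))) + g n].
  by have := att n; rewrite stE.
have c2 : c / 2 *+ 2 = c by rewrite -mulr_natr divfK.
have [S hS] : exists S : {linear X -> X}, forall n h, |:Tn n h - S h:| <= c / 2 ^+ n * |:h:|.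
  by rewrite -{1}c2; apply: linear_limit => // n h; have [] := cl n.
have [ys hys] : exists ys : {linear X -> K^o},
    forall n h, modu (fn n h - ys h) <= c / 2 ^+ n * |:h:|.
  have [n h|F hF] := @linear_limit X K^o fn (c / 2) complK.
    by rewrite rnorm_regular; have [] := cl n.
  by exists F => n h; rewrite -rnorm_regular -{1}c2.
have [y hy] : exists y, forall n, |:xn n - y:| <= c / 2 ^+ n.
  by rewrite -{1}c2; apply: complX => n; have [] := cl n.
have nys h : modu (ys h) <= |:h:|.
  apply: (@le_geometric _ _ _ (c * |:h:|)) => n.
  have [_ [_ /(_ h) nx _] _] := att n.
  rewrite -(subrK (fn n h) (ys h)) addrC (le_trans (modulusD _ _ _))// lerD//.
  by rewrite modulusB mulrAC.
have py : dual_pair s y ys.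
  split=> //.
    have h1 n : |:xn n:| = 1 by have [_ []] := att n.
    apply/eqP; rewrite eq_le; apply/andP; split.
      apply: (@le_geometric _ _ _ c) => n.
      by have := rnormDB s y (xn n); rewrite h1 rnormB => /le_trans; apply; rewrite lerD2l.
    apply: (@le_geometric _ _ _ c) => n.
    by have := rnormDB s (xn n) y; rewrite h1 => /le_trans; apply; rewrite lerD2l.
  apply/esym/(@rnorm_limit_eq _ _ s _ (c + c)) => n; rewrite rnorm_regular.
  have [_ [x1 nx fx] _] := att n.
  have -> : 1 - ys y = (fn n (xn n) - ys (xn n)) + ys (xn n - y).
    by rewrite fx linearB/= addrA subrK.
  rewrite (le_trans (modulusD _ _ _))// mulrDl lerD//.
    by have := hys n (xn n); rewrite x1 mulr1.
  exact: le_trans (nys _) (hy n).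
have [M0 T0M] : exists M, forall h, |:Tn 0%N h:| <= M * |:h:| by have [] := att 0%N.
have SM h : |:S h:| <= (M0 + c) * |:h:|.
  rewrite mulrDl; apply: le_trans (lerD (T0M h) (le_trans (hS 0%N h) _)).
    by rewrite rnormB rnormDB.
  by rewrite expr0 divr1.
have pn n : 1 <= 2 ^+ n :> R by rewrite exprn_ege1// ler1n.
have ci n : 0 <= c / 2 ^+ n by apply: divr_ge0; [exact: ltW|exact: exprn_ge0].
have c2n n : c / 2 ^+ n <= c by rewrite ler_pdivrMr ?exprn_gt0// ler_peMr// ltW.
exists S, y, ys; split=> //; first by exists (M0 + c).
  move=> z zs pz.
  (* Three errors [c / 2 ^+ n] come from replacing [S] by [Tn n] at [z], from [g n], and from
     replacing [Tn n] by [S] at [xn n]. The terms in [M0] come from moving [fn n] to [ys] and [xn n]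
     to [y]. *)
  apply: (@le_geometric _ _ _ (c *+ 3 + c * (M0 *+ 2 + c *+ 3))) => n.
  have [z1 nz _] := pz; have [_ [x1 nx _] /(_ z zs pz) zT] := att n.
  have xTx : modu (fn n (Tn n (xn n))) <= modu (ys (S y)) +
      (c / 2 ^+ n * (M0 + c + c) + c / 2 ^+ n + (M0 + c) * (c / 2 ^+ n)).
    have -> : fn n (Tn n (xn n)) = ys (S y) + ((fn n (Tn n (xn n)) - ys (Tn n (xn n)))
        + ys (Tn n (xn n) - S (xn n)) + ys (S (xn n - y))).
      by rewrite !linearB/=; ring.
    rewrite (le_trans (modulusD _ _ _))// lerD2l.
    rewrite (le_trans (modulusD _ _ _))// lerD//.
      rewrite (le_trans (modulusD _ _ _))// lerD//.
        rewrite (le_trans (hys _ _))// ler_wpM2l//.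
        rewrite (le_trans (rnormDB _ _ (S (xn n))))// lerD//.
          by have := SM (xn n); rewrite x1 mulr1.
        by rewrite (le_trans (hS _ _))// x1 mulr1.
      by rewrite (le_trans (nys _))// (le_trans (hS _ _))// x1 mulr1.
    rewrite (le_trans (nys _))// (le_trans (SM _))// ler_wpM2l//.
    have := rnorm_ge0 s (S (xn n)); have := SM (xn n); rewrite x1 mulr1 => h1 h2.
    exact: le_trans h2 h1.
  have zS : modu (zs (S z)) <= modu (zs (Tn n z)) + c / 2 ^+ n.
    rewrite -(subrK (zs (Tn n z)) (zs (S z))) addrC (le_trans (modulusD _ _ _))// lerD2l.
    by rewrite -linearB (le_trans (nz _))// rnormB (le_trans (hS _ _))// z1 mulr1.
  have gn : g n <= c / 2 ^+ n.
    rewrite ge_min; apply/orP; right.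
    by rewrite ler_pM2r ?invr_gt0 ?exprn_gt0// ler_pdivrMr// ler_peMr ?ltW// ltr1n.
  set i := (2 ^+ n)^-1 in xTx zS gn *; lra.
have st0 : a0 = (Tn 0%N, xn 0%N, fn 0%N) by rewrite -stE.
rewrite st0; split.
- by move=> h; have := hS 0%N h; rewrite expr0 divr1.
- by have := hy 0%N; rewrite expr0 divr1.
- by move=> h; have := hys 0%N h; rewrite expr0 divr1.
Qed.

(** The index hypothesis bounds the operator norm once the numerical radius is at most 1. It is
    applied to [T], and the norm of the limit operator is then at most [C + k]. *)
Theorem BPBp_nu_of_index (C : R) : 0 <= C ->
  (forall T, (exists M, forall h, |:T h:| <= M * |:h:|) ->
     (forall x xs, dual_pair s x xs -> modu (xs (T x)) <= 1) ->
     forall h, |:T h:| <= C * |:h:|) ->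
  BPBp_nu X.
Proof.
move=> C0 index eps eps0 eps1.
pose e := modu eps.
have epsE : eps = s e by rewrite emb_modulus ?ltW.
have e0 : 0 < e by exact: modulus_gt0.
have e1 : e < 1 by rewrite -(ltr_emb s) -epsE rmorph1.
have den0 : 0 < C *+ 2 + 4 by rewrite ltr_wpDl ?mulrn_wge0.
(* The distance from [T] to [S] is at most [k + 2k(C + k)]: [k] for the iteration, then
   [|1 - v^-1| <= 2k] times the norm of [S0], with [v] between [1 - k] and [1 + k]. As [4k < 1],
   this stays below [k(2C + 4)]. *)
pose k := e / (C *+ 2 + 4).
have k0 : 0 < k by rewrite divr_gt0.
have kE : k * (C *+ 2 + 4) = e by rewrite divfK// gt_eqF.
have k4 : k * 4 < 1 by apply: le_lt_trans e1; nra.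
have [g g0 hg] := attaining_limit k0.
exists (s g); first by rewrite emb_gt0.
move=> T x xs cT /(Pi_setP s) px vT xT.
have [M M0 TM] := continuous_rnorm_bound s cT.
have T1 z zs : dual_pair s z zs -> modu (zs (T z)) <= 1.
  by move=> pz; rewrite -(ler_emb s) rmorph1 -vT; exact: num_radius_ub TM.
have TC := index T (ex_intro _ M TM) T1.
have att : almost_attains g (T, x, xs).
  split=> //; first by exists M.
  move=> z zs /T1 h; rewrite (le_lt_trans h)// -ltrBlDr -(ltr_emb s) rmorphB rmorph1.
  by rewrite -(normE_modulus s).
have [S0 [y [ys [[M' SM] py Sy [TS xy xsys]]]]] := hg _ att.
have [y1 nys ysy] := py.
pose v := modu (ys (S0 y)).
have vge : 1 - k <= v.
  rewrite lerBlDr -(ler_emb s) rmorph1 -vT (num_radius_eq px TM) ler_emb.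
  apply: ge_sup; first by exists (modu (xs (T x))), (x, xs).
  move=> _ [[z zs] /= pz <-]; have [z1 nz _] := pz.
  rewrite -(subrK (zs (S0 z)) (zs (T z))) addrC (le_trans (modulusD _ _ _))// lerD ?Sy//.
  by rewrite -linearB (le_trans (nz _))// (le_trans (TS _))// z1 mulr1.
have vle : v <= 1 + k.
  rewrite /v -(subrK (ys (T y)) (ys (S0 y))) addrC (le_trans (modulusD _ _ _))// lerD ?T1//.
  by rewrite -linearB (le_trans (nys _))// rnormB (le_trans (TS _))// y1 mulr1.
have v0 : 0 < v by lra.
have linS : linear (fun h => s v^-1 *: S0 h).
  by move=> a h l; rewrite linearP scalerDr !scalerA mulrC.
pose S := mkLinear linS.
have SE h : S h = s v^-1 *: S0 h by [].
have S1 : modu (ys (S y)) = 1.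
  by rewrite SE functionalZ modulusM modulus_emb gtr0_norm ?invr_gt0// mulVf// gt_eqF.
exists S, y, ys; split.
- apply: (@rnorm_bound_continuous _ _ s _ _ _ (v^-1 * M')) => h.
  by rewrite SE rnormZr gtr0_norm ?invr_gt0// -mulrA ler_pM2l ?invr_gt0.
- exact/(Pi_setP s).
- split; last by rewrite [LHS](normE_modulus s) S1 rmorph1.
  rewrite (num_radius_attained py) ?S1 ?rmorph1// => z zs pz.
  rewrite SE functionalZ modulusM modulus_emb gtr0_norm ?invr_gt0//.
  by rewrite mulrC ler_pdivrMr// mul1r Sy.
- apply: (@le_lt_trans _ _ (s (k + k *+ 2 * (C + k)))).
    apply: op_norm_le => [|h]; first nra.
    rewrite (le_trans (rnorm_trans s (S0 h) _ _))// mulrDl lerD// ?TS//.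
    rewrite SE -{1}(scale1r (S0 h)) -scalerBl -(rmorph1 s) -rmorphB rnormZr -mulrA.
    have hv : `|1 - v^-1| <= k *+ 2.
      have iv : v * v^-1 = 1 by rewrite divff// gt_eqF.
      have iv0 : 0 < v^-1 by rewrite invr_gt0.
      rewrite ler_norml; apply/andP; split; nra.
    apply: ler_pM => //; first exact: rnorm_ge0.
    rewrite mulrDl (le_trans (rnormDB _ _ (T h)))// rnormB.
    by rewrite lerD ?TC ?TS.
  by rewrite epsE ltr_emb; nra.
split; first by rewrite -(emb_rnorm s) epsE ltr_emb (le_lt_trans xy)//; nra.
apply: (@le_lt_trans _ _ (s k)); last by rewrite epsE ltr_emb; nra.
by apply: op_norm_le => [|h]; [exact: ltW|rewrite rnorm_regular].
Qed.

End perturbation.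

(** * Completeness *)

Section completeness.
Context (R : realType) (K : numFieldType) (s : real_scalars R K).
Variable X : normedModType K.

Local Notation "|: x :|" := (rnorm s x) (format "|: x :|").

Lemma geometric_dist (u : nat -> X) (c : R) :
  (forall n, |:u n - u n.+1:| <= c / 2 ^+ n) ->
  forall n k, |:u n - u (n + k)%N:| <= c *+ 2 / 2 ^+ n - c *+ 2 / 2 ^+ (n + k).
Proof.
move=> hu n; elim=> [|k IH]; first by rewrite addn0 !subrr rnorm0.
rewrite addnS; apply: le_trans (rnorm_trans s (u (n + k)%N) _ _) _.
apply: le_trans (lerD IH (hu _)) _.
by rewrite -addrA lerD2l exprS invfM; set i := (2 ^+ _)^-1; lra.
Qed.

(** A sequence with geometric steps stays within [c *+ 2 / 2 ^+ n] of all its later terms, so a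
    point approached along arbitrarily large indices is a limit with that rate. *)
Lemma complete_rnorm_cluster :
  (forall (u : nat -> X) (c : R), (forall n, |:u n - u n.+1:| <= c / 2 ^+ n) ->
    exists l, forall e, 0 < e -> forall n, exists2 m, (n <= m)%N & |:u m - l:| <= e) ->
  complete_rnorm s X.
Proof.
move=> h u c hu; have [l hl] := h u c hu; exists l => n.
have c0 : 0 <= c by have := hu 0%N; rewrite expr0 divr1; apply: le_trans; exact: rnorm_ge0.
apply/ler_addgt0Pr => e e0; have [m nm um] := hl e e0 n.
rewrite (le_trans (rnorm_trans s (u m) _ _))// lerD//.
have := geometric_dist hu n (m - n); rewrite subnKC// => /le_trans; apply.
by rewrite gerBl divr_ge0 ?mulrn_wge0 ?exprn_ge0.
Qed.

End completeness.

Lemma completeNormed_complete_rnorm (R : realType) (K : numFieldType)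
  (s : real_scalars R K) (X : completeNormedModType K) : complete_rnorm s X.
Proof.
apply: complete_rnorm_cluster => u c hu.
have c0 : 0 <= c by have := hu 0%N; rewrite expr0 divr1; apply: le_trans; exact: rnorm_ge0.
have uc : cauchy (u @ \oo).
  apply/cauchyP => e e0; have me0 := modulus_gt0 s e0.
  have [N hN] := geometric_small (c *+ 2) (divr_gt0 me0 (ltr0Sn R 1)).
  exists (u N); exists N => // n /= Nn; rewrite -ball_normE/=.
  rewrite -(emb_rnorm s) -(emb_modulus s (ltW e0)) ltr_emb.
  have := geometric_dist hu N (n - N); rewrite subnKC// => h.
  have := hN N (leqnn _); have : 0 <= c *+ 2 / 2 ^+ n by rewrite divr_ge0 ?mulrn_wge0 ?exprn_ge0.
  by move: h me0; lra.
have /cvg_ex[l ul] : cvg (u @ \oo) by exact: cauchy_cvg.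
exists l => e e0 n.
have se0 : 0 < s e by rewrite emb_gt0.
have /cvgrPdist_le/(_ _ se0)[N _ hN] := ul.
exists (maxn n N); first exact: leq_maxl.
by have := hN (maxn n N) (leq_maxr _ _); rewrite /= -(emb_rnorm s) ler_emb rnormB.
Qed.

Section real_instance.
Variable R : realType.

Let idR : {rmorphism R -> R} := idfun.

Let idR_sup (A : set R) : has_sup A -> supremum 0 [set idR x | x in A] = idR (sup A).
Proof. by move=> _; rewrite image_id. Qed.

Definition real_real_scalars : real_scalars R R :=
  @RealScalars R R idR Num.norm (fun _ _ => erefl) (fun _ => erefl) idR_sup.

Lemma complete_real : complete_rnorm real_real_scalars R^o.
Proof. exact: completeNormed_complete_rnorm. Qed.

End real_instance.

Section complex_instance.
Variable R : realType.
Import ComplexField.Normc.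

Let normr_normc (z : R[i]) : `|z| = (normc z)%:C%C.
Proof. by case: z => a b; rewrite normc_def. Qed.

Let real_complex_le : {mono (real_complex R) : x y / x <= y}.
Proof. by move=> x y; rewrite lecR. Qed.

Definition complex_real_scalars : real_scalars R R[i] :=
  @RealScalars R R[i] (real_complex R) (@normc R) real_complex_le normr_normc (@supremum_complex R).

Lemma Re_le_normc (z : R[i]) : `|complex.Re z| <= normc z.
Proof. by case: z => a b /=; rewrite -sqrtr_sqr ler_sqrt ?addr_ge0 ?sqr_ge0// lerDl sqr_ge0. Qed.

Lemma Im_le_normc (z : R[i]) : `|complex.Im z| <= normc z.
Proof. by case: z => a b /=; rewrite -sqrtr_sqr ler_sqrt ?addr_ge0 ?sqr_ge0// lerDr sqr_ge0. Qed.

Lemma normc_le_ReIm (z : R[i]) : normc z <= `|complex.Re z| + `|complex.Im z|.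
Proof.
case: z => a b /=; rewrite -(@ger0_norm _ (`|a| + `|b|)) ?addr_ge0// -sqrtr_sqr.
rewrite ler_sqrt ?sqr_ge0// sqrrD !real_normK ?num_real// lerD2r lerDl.
by rewrite mulrn_wge0// mulr_ge0.
Qed.

Lemma complete_complex : complete_rnorm complex_real_scalars R[i]^o.
Proof.
apply: complete_rnorm_cluster => u c hu.
have hu' n : normc (u n - u n.+1) <= c / 2 ^+ n by have := hu n; rewrite rnorm_regular.
have [|a ha] := @complete_real R (fun n => complex.Re (u n)) c.
  move=> n; rewrite rnorm_regular; apply: le_trans (hu' n).
  by rewrite -raddfB; exact: Re_le_normc.
have [|b hb] := @complete_real R (fun n => complex.Im (u n)) c.
  move=> n; rewrite rnorm_regular; apply: le_trans (hu' n).
  by rewrite -raddfB; exact: Im_le_normc.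
exists (a +i* b)%C => e e0 n.
have [N hN] := geometric_small (c *+ 2) (divr_gt0 e0 (ltr0Sn R 1)).
exists (maxn n N); first exact: leq_maxl.
have := hN _ (leq_maxr n N); set m := maxn n N => hm.
have ham : `|complex.Re (u m) - a| <= c *+ 2 / 2 ^+ m.
  by have := ha m; rewrite rnorm_regular.
have hbm : `|complex.Im (u m) - b| <= c *+ 2 / 2 ^+ m.
  by have := hb m; rewrite rnorm_regular.
rewrite rnorm_regular; apply: le_trans (normc_le_ReIm _) _.
by rewrite !raddfB/=; move: hm hbm ham; lra.
Qed.

End complex_instance.

(** * Uniform convexity and smoothness with real moduli *)

Section uniform_moduli.
Context (R : realType) (K : numFieldType) (s : real_scalars R K).
Variable X : normedModType K.

Lemma uniformly_convex_rconvex : uniformly_convex X -> rconvex s X.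
Proof.
move=> convX e e0; have se0 : 0 < s e by rewrite emb_gt0.
have [d d0 hd] := convX _ se0; have m0 := modulus_gt0 s d0.
set m := modulus s d in m0; have dE : d = s m by rewrite emb_modulus ?ltW.
exists (m *+ 2) => [|x y x1 y1 xy]; first by rewrite pmulrn_lgt0.
have := hd x y; rewrite -!(emb_rnorm s) x1 y1 rmorph1 ler_emb => /(_ erefl erefl xy).
rewrite dE -[X in X - _](rmorph1 s) -rmorphB ler_emb rnormZ modulusV.
rewrite -(rmorph_nat s 2) modulus_emb ger0_norm// ler_pdivrMl//.
by rewrite mulrBr mulr1 mulr_natl.
Qed.

Lemma uniformly_smooth_rsmooth : uniformly_smooth X -> rsmooth s X.
Proof.
move=> smoothX e e0; have se0 : 0 < s e by rewrite emb_gt0.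
have [d d0 hd] := smoothX _ se0; have m0 := modulus_gt0 s d0.
set m := modulus s d in m0; have dE : d = s m by rewrite emb_modulus ?ltW.
exists m => // x y x1 yd; have := hd x y.
rewrite dE -!(emb_rnorm s) x1 rmorph1 ler_emb => /(_ erefl yd).
by rewrite -(rmorph_nat s 2) -rmorphM -!rmorphD ler_emb.
Qed.

End uniform_moduli.

(** * Support functionals of uniformly smooth spaces *)

Section support_functional.
Variable R : realType.
Let s := complex_real_scalars R.
Variable X : normedModType R[i].
Hypothesis smoothX : rsmooth s X.
Implicit Types (x h k : X) (t : R).

Local Notation "|: x :|" := (rnorm s x) (format "|: x :|").

Variable x : X.
Hypothesis x1 : |:x:| = 1.

Let quotient h : set R := [set (|:x + s t *: h:| - 1) / t | t in [set t | 0 < t]].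

(** By convexity of the norm the quotient is nondecreasing in [t], so this infimum is the right
    derivative of the norm at [x] in the direction [h]. *)
Definition norm_derivative h : R := inf (quotient h).

Let quotient_lb h : lbound (quotient h) (- |:h:|).
Proof.
move=> _ [t /= t0 <-]; rewrite ler_pdivlMr//.
have := rnormDB s x (x + s t *: h); rewrite x1 opprD addNKr rnormN rnormZr gtr0_norm//.
lra.
Qed.

Let has_inf_quotient h : has_inf (quotient h).
Proof.
split; last by exists (- |:h:|); exact: quotient_lb.
by exists ((|:x + s 1 *: h:| - 1) / 1), 1 => /=.
Qed.

Local Notation rho := norm_derivative.

Lemma norm_derivative_le h t : 0 < t -> rho h * t <= |:x + s t *: h:| - 1.
Proof.
move=> t0; rewrite -ler_pdivlMr//; apply: ge_inf; first by case: (has_inf_quotient h).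
by exists t.
Qed.

Lemma norm_derivative_le_norm h : rho h <= |:h:|.
Proof.
have := norm_derivative_le h ltr01; have := rnormD s x (s 1 *: h).
by rewrite mulr1 rnormZr normr1 x1; lra.
Qed.

Lemma norm_derivative_ge h c :
  (forall t, 0 < t -> c * t <= |:x + s t *: h:| - 1) -> c <= rho h.
Proof.
move=> hc; apply: lb_le_inf; first by case: (has_inf_quotient h).
by move=> _ [t /= t0 <-]; rewrite ler_pdivlMr// hc.
Qed.

(** For independent [t] and [u], the point [x + c (h + k)] with [c = t u / (t + u)] is a convex
    combination of [x + t h] and [x + u k], with weights [u / (t + u)] and [t / (t + u)]. *)
Lemma norm_derivative_subadd h k : rho (h + k) <= rho h + rho k.
Proof.
rewrite -lerBlDr; apply: norm_derivative_ge => t t0.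
rewrite mulrBl lerBlDr -lerBlDl -ler_pdivrMr//.
apply: norm_derivative_ge => u u0.
have tu0 : 0 < t + u by rewrite addr_gt0.
have := norm_derivative_le (h + k) (divr_gt0 (mulr_gt0 t0 u0) tu0).
set c := _ / (t + u).
have xE : x + s c *: (h + k) =
    s (u / (t + u)) *: (x + s t *: h) + s (t / (t + u)) *: (x + s u *: k).
  rewrite !scalerDr addrACA -scalerDl -rmorphD -mulrDl [u + t]addrC divff ?gt_eqF//.
  rewrite rmorph1 scale1r !scalerA -!rmorphM; congr (_ + (s _ *: _ + s _ *: _)).
    by rewrite [RHS]mulrAC [u * t]mulrC.
  by rewrite [RHS]mulrAC.
rewrite xE => le1; have := le_trans le1 (lerB (rnormD _ _ _) (lexx 1)).
rewrite !rnormZr !gtr0_norm ?divr_gt0//.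
set A := |:x + s t *: h:|; set B := |:x + s u *: k:| => le2.
rewrite mulrAC ler_pdivrMr//.
have : rho (h + k) * (t * u) <= u * A + t * B - (t + u).
  have e1 : (u / (t + u) * A + t / (t + u) * B - 1) * (t + u) = u * A + t * B - (t + u).
    by field; exact: lt0r_neq0.
  by rewrite -e1 -ler_pdivrMr// -[leLHS]mulrA.
by move=> ?; nra.
Qed.

(** Smoothness enters here: [|x + t h| + |x - t h| - 2] is [o(t)], so the two one-sided derivatives
    agree, and a subadditive odd function is additive. *)
Lemma norm_derivativeN h : rho (- h) = - rho h.
Proof.
apply/eqP; rewrite eq_le; apply/andP; split; last first.
  rewrite -subr_ge0 opprK addrC.
  apply: (le_trans _ (norm_derivative_subadd h (- h))); rewrite subrr.
  by apply: norm_derivative_ge => t t0; rewrite scaler0 addr0 x1 subrr mul0r.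
rewrite -subr_le0 opprK.
apply/ler_addgt0Pr => e e0; rewrite add0r.
have h1 : 0 < |:h:| + 1 by rewrite ltr_wpDl ?rnorm_ge0.
have [d d0 hd] := smoothX (divr_gt0 e0 h1).
have [t t0 th] : exists2 t, 0 < t & t * |:h:| <= d.
  exists (d / (|:h:| + 1)); first by rewrite divr_gt0.
  by rewrite mulrAC ler_pdivrMr// ler_pM2l// lerDl.
have td : |:s t *: h:| = t * |:h:| by rewrite rnormZr gtr0_norm.
have := hd x (s t *: h) x1; rewrite td => /(_ th).
have := norm_derivative_le h t0; have := norm_derivative_le (- h) t0.
rewrite scalerN => h2 h3 h4.
have : (rho (- h) + rho h) * t <= e / (|:h:| + 1) * (t * |:h:|) by lra.
rewrite [t * _]mulrC mulrA ler_pM2r// => /le_trans; apply.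
by rewrite mulrAC ler_pdivrMr// ler_pM2l// lerDl.
Qed.

Lemma norm_derivativeD h k : rho (h + k) = rho h + rho k.
Proof.
apply/eqP; rewrite eq_le norm_derivative_subadd/=.
have := norm_derivative_subadd (- h) (- k).
by rewrite -opprD !norm_derivativeN -opprD lerN2.
Qed.

Let norm_derivativeZ_ge0 a h : 0 < a -> rho (s a *: h) = a * rho h.
Proof.
move=> a0; have le b k : 0 < b -> b * rho k <= rho (s b *: k).
  move=> b0; apply: norm_derivative_ge => t t0; rewrite scalerA -rmorphM.
  by rewrite mulrAC [t * b]mulrC [leLHS]mulrC norm_derivative_le// mulr_gt0.
apply/eqP; rewrite eq_le le// andbT -ler_pdivrMl//.
apply: le_trans (le _ _ _) _; first by rewrite invr_gt0.
by rewrite scalerA -rmorphM mulVf ?gt_eqF// rmorph1 scale1r.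
Qed.

Lemma norm_derivativeZ a h : rho (s a *: h) = a * rho h.
Proof.
have rho0 : rho 0 = 0.
  by have := norm_derivativeD 0 0; rewrite addr0 => /eqP;
     rewrite -subr_eq0 opprD addNKr oppr_eq0 => /eqP.
have [a0|a0|->] := ltgtP a 0; last by rewrite rmorph0 scale0r mul0r.
  by rewrite -(opprK a) rmorphN scaleNr norm_derivativeN norm_derivativeZ_ge0 ?oppr_gt0// !mulNr.
exact: norm_derivativeZ_ge0.
Qed.

(* [norm_derivative] is real linear; it is the real part of this complex linear form. *)
Let functional h : R[i]^o := (rho h -i* rho ('i%C *: h))%C.

Let functional_linear : linear functional.
Proof.
move=> [a b] h k; rewrite /functional scalerDr !norm_derivativeD.
have zE : (a +i* b)%C = s a + s b * 'i%C :> R[i] by rewrite {1}[LHS]complexE mulrC.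
have rhoZ : rho ((a +i* b)%C *: h) = a * rho h + b * rho ('i%C *: h).
  by rewrite zE scalerDl -scalerA norm_derivativeD !norm_derivativeZ.
have rhoiZ : rho ('i%C *: ((a +i* b)%C *: h)) = a * rho ('i%C *: h) - b * rho h.
  have ii : 'i%C * 'i%C = -1 :> R[i] by rewrite -expr2 sqr_i.
  rewrite zE scalerDl scalerDr norm_derivativeD !scalerA ['i%C * (_ * _)]mulrCA ii mulrN1.
  by rewrite ['i%C * _]mulrC -scalerA scaleNr norm_derivativeN !norm_derivativeZ.
rewrite rhoZ rhoiZ; apply/eqP; rewrite eq_complex/=; apply/andP; split; apply/eqP.
  ring.
ring.
Qed.

(** Rotating [h] until [xs h] is its own real part reduces the norm bound to
    [norm_derivative_le_norm]. At [x] the real part is 1 and the modulus at most 1, which leaves no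
    room for an imaginary part. *)
Lemma support_functional : exists xs : {linear X -> R[i]^o}, dual_pair s x xs.
Proof.
pose xs := mkLinear functional_linear.
have xsE h : xs h = (rho h -i* rho ('i%C *: h))%C by [].
have nxs h : modulus s (xs h) <= |:h:|.
  have [w w1 hw] := polar_form s (xs h).
  have w0 : w != 0.
    by apply/eqP => w0; move: w1; rewrite w0 modulus0 => /esym/eqP; rewrite oner_eq0.
  have : xs (w^-1 *: h) = s (modulus s (xs h)).
    by rewrite functionalZ {1}hw mulrA mulVf// mul1r.
  move/(congr1 (@complex.Re R)); rewrite xsE/= => <-.
  rewrite (le_trans (norm_derivative_le_norm _))//.
  by rewrite rnormZ modulusV w1 invr1 mul1r.
have rx : rho x = 1.
  apply/eqP; rewrite eq_le -{1}x1 norm_derivative_le_norm/=.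
  apply: norm_derivative_ge => t t0; rewrite -{1}(scale1r x) -(rmorph1 s) -scalerDl.
  by rewrite -rmorphD rnormZr x1 mulr1 gtr0_norm ?addr_gt0// addrC addKr mul1r.
exists xs; split=> //; have := nxs x; rewrite x1 xsE rx => m1.
suff -> : rho ('i%C *: x) = 0 by apply/eqP; rewrite eq_complex/= oppr0 !eqxx.
move: (rho _) m1 => b.
rewrite -[modulus _ _]/(Normc.normc (1 -i* b)%C) /= sqrrN expr1n.
rewrite -[leRHS]sqrtr1 ler_sqrt// gerDl => b0.
by apply/eqP; rewrite -sqrf_eq0 eq_le b0 sqr_ge0.
Qed.

End support_functional.

(** * The numerical index of complex spaces *)

(** In characteristic 0 the polynomial ['X^n - 1] is separable, hence has [n] distinct roots, and
    [n] distinct [n]-th roots of unity include a primitive one. *)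
Lemma prim_root_exists (C : numClosedFieldType) n : (0 < n)%N ->
  exists w : C, n.-primitive_root w.
Proof.
pose p : {poly C} := 'X^n - 1; have [r Dp] := closed_field_poly_normal p.
move=> n_gt0; rewrite (monicP _) ?monicXnsubC // scale1r in Dp.
have rn1 : all n.-unity_root r by apply/allP => z; rewrite -root_prod_XsubC -Dp.
have sz_r : (n < (size r).+1)%N.
  by rewrite -(size_prod_XsubC r id) -Dp size_XnsubC.
have [|z] := hasP (has_prim_root n_gt0 rn1 _ sz_r); last by exists z.
by rewrite -separable_prod_XsubC -Dp separable_Xn_sub_1 // pnatr_eq0 -lt0n.
Qed.

(** A geometric sum whose ratio [w^-1 * w ^+ j] is an [n]-th root of unity, equal to 1 only for
    [j = 1]. *)
Lemma sum_prim_root (F : fieldType) n (w : F) j : (1 < n)%N -> (j < n)%N ->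
  n.-primitive_root w ->
  \sum_(k < n) (w ^+ k)^-1 * (w ^+ k) ^+ j = (j == 1%N)%:R * n%:R.
Proof.
move=> n1 jn pw.
have w0 : w != 0 by rewrite (prim_root_eq0 pw); case: n n1 {jn pw}.
have wE k : (w ^+ k)^-1 * (w ^+ k) ^+ j = (w^-1 * w ^+ j) ^+ k.
  by rewrite exprMn exprVn -!exprM mulnC.
under eq_bigr do rewrite wE.
have [->|j1] := eqVneq j 1%N.
  by rewrite mul1r expr1 mulVf//; under eq_bigr do rewrite expr1n; rewrite sumr_const card_ord.
rewrite mul0r; apply/eqP; set y := w^-1 * _.
have y1 : y != 1.
  apply: contra_neq j1 => y1; have : w ^+ j == w ^+ 1.
    by rewrite expr1 -[w ^+ j](mulVKf w0) -/y y1 mulr1.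
  by rewrite (eq_prim_root_expr pw) !modn_small// => /eqP.
have : (y - 1) * (\sum_(k < n) y ^+ k) = 0.
  rewrite -subrX1 /y exprMn exprVn -exprM mulnC exprM (prim_expr_order pw) expr1n.
  by rewrite invr1 mul1r subrr.
by move/eqP; rewrite mulf_eq0 subr_eq0 (negbTE y1).
Qed.

Section complex_index.
Variable R : realType.
Let s := complex_real_scalars R.
Variable X : normedModType R[i].

Local Notation "|: x :|" := (rnorm s x) (format "|: x :|").
Local Notation modu := (modulus s).

(* Cauchy's estimate, with an average over roots of unity in place of the contour integral. *)
Lemma cauchy_coefficient1 (n : nat) (v : nat -> X) (r B : R) : (1 < n)%N -> 0 <= r ->
  (forall z, modu z = r -> |:\sum_(j < n) z ^+ j *: v j:| <= B) ->
  r * |:v 1%N:| <= B.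
Proof.
move=> n1 r0 hB; have [w pw] := prim_root_exists (R[i]) (ltnW n1).
have w1 : modu w = 1.
  have mX k : modu (w ^+ k) = modu w ^+ k.
    by elim: k => [|k IH]; rewrite ?modulus1// !exprS modulusM IH.
  apply/eqP; rewrite -(@pexpr_eq1 _ _ n) ?modulus_ge0 ?(ltnW n1)//.
  by rewrite -mX (prim_expr_order pw) modulus1.
have mwk k : modu (w ^+ k) = 1.
  by elim: k => [|k IH]; rewrite ?modulus1// exprS modulusM IH w1 mulr1.
have : |:\sum_(k < n) (w ^+ k)^-1 *: (\sum_(j < n) (w ^+ k * s r) ^+ j *: v j):| <= B *+ n.
  have : B *+ n = \sum_(k < n) B by rewrite sumr_const card_ord.
  move=> ->; elim/big_ind2 : _ => [|x a y b xa yb|k _].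
  - by rewrite rnorm0.
  - exact: le_trans (rnormD _ _ _) (lerD xa yb).
  - by rewrite rnormZ modulusV mwk invr1 mul1r hB// modulusM mwk mul1r modulus_emb ger0_norm.
under eq_bigr do rewrite scaler_sumr; rewrite exchange_big/=.
have -> : \sum_(j < n) \sum_(i < n) (w ^+ i)^-1 *: ((w ^+ i * s r) ^+ j *: v j) =
    (n%:R * s r) *: v 1%N.
  transitivity (\sum_(j < n) ((j == 1 :> nat)%:R * n%:R * s r ^+ j) *: v j).
    apply: eq_bigr => j _; under eq_bigr do rewrite scalerA exprMn mulrA.
    by rewrite -scaler_suml -mulr_suml sum_prim_root.
  rewrite (bigD1 (Ordinal n1))//= mul1r expr1 big1 ?addr0// => j j1.
  by rewrite (_ : (j == 1 :> nat) = false) ?mul0r ?scale0r//; apply/negbTE.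
rewrite -(rmorph_nat s n) -rmorphM rnormZr ger0_norm ?mulr_ge0//.
by rewrite -[leRHS]mulr_natl -mulrA ler_pM2l// ltr0n ltnW.
Qed.

Variable T : {linear X -> X}.

(** [v j] is [T^j x] times the binomial coefficient of [m] and [j], and the induction is Pascal's
    rule. Only [v 1] is needed for Cauchy's estimate. *)
Lemma iter_resolvent_expansion m x : exists v : nat -> X,
  [/\ v 0%N = x, v 1%N = m%:R *: T x, forall j, (m < j)%N -> v j = 0 &
  forall z : R[i], iter m (fun h => h + z *: T h) x = \sum_(j < m.+1) z ^+ j *: v j].
Proof.
elim: m => [|m [v [v0 v1 vm hv]]].
  exists (fun j => if j is 0%N then x else 0); split=> //.
  - by rewrite scale0r.
  - by case.
  - by move=> z; rewrite big_ord1 expr0 scale1r.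
exists (fun j => v j + if j is i.+1 then T (v i) else 0); split.
- by rewrite v0 addr0.
- by rewrite v1 v0 -[in RHS]natr1 scalerDl scale1r.
- move=> [//|j] mj; rewrite vm ?(ltn_trans _ mj)// vm ?linear0 ?addr0//.
- move=> z; rewrite iterS hv.
  under [RHS]eq_bigr do rewrite scalerDr; rewrite big_split/=; congr (_ + _).
    by rewrite [RHS]big_ord_recr/= vm// scaler0 addr0.
  rewrite [RHS]big_ord_recl/= scaler0 add0r linear_sum scaler_sumr.
  by apply: eq_bigr => j _; rewrite linearZ scalerA /bump add1n exprS.
Qed.

Hypothesis supportX : forall x, |:x:| = 1 -> exists xs : {linear X -> R[i]^o}, dual_pair s x xs.
Variable M : R.
Hypothesis TM : forall x, |:T x:| <= M * |:x:|.
Hypothesis T1 : forall x (xs : {linear X -> R[i]^o}), dual_pair s x xs -> modu (xs (T x)) <= 1.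

(** Evaluate a support functional [ys] of the normalized vector [y]: it sends [y - z T y] to
    [1 - z ys (T y)], and [|ys (T y)| <= 1]. *)
Lemma resolvent_lower_bound z x : (1 - modu z) * |:x:| <= |:x - z *: T x:|.
Proof.
have [->|x0] := eqVneq x 0; first by rewrite rnorm0 mulr0 rnorm_ge0.
have rx0 := rnorm_gt0 s x0.
pose y := s |:x:|^-1 *: x.
have y1 : |:y:| = 1 by rewrite rnormZr gtr0_norm ?invr_gt0// mulVf// gt_eqF.
have xE : x = s |:x:| *: y by rewrite scalerA -rmorphM divff ?gt_eqF// rmorph1 scale1r.
clearbody y; move: (|:x:|) rx0 xE => a a0 ->{x x0}.
have -> : T (s a *: y) = s a *: T y by exact: linearZZ.
rewrite scalerA [z * _]mulrC -scalerA -scalerBr rnormZr gtr0_norm//.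
rewrite mulrC ler_pM2l//.
have [ys py] := supportX y1; have [_ nys ysy] := py.
apply: le_trans (nys _).
have -> : ys (y - z *: T y) = 1 - z * ys (T y) by rewrite linearB/= functionalZ ysy.
have : modu (z * ys (T y)) <= modu z.
  by rewrite modulusM ler_piMr ?modulus_ge0 ?T1.
have := modulusD s (1 - z * ys (T y)) (z * ys (T y)).
by rewrite subrK modulus1; lra.
Qed.

(** The lower bound is applied to [x + z T x], since [(1 - z T)(1 + z T) = 1 - z^2 T^2]: the
    first-order term in the norm of [T] disappears. *)
Lemma resolvent_upper_bound z x : modu z < 1 ->
  |:x + z *: T x:| <= (1 + modu z ^+ 2 * M ^+ 2) / (1 - modu z) * |:x:|.
Proof.
move=> z1; have z1' : 0 < 1 - modu z by rewrite subr_gt0.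
rewrite mulrAC ler_pdivlMr// mulrC (le_trans (resolvent_lower_bound _ _))//.
have -> : x + z *: T x - z *: T (x + z *: T x) = x - (z ^+ 2) *: T (T x).
  have -> : T (x + z *: T x) = T x + z *: T (T x).
    by rewrite linearD; congr (_ + _); exact: linearZZ.
  by rewrite scalerDr opprD addrA addrK scalerA expr2.
have z2 : modu (z ^+ 2) = modu z ^+ 2 by rewrite expr2 modulusM -expr2.
rewrite (le_trans (rnormD _ _ _))// rnormN rnormZ mulrDl mul1r lerD2l z2.
rewrite -[leRHS]mulrA ler_wpM2l ?sqr_ge0//.
(* A negative [M] is possible only on the zero space. *)
have [M0|M0] := leP 0 M.
  by rewrite (le_trans (TM _))// expr2 -mulrA ler_wpM2l.
have z0 (y : X) : |:y:| = 0.
  have := TM y; have := rnorm_ge0 s (T y); have := rnorm_ge0 s y; nra.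
by rewrite !z0 mulr0.
Qed.

(** With [r = 1 / m] and [m >= M ^+ 2], the second-order term [r^2 M^2] is at most [r]. Each factor
    [1 + z T] then has norm at most [(1 + r) / (1 - r) <= 1 + 4r <= expR (4 * r)], where [r <= 1/2]
    serves the middle inequality. So [m] factors cost [expR 4] whatever [M] is, and [r] times the
    linear coefficient [m T x] is [T x]. *)
Lemma complex_index x : |:T x:| <= expR 4 * |:x:|.
Proof.
have [m m2 mM] : exists2 m : nat, (2 <= m)%N & M ^+ 2 <= m%:R.
  exists (maxn 2 (Num.trunc (M ^+ 2)).+1); first exact: leq_maxl.
  have M2 : 0 <= M ^+ 2 by exact: sqr_ge0.
  have /andP[_ /ltW h] := truncn_itv M2.
  by rewrite (le_trans h)// ler_nat leq_maxr.
have m0 : 0 < m%:R :> R by rewrite ltr0n; case: m m2 {mM}.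
pose r : R := m%:R^-1.
have r0 : 0 < r by rewrite invr_gt0.
have r2 : r <= 2^-1 by rewrite lef_pV2 ?posrE// ler_nat.
have rm : r * m%:R = 1 by rewrite mulVf// gt_eqF.
have rM : r ^+ 2 * M ^+ 2 <= r.
  by rewrite expr2 -mulrA -[leRHS]mulr1 ler_pM2l// -rm ler_pM2l.
have step z y : modu z = r -> |:y + z *: T y:| <= expR (4 * r) * |:y:|.
  move=> zr; have z1 : modu z < 1 by rewrite zr; lra.
  rewrite (le_trans (resolvent_upper_bound _ z1))// ler_wpM2r ?rnorm_ge0//.
  rewrite zr (@le_trans _ _ (1 + 4 * r)) ?expR_ge1Dx//.
  rewrite ler_pdivrMr; [nra|lra].
have bound z : modu z = r -> |:iter m (fun h => h + z *: T h) x:| <= expR 4 * |:x:|.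
  move=> zr; have : forall k, |:iter k (fun h => h + z *: T h) x:| <= expR (4 * r *+ k) * |:x:|.
    elim=> [|k IH]; first by rewrite mulr0n expR0 mul1r.
    rewrite iterS (le_trans (step _ _ zr))// [_ * r *+ _]mulrS expRD -mulrA.
    by rewrite ler_pM2l ?expR_gt0.
  by move/(_ m); rewrite -mulr_natr -mulrA rm mulr1.
have [v [_ v1 _ hv]] := iter_resolvent_expansion m x.
have := @cauchy_coefficient1 m.+1 v r (expR 4 * |:x:|).
rewrite v1 -(rmorph_nat s m) rnormZr ger0_norm ?ler0n// mulrA rm mul1r; apply.
- by rewrite ltnS; case: m m2 {mM m0 r r0 r2 rm rM step bound v1 hv}.
- exact: ltW.
- by move=> z zr; rewrite -hv bound.
Qed.

End complex_index.

Theorem complex_BPBp_nu (R : realType) (X : normedModType R[i]) :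
  complete_rnorm (complex_real_scalars R) X -> rsmooth (complex_real_scalars R) X ->
  rconvex (complex_real_scalars R) X -> BPBp_nu X.
Proof.
move=> cX sX uX.
apply: (BPBp_nu_of_index uX sX cX (@complete_complex R) (expR_ge0 4)) => T [M TM] T1 h.
apply: (complex_index _ TM T1) => x x1; exact: support_functional.
Qed.

(** * Scalar inequalities *)

Section power_inequalities.
Context (R : realType) (p : R).
Hypothesis p1 : 1 < p.
Implicit Types a b t u x y : R.

Let p0 : 0 < p. Proof. exact: lt_trans p1. Qed.
Let pB1 : 0 < p - 1. Proof. by rewrite subr_gt0. Qed.

Lemma ler_powR2r x y : 0 <= x -> x <= y -> x `^ p <= y `^ p.
Proof. by move=> x0 xy; rewrite ge0_ler_powR ?nnegrE ?(ltW p0)// (le_trans x0). Qed.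

Lemma powRB1_mulr x : 0 <= x -> x `^ (p - 1) * x = x `^ p.
Proof. by move=> x0; rewrite mulrC mulr_powRB1. Qed.

(** Young's inequality for the product [t * 1], with exponents [p] and [p / (p - 1)]. *)
Lemma bernoulli_powR t : 0 <= t -> 1 + p * (t - 1) <= t `^ p.
Proof.
move=> t0; have q0 : 0 < p / (p - 1) by rewrite divr_gt0.
have := @conjugate_powR _ t 1 p (p / (p - 1)) t0 ler01 p0 q0.
rewrite invf_div -{1}(mul1r p^-1) -mulrDl addrC subrK divff ?gt_eqF// => /(_ erefl).
by rewrite mulr1 powR1 mul1r -mulrDl ler_pdivlMr//; lra.
Qed.

Lemma tangent_powR x y : 0 < x -> 0 <= y ->
  x `^ p + p * x `^ (p - 1) * (y - x) <= y `^ p.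
Proof.
move=> x0 y0; have := bernoulli_powR (divr_ge0 y0 (ltW x0)).
rewrite -(ler_pM2l (powR_gt0 p x0)) -powRM ?divr_ge0// ?(ltW x0)//. 
rewrite [x * _]mulrC divfK ?gt_eqF//.
rewrite mulrDr mulr1; apply: le_trans; rewrite lerD2l -(powRB1_mulr (ltW x0)) le_eqVlt.
apply/orP; left; apply/eqP; field; exact: lt0r_neq0.
Qed.

Lemma powR_near1 (q e : R) : 0 < e -> exists2 d, 0 < d <= 2^-1 &
  forall x, `|x - 1| <= d -> `|x `^ q - 1| <= e.
Proof.
move=> e0.
have cq : {for 1, continuous (fun x : R => x `^ q)}.
  apply/differentiable_continuous/derivable1_diffP/derivable_powR.
  by rewrite in_itv/= ltr01.
have /cvgrPdist_le/(_ e e0)/nbhs_ballP[d /= d0 hd] := cq.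
exists (Num.min (d / 2) 2^-1).
  by rewrite lt_min divr_gt0//= invr_gt0 ltr0n/= ge_min lexx orbT.
move=> x; rewrite le_min => /andP[xd _].
have := hd x; rewrite powR1 distrC; apply.
by rewrite /ball/= distrC (le_lt_trans xd)// ltr_pdivrMr// ltr_pMr// ltr1n.
Qed.

(* A, B, P, Q stand for the moduli of a, b, a + b, a - b. *)
Lemma powR_smooth e : 0 < e -> exists2 C, 0 <= C & forall A B P Q : R,
  0 <= A -> 0 <= B -> 0 <= P -> 0 <= Q -> P <= A + B -> Q <= A + B -> A <= P + B -> A <= Q + B ->
  P ^+ 2 + Q ^+ 2 = (A ^+ 2 + B ^+ 2) *+ 2 ->
  P `^ p + Q `^ p <= A `^ p *+ 2 + e * (A `^ (p - 1) * B) + C * B `^ p.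
Proof.
move=> e0; have e'0 : 0 < e / (p *+ 4) by rewrite divr_gt0// pmulrn_lgt0.
have [d0 /andP[d00 d02] hd0] := powR_near1 (p - 1) e'0.
pose d := Num.min d0 (e / (p *+ 2)).
have d_gt0 : 0 < d by rewrite lt_min d00 divr_gt0// pmulrn_lgt0.
have dle : d <= d0 /\ d <= e / (p *+ 2) by split; rewrite ge_min lexx ?orbT.
exists ((d^-1 + 1) `^ p *+ 2); first by rewrite mulrn_wge0// powR_ge0.
move=> A B P Q A0 B0 P0 Q0 PAB QAB APB AQB par.
have Ap0 := powR_ge0 A (p - 1); have Bp0 := powR_ge0 B p; have App0 := powR_ge0 A p.
have [Bd|Bd] := leP B (d * A); last first.
  have AB : A + B <= (d^-1 + 1) * B.
    by rewrite mulrDl mul1r lerD2r mulrC ler_pdivlMr// mulrC ltW.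
  have PB : P `^ p <= (d^-1 + 1) `^ p * B `^ p.
    rewrite -powRM ?addr_ge0 ?invr_ge0 ?(ltW d_gt0)//.
    by apply: ler_powR2r => //; exact: le_trans PAB AB.
  have QB : Q `^ p <= (d^-1 + 1) `^ p * B `^ p.
    rewrite -powRM ?addr_ge0 ?invr_ge0 ?(ltW d_gt0)//.
    by apply: ler_powR2r => //; exact: le_trans QAB AB.
  have : 0 <= e * (A `^ (p - 1) * B) by rewrite mulr_ge0 ?(ltW e0)// mulr_ge0.
  lra.
have [A0'|A_neq0] := eqVneq A 0.
  have B0' : B = 0 by apply/eqP; rewrite eq_le B0 andbT (le_trans Bd)// A0' mulr0.
  have P0' : P = 0 by apply/eqP; rewrite eq_le P0 andbT (le_trans PAB)// A0' B0' addr0.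
  have Q0' : Q = 0 by apply/eqP; rewrite eq_le Q0 andbT (le_trans QAB)// A0' B0' addr0.
  by rewrite P0' Q0' A0' B0' powR0 ?gt_eqF// !mulr0 mul0rn !addr0.
have {}A0 : 0 < A by rewrite lt_def A_neq0.
pose b := B / A; pose x := P / A; pose y := Q / A.
have BE : B = A * b by rewrite mulrC divfK.
have PE : P = A * x by rewrite mulrC divfK.
have QE : Q = A * y by rewrite mulrC divfK.
have b0 : 0 <= b by rewrite divr_ge0// ltW.
have x0 : 0 <= x by rewrite divr_ge0// ltW.
have y0 : 0 <= y by rewrite divr_ge0// ltW.
have bd : b <= d by rewrite ler_pdivrMr.
have {}par : x ^+ 2 + y ^+ 2 = (1 + b ^+ 2) *+ 2.
  have A2 : A ^+ 2 != 0 by rewrite expf_neq0.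
  apply: (mulfI A2); move: par; rewrite BE PE QE; lra.
(* The tangent at [z], evaluated at 1, gives [z^p <= 1 + p z^(p-1) (z - 1)]; replacing [z^(p-1)] by
   1 costs at most [p * (e / (p *+ 4)) * b]. *)
have pow z : 0 < z -> `|z - 1| <= b -> z `^ p <= 1 + p * (z - 1) + e / 4 * b.
  move=> z0 zb; have := tangent_powR z0 ler01; rewrite powR1.
  have wz := ler_pM (normr_ge0 _) (normr_ge0 _) (hd0 z (le_trans zb (le_trans bd dle.1))) zb.
  have := ler_norm ((z `^ (p - 1) - 1) * (z - 1)); rewrite normrM => /le_trans/(_ wz).
  move: (z `^ (p - 1)) (z `^ p) => w v; rewrite -(ler_pM2l p0) => {}wz.
  have : p * (e / (p *+ 4) * b) = e / 4 * b by field; rewrite gt_eqF.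
  by move: wz; lra.
have b2 : b <= 2^-1 by rewrite (le_trans bd)// (le_trans dle.1).
have near z Z : Z = A * z -> Z <= A + B -> A <= Z + B -> `|z - 1| <= b.
  move=> ZE h1 h2; have z1 : z <= 1 + b by rewrite -(ler_pM2l A0) mulrDr mulr1 -ZE -BE.
  have z2 : 1 <= z + b by rewrite -(ler_pM2l A0) mulrDr mulr1 -ZE -BE.
  by rewrite ler_norml; apply/andP; split; lra.
have xb := near _ _ PE PAB APB; have yb := near _ _ QE QAB AQB.
have half : 2^-1 < 1 :> R by rewrite invf_lt1 ?ltr1n.
have xp : 0 < x by move: xb => /ler_normlP[]; lra.
have yp : 0 < y by move: yb => /ler_normlP[]; lra.
(* Separately [x - 1] and [y - 1] are only of order [b]; the parallelogram law cancels the first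
   order in their sum. *)
have xy2 : x + y <= 2 + b ^+ 2.
  have : (x + y) ^+ 2 <= (2 + b ^+ 2) ^+ 2.
    have := sqr_ge0 (x - y); have := sqr_ge0 (b ^+ 2); move: par; nra.
  by rewrite ler_pXn2r ?nnegrE ?addr_ge0 ?sqr_ge0.
have pb : p * b ^+ 2 <= e / 2 * b.
  rewrite expr2 mulrA ler_wpM2r// -ler_pdivlMl//.
  apply: le_trans (le_trans bd dle.2) _.
  rewrite le_eqVlt; apply/orP; left; apply/eqP; field; by rewrite gt_eqF.
have := pow x xp xb; have := pow y yp yb.
have -> : P `^ p = A `^ p * x `^ p by rewrite {1}PE powRM// ltW.
have -> : Q `^ p = A `^ p * y `^ p by rewrite {1}QE powRM// ltW.
have -> : A `^ (p - 1) * B = A `^ p * b by rewrite BE mulrA powRB1_mulr// ltW.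
have : 0 <= ((d^-1 + 1) `^ p *+ 2) * B `^ p.
  by rewrite mulr_ge0// mulrn_wge0// powR_ge0.
have Ap_gt0 : 0 < A `^ p by rewrite powR_gt0.
move=> cB hy hx; rewrite -mulrDr.
apply: (@le_trans _ _ (A `^ p *+ 2 + e * (A `^ p * b))); last by rewrite lerDl.
have -> : A `^ p *+ 2 + e * (A `^ p * b) = A `^ p * (2 + e * b) by ring.
have {}xy2 : p * (x + y) <= p * (2 + b ^+ 2) by rewrite ler_pM2l.
by rewrite ler_pM2l//; move: xy2 hx hy pb; lra.
Qed.

(** Strict convexity made quantitative. From the midpoint [u] towards 1 the tangent is renewed at
    [w = (1 + u) / 2], where the slope has grown; the gap is half of
    [p (w - u) (w^(p-1) - u^(p-1))]. The constant [g] uses [u >= 1/2] and [w / u >= 1 + e / 4]. *)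
Lemma powR_convex_gap (e : R) : 0 < e -> exists2 c, 0 < c & forall t, 0 <= t <= 1 - e ->
  c + ((1 + t) / 2) `^ p <= (1 + t `^ p) / 2.
Proof.
move=> e0.
have pow11 : (1 : R) `^ (p - 1) = 1 by rewrite powR1.
pose g := (2^-1) `^ (p - 1) * ((1 + e / 4) `^ (p - 1) - 1).
have g0 : 0 < g.
  rewrite mulr_gt0 ?powR_gt0 ?invr_gt0// subr_gt0 -[X in X < _]pow11.
  by rewrite gt0_ltr_powR ?nnegrE ?addr_ge0 ?divr_ge0 ?(ltW e0)// ltrDl divr_gt0.
exists (p * (e / 4) * g / 2).
  by do 2!apply: mulr_gt0 => //; rewrite ?mulr_gt0 ?divr_gt0 ?invr_gt0.
move=> t /andP[t0 te].
have [u uE] : exists u, u = (1 + t) / 2 by eexists.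
have [w wE] : exists w, w = (1 + u) / 2 by eexists.
have u2 : 2^-1 <= u by lra.
have half : 0 < 2^-1 :> R by rewrite invr_gt0.
have u0 : 0 < u by exact: lt_le_trans u2.
have u1 : u <= 1 - e / 2 by lra.
have wu : e / 4 <= w - u by lra.
have w0 : 0 < w by lra.
have gw : g <= w `^ (p - 1) - u `^ (p - 1).
  have -> : w = u * (w / u) by rewrite mulrC divfK// gt_eqF.
  rewrite powRM ?(ltW u0) ?divr_ge0 ?(ltW w0) ?(ltW u0)//.
  rewrite -[X in _ - X]mulr1 -mulrBr ler_pM ?powR_ge0//.
  - rewrite subr_ge0 -[X in X <= _]pow11.
    by rewrite ge0_ler_powR ?nnegrE ?(ltW pB1) ?addr_ge0 ?divr_ge0 ?(ltW e0)//
      lerDl divr_ge0 ?(ltW e0).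
  - by rewrite ge0_ler_powR ?nnegrE ?(ltW pB1) ?(ltW half) ?(ltW u0).
  rewrite lerD2r ge0_ler_powR ?nnegrE ?(ltW pB1) ?addr_ge0 ?divr_ge0 ?(ltW e0) ?(ltW u0)
    ?(ltW w0)//.
  rewrite ler_pdivlMr//; nra.
have h1 := tangent_powR w0 ler01; have h2 := tangent_powR u0 (ltW w0).
have h3 := tangent_powR u0 t0; rewrite powR1 in h1.
have w1 : 1 - w = w - u by lra.
have ut : t - u = - (w - u) *+ 2 by lra.
have : p * (e / 4) * g <= p * (w - u) * (w `^ (p - 1) - u `^ (p - 1)).
  apply: ler_pM => //; last by rewrite ler_pM2l.
    by apply: mulr_ge0; [exact: ltW|rewrite divr_ge0// ltW].
  exact: ltW.
rewrite -uE; move: h1 h2 h3; rewrite w1 ut.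
move: (w `^ (p - 1)) (u `^ (p - 1)) (w `^ p) (u `^ p) (t `^ p) => W U Wp Up Tp.
lra.
Qed.

(** Again [A], [B], [P], [Q] are the moduli of [a], [b], [a + b], [a - b]. After scaling to
    [A = 1 >= B = t], either [q^p <= e] and convexity is enough, or the midpoint defect is at least
    [c'] and [C] times it exceeds [2^p >= q^p]. The defect comes from [powR_convex_gap] when [t] is
    far from 1; when [t] is near 1, the parallelogram law turns [q >= e1] into [m / 2 <= 1 - k]. *)
Lemma powR_convex e : 0 < e -> exists2 C, 0 < C & forall A B P Q : R,
  0 <= A -> 0 <= B -> 0 <= P -> 0 <= Q -> P <= A + B -> Q <= A + B ->
  P ^+ 2 + Q ^+ 2 = (A ^+ 2 + B ^+ 2) *+ 2 ->
  Q `^ p + C * (P / 2) `^ p <= e * (A `^ p + B `^ p) + C * ((A `^ p + B `^ p) / 2).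
Proof.
move=> e0; pose e1 := (Num.min e 1) `^ p^-1.
have me : 0 < Num.min e 1 by rewrite lt_min e0 ltr01.
have e10 : 0 < e1 by exact: powR_gt0.
have e1p : e1 `^ p <= e by rewrite -powRrM mulVf ?gt_eqF// powRr1 ?(ltW me)// ge_min lexx.
pose k := e1 ^+ 2 / 8.
have k0 : 0 < k by rewrite divr_gt0// exprn_gt0.
have [c c0 hc] := powR_convex_gap (divr_gt0 k0 (mulr_gt0 (ltr0Sn R 1) p0)).
pose c' := Num.min c (k / 2).
have c'0 : 0 < c' by rewrite lt_min c0 divr_gt0.
exists (2 `^ p / c'); first by rewrite divr_gt0// powR_gt0.
have Cc x : c' <= x -> 2 `^ p <= 2 `^ p / c' * x.
  by move=> cx; rewrite mulrAC ler_pdivlMr// ler_pM2l// powR_gt0.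
set C := 2 `^ p / c'; have C0 : 0 < C by rewrite divr_gt0// powR_gt0.
move=> A B P Q; wlog BA : A B / B <= A.
  move=> h A0 B0; have [BA|/ltW AB] := leP B A; first exact: h.
  by rewrite [A + B]addrC [A ^+ 2 + _]addrC [A `^ p + _]addrC; exact: h.
move=> A0 B0 P0 Q0 PAB QAB par.
have [A0'|A_neq0] := eqVneq A 0.
  have B0' : B = 0 by apply/eqP; rewrite eq_le B0 andbT (le_trans BA)// A0'.
  have P0' : P = 0 by apply/eqP; rewrite eq_le P0 andbT (le_trans PAB)// A0' B0' addr0.
  have Q0' : Q = 0 by apply/eqP; rewrite eq_le Q0 andbT (le_trans QAB)// A0' B0' addr0.
  by rewrite P0' Q0' A0' B0' !mul0r powR0 ?gt_eqF// !(mulr0, addr0, mul0r).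
have {A_neq0}A_gt0 : 0 < A by rewrite lt_def A_neq0.
pose t := B / A; pose m := P / A; pose q := Q / A.
have BE : B = A * t by rewrite mulrC divfK// gt_eqF.
have PE : P = A * m by rewrite mulrC divfK// gt_eqF.
have QE : Q = A * q by rewrite mulrC divfK// gt_eqF.
have t0 : 0 <= t by rewrite divr_ge0.
have m0 : 0 <= m by rewrite divr_ge0.
have q0 : 0 <= q by rewrite divr_ge0.
have t1 : t <= 1 by rewrite ler_pdivrMr// mul1r.
have mt : m <= 1 + t by rewrite -(ler_pM2l A_gt0) -PE mulrDr mulr1 -BE.
have qt : q <= 1 + t by rewrite -(ler_pM2l A_gt0) -QE mulrDr mulr1 -BE.
have {}par : m ^+ 2 + q ^+ 2 = (1 + t ^+ 2) *+ 2.
  have A2 : A ^+ 2 != 0 by rewrite expf_neq0// gt_eqF.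
  by apply: (mulfI A2); move: par; rewrite BE PE QE; lra.
have -> : Q `^ p = A `^ p * q `^ p by rewrite {1}QE powRM.
have -> : (P / 2) `^ p = A `^ p * (m / 2) `^ p.
  by rewrite {1}PE -mulrA powRM ?divr_ge0.
have -> : B `^ p = A `^ p * t `^ p by rewrite {1}BE powRM.
have Ap0 : 0 < A `^ p by exact: powR_gt0.
suff : q `^ p + C * (m / 2) `^ p <= e * (1 + t `^ p) + C * ((1 + t `^ p) / 2).
  by rewrite -(ler_pM2l Ap0); lra.
have gap0 : (m / 2) `^ p <= ((1 + t) / 2) `^ p.
  by apply: ler_powR2r; [rewrite divr_ge0|rewrite ler_pM2r// invr_gt0].
have u0 : 0 < (1 + t) / 2 by rewrite divr_gt0// ltr_pwDl.
have gap1 : ((1 + t) / 2) `^ p <= (1 + t `^ p) / 2.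
  have h1 := tangent_powR u0 ler01; have := tangent_powR u0 t0.
  by rewrite powR1 in h1; move: h1; lra.
have tp0 := powR_ge0 t p.
have [qe|qe] := leP (q `^ p) e.
  have : C * (m / 2) `^ p <= C * ((1 + t `^ p) / 2).
    by rewrite ler_pM2l// (le_trans gap0).
  have : 0 <= e * t `^ p by rewrite mulr_ge0// ltW.
  by move: qe; lra.
have qe1 : e1 <= q.
  rewrite leNgt; apply/negP => qe1; have := ler_powR2r q0 (ltW qe1).
  by move/le_trans/(_ e1p); rewrite leNgt qe.
have qp : q `^ p <= 2 `^ p by apply: ler_powR2r => //; lra.
suff : c' <= (1 + t `^ p) / 2 - (m / 2) `^ p.
  move/Cc; rewrite -/C mulrBr => h.
  have : 0 <= e * (1 + t `^ p) by rewrite mulr_ge0 ?addr_ge0// ltW.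
  by move: h qp; lra.
have [tk|tk] := leP t (1 - k / (2 * p)).
  have := hc t; rewrite t0 tk => /(_ isT) h.
  have : c' <= c by rewrite ge_min lexx.
  by move: h gap0; lra.
have c'k : c' <= k / 2 by rewrite ge_min lexx orbT.
have k1 : k <= 1.
  have : e1 <= 2 by lra.
  by rewrite /k; nra.
have m2 : m / 2 <= 1 - k.
  have e1q : e1 ^+ 2 <= q ^+ 2 by rewrite ler_pXn2r ?nnegrE// ltW.
  have m4 : m ^+ 2 <= (2 * (1 - k)) ^+ 2 by move: e1q; rewrite /k; nra.
  have : m <= 2 * (1 - k).
    by rewrite -(@ler_pXn2r _ 2)// nnegrE; lra.
  by lra.
have mp : (m / 2) `^ p <= 1 - k.
  have [->|m_neq0] := eqVneq m 0.
    by rewrite mul0r powR0 ?gt_eqF// subr_ge0.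
  apply: le_trans m2; apply: ge1r_powR; last exact: ltW.
  by apply/andP; split; [rewrite divr_gt0// lt_def m_neq0|lra].
have := bernoulli_powR t0.
have : p * (t - 1) >= - (k / 2).
  have -> : - (k / 2) = p * (- (k / (2 * p))) by field; rewrite gt_eqF.
  by rewrite ler_pM2l//; lra.
by move: mp; lra.
Qed.

End power_inequalities.

(** * Uniform convexity and smoothness of function spaces *)

Section seminormed_quotient_sub.
Context (K : numFieldType) (V : seminormed K).
Local Open Scope quotient_scope.

Lemma sn_quotB (f g : V) : \pi_(sn_quot V) (f - g) = \pi_(sn_quot V) f - \pi_(sn_quot V) g.
Proof. by rewrite sn_quotD -(scaleN1r g) sn_quotZ scaleN1r. Qed.

End seminormed_quotient_sub.

Section function_space.
Context d (T : measurableType d) (R : realType) (mu : {measure set T -> \bar R}).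

Lemma le_integral_combination (F1 F2 G1 G2 : T -> R) (a1 a2 b1 b2 f1 f2 g1 g2 : R) :
  measurable_fun setT F1 -> measurable_fun setT F2 ->
  measurable_fun setT G1 -> measurable_fun setT G2 ->
  (forall t, 0 <= F1 t) -> (forall t, 0 <= F2 t) ->
  (forall t, 0 <= G1 t) -> (forall t, 0 <= G2 t) ->
  0 <= a1 -> 0 <= a2 -> 0 <= b1 -> 0 <= b2 ->
  (\int[mu]_t (F1 t)%:E = f1%:E)%E -> (\int[mu]_t (F2 t)%:E = f2%:E)%E ->
  (\int[mu]_t (G1 t)%:E = g1%:E)%E -> (\int[mu]_t (G2 t)%:E = g2%:E)%E ->
  (forall t, a1 * F1 t + a2 * F2 t <= b1 * G1 t + b2 * G2 t) ->
  a1 * f1 + a2 * f2 <= b1 * g1 + b2 * g2.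
Proof.
move=> mF1 mF2 mG1 mG2 F10 F20 G10 G20 a10 a20 b10 b20 iF1 iF2 iG1 iG2 h.
have comb (F G : T -> R) (a b f g : R) : measurable_fun setT F -> measurable_fun setT G ->
    (forall t, 0 <= F t) -> (forall t, 0 <= G t) -> 0 <= a -> 0 <= b ->
    (\int[mu]_t (F t)%:E = f%:E)%E -> (\int[mu]_t (G t)%:E = g%:E)%E ->
    (\int[mu]_t (a * F t + b * G t)%:E = (a * f + b * g)%:E)%E.
  move=> mF mG F0 G0 a0 b0 iF iG.
  rewrite (eq_integral (fun t => a%:E * (F t)%:E + b%:E * (G t)%:E)%E); last first.
    by move=> t _; rewrite -!EFinM -EFinD.
  rewrite ge0_integralD//.
  - rewrite ge0_integralZl//; last 2 first.
    + exact/measurable_EFinP.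
    + by move=> t _; rewrite lee_fin.
    rewrite ge0_integralZl//; last 2 first.
    + exact/measurable_EFinP.
    + by move=> t _; rewrite lee_fin.
    by rewrite iF iG -!EFinM -EFinD.
  - by move=> t _; rewrite -EFinM lee_fin mulr_ge0.
  - by apply: measurable_funeM; exact/measurable_EFinP.
  - by move=> t _; rewrite -EFinM lee_fin mulr_ge0.
  - by apply: measurable_funeM; exact/measurable_EFinP.
rewrite -lee_fin -(comb F1 F2)// -(comb G1 G2)//.
apply: ge0_le_integral => //.
- by move=> t _; rewrite lee_fin addr_ge0// mulr_ge0.
- by apply/measurable_EFinP/measurable_funD; apply: measurable_funM.
- by apply/measurable_EFinP/measurable_funD; apply: measurable_funM.
- by move=> t _; rewrite lee_fin.
Qed.

Lemma measurable_powR_comp (F : T -> R) (r : R) :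
  measurable_fun setT F -> measurable_fun setT (fun t => F t `^ r).
Proof. by move=> mF; apply: (measurableT_comp (measurable_powR _)). Qed.

Variables (p : R) (p1 : 1 < p).
Context (K : numFieldType) (s : real_scalars R K) (V : seminormed K).
Variable val : V -> T -> K.
Local Notation modu := (modulus s).
Hypothesis valD : forall f g t, val (f + g) t = val f t + val g t.
Hypothesis valB : forall f g t, val (f - g) t = val f t - val g t.
Hypothesis measurable_val : forall f, measurable_fun setT (fun t => modu (val f t)).
Hypothesis integral_val : forall f,
  (\int[mu]_t (modu (val f t) `^ p)%:E = (modu (snorm f) `^ p)%:E)%E.
Hypothesis parallelogram : forall a b : K,
  modu (a + b) ^+ 2 + modu (a - b) ^+ 2 = (modu a ^+ 2 + modu b ^+ 2) *+ 2.

Local Notation "|: x :|" := (rnorm s x) (format "|: x :|").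

Let p0 : 0 < p. Proof. exact: lt_trans p1. Qed.

Let modulusDB (a b : K) : modu (a - b) <= modu a + modu b.
Proof. by rewrite -(modulusN s b) modulusD. Qed.

Let rnorm_pi (f : V) : |:\pi_(sn_quot V)%qT f:| = modu (snorm f).
Proof. by rewrite /rnorm sn_quot_norm. Qed.

(** Integrating [powR_convex] bounds the [p]-th power of [|(f + g) / 2|] by [1 - e^p / (2C)] as soon
    as [|f - g| >= e]; Bernoulli's inequality converts this into a bound on the norm itself. *)
Lemma Lp_rconvex : rconvex s (sn_quot V).
Proof.
move=> e e0; have ep0 : 0 < e `^ p by exact: powR_gt0.
have [C C0 hC] := powR_convex p1 (divr_gt0 ep0 (ltr0Sn R 3)).
exists (e `^ p / (p * C)) => [|x y]; first by rewrite divr_gt0// mulr_gt0.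
rewrite -(reprK x) -(reprK y); move: (repr x) (repr y) => f g {x y}.
rewrite -sn_quotB -sn_quotD !rnorm_pi => f1 g1 efg.
have := integral_val f; have := integral_val g; rewrite f1 g1 powR1 => ig jf.
have Cp : 0 <= C * 2^-1 `^ p by rewrite mulr_ge0 ?(ltW C0) ?powR_ge0.
have eC : 0 <= e `^ p / 4 + C / 2 by rewrite addr_ge0 ?divr_ge0 ?(ltW C0) ?(ltW ep0).
have pw t : 1 * modu (val (f - g) t) `^ p + C * 2^-1 `^ p * modu (val (f + g) t) `^ p <=
    (e `^ p / 4 + C / 2) * modu (val f t) `^ p + (e `^ p / 4 + C / 2) * modu (val g t) `^ p.
  rewrite valB valD.
  have := hC _ _ _ _ (modulus_ge0 s (val f t)) (modulus_ge0 s (val g t))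
    (modulus_ge0 s _) (modulus_ge0 s _) (modulusD s _ _) (modulusDB _ _) (parallelogram _ _).
  by rewrite powRM ?modulus_ge0 ?invr_ge0//; lra.
have mp := fun f => measurable_powR_comp p (measurable_val f).
have nn := fun f t => powR_ge0 (modu (val f t)) p.
have := le_integral_combination (mp _) (mp _) (mp _) (mp _) (nn _) (nn _) (nn _) (nn _)
  ler01 Cp eC eC (integral_val (f - g)) (integral_val (f + g)) jf ig pw.
have n0 := modulus_ge0 s (snorm (f + g)); have eq0 := modulus_ge0 s (snorm (f - g)).
rewrite mul1r !mulr1 -mulrA [2^-1 `^ _ * _]mulrC -powRM ?invr_ge0// => hint.
have h2 := ler_powR2r p1 (ltW e0) efg.
have := bernoulli_powR p1 (divr_ge0 n0 (ler0n R 2)).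
rewrite -(ler_pM2l C0) => h3.
rewrite -(ler_pM2l (mulr_gt0 p0 C0)).
have -> : p * C * (2 - e `^ p / (p * C)) = p * C * 2 - e `^ p.
  by field; rewrite !gt_eqF.
by move: h2 h3 hint; lra.
Qed.

(** The error [e * b] has three shares: one for [C * b^p], which fixes the radius [r], and two for
    the mixed term of [powR_smooth], whose integral is at most [2b]. Bernoulli's inequality at both
    norms passes from [p]-th powers to norms. *)
Lemma Lp_rsmooth : rsmooth s (sn_quot V).
Proof.
move=> e e0; have e3 : 0 < e / 3 by rewrite divr_gt0.
have [C C0 hC] := powR_smooth p1 e3.
have C1 : 0 < C + 1 by rewrite ltr_wpDl.
have pB1 : 0 < p - 1 by rewrite subr_gt0.
pose r := (e / 3 / (C + 1)) `^ (p - 1)^-1.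
exists r => [|x y]; first by rewrite powR_gt0// divr_gt0.
rewrite -(reprK x) -(reprK y); move: (repr x) (repr y) => f g {x y}.
rewrite -sn_quotB -sn_quotD !rnorm_pi => f1.
have := modulus_ge0 s (snorm g); rewrite le_eqVlt => /predU1P[/esym g0 _|].
  rewrite g0 mulr0 addr0.
  have g0' : |:\pi_(sn_quot V)%qT g:| = 0 by rewrite rnorm_pi.
  have := rnormD s (\pi_(sn_quot V)%qT f) (\pi_(sn_quot V)%qT g).
  have := rnormD s (\pi_(sn_quot V)%qT f) (- \pi_(sn_quot V)%qT g).
  by rewrite rnormN -sn_quotB -sn_quotD !rnorm_pi g0 f1; lra.
have := integral_val f; rewrite f1 powR1 => jf.
have := integral_val g; move: (modu (snorm g)) => b ig b0 bd.
have bp : C * b `^ p <= e / 3 * b.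
  rewrite -(powRB1_mulr p1 (ltW b0)) mulrA ler_pM2r//.
  have : b `^ (p - 1) <= e / 3 / (C + 1).
    rewrite (le_trans (ge0_ler_powR _ _ _ bd)) ?nnegrE ?powR_ge0 ?(ltW pB1) ?(ltW b0)//.
    by rewrite /r -powRrM mulVf ?gt_eqF// powRr1// divr_ge0 ?(ltW C1) ?(ltW e3).
  rewrite ler_pdivlMr//; have := powR_ge0 b (p - 1); nra.
have bb0 : 0 <= (b^-1) `^ (p - 1) by exact: powR_ge0.
have c1 : 0 <= 2 + e / 3 * b by rewrite addr_ge0// mulr_ge0 ?(ltW e3) ?(ltW b0).
have c2 : 0 <= C + e / 3 * b^-1 `^ (p - 1) by rewrite addr_ge0// mulr_ge0 ?(ltW e3).
have pw t : 1 * modu (val (f + g) t) `^ p + 1 * modu (val (f - g) t) `^ p <=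
    (2 + e / 3 * b) * modu (val f t) `^ p + (C + e / 3 * b^-1 `^ (p - 1)) * modu (val g t) `^ p.
  rewrite valB valD.
  have AD (a c : K) : modu a <= modu (a + c) + modu c.
    by rewrite -{1}(addrK c a) modulusDB.
  have AB (a c : K) : modu a <= modu (a - c) + modu c.
    by rewrite -{1}(subrK c a) modulusD.
  have := hC _ _ _ _ (modulus_ge0 s (val f t)) (modulus_ge0 s (val g t))
    (modulus_ge0 s _) (modulus_ge0 s _) (modulusD s _ _) (modulusDB _ _)
    (AD _ _) (AB _ _) (parallelogram _ _).
  have := modulus_ge0 s (val f t); have := modulus_ge0 s (val g t).
  move: (modu (val f t)) (modu (val g t)) => A B B0 A0.
  (* A pointwise form of Hölder's inequality, up to a factor 2: after integration each of the two
     terms contributes [b], the norm of [g]. *)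
  have mix : A `^ (p - 1) * B <= b * A `^ p + b^-1 `^ (p - 1) * B `^ p.
    have [Ab|Ab] := leP B (b * A).
      apply: (@le_trans _ _ (b * A `^ p)); last by rewrite lerDl mulr_ge0// powR_ge0.
      by rewrite -(powRB1_mulr p1 A0) mulrCA ler_wpM2l ?powR_ge0.
    apply: (@le_trans _ _ (b^-1 `^ (p - 1) * B `^ p)); last first.
      by rewrite lerDr mulr_ge0 ?powR_ge0// ltW.
    rewrite -(powRB1_mulr p1 B0) mulrA ler_wpM2r// -powRM ?invr_ge0 ?(ltW b0)//.
    by rewrite ge0_ler_powR ?nnegrE ?(ltW pB1) ?mulr_ge0 ?invr_ge0 ?(ltW b0)// ler_pdivlMl// ltW.
  have := ler_wpM2l (ltW e3) mix; lra.
have mp := fun f => measurable_powR_comp p (measurable_val f).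
have nn := fun f t => powR_ge0 (modu (val f t)) p.
have := le_integral_combination (mp _) (mp _) (mp _) (mp _) (nn _) (nn _) (nn _) (nn _)
  ler01 ler01 c1 c2 (integral_val (f + g)) (integral_val (f - g)) jf ig pw.
have -> : (C + e / 3 * b^-1 `^ (p - 1)) * b `^ p = C * b `^ p + e / 3 * b.
  rewrite mulrDl -(powRB1_mulr p1 (ltW b0)) !mulrA -[e / 3 * _ * _]mulrA
    -powRM ?invr_ge0 ?(ltW b0)//.
  by rewrite mulVf ?gt_eqF// powR1 mulr1.
have := bernoulli_powR p1 (modulus_ge0 s (snorm (f + g))).
have := bernoulli_powR p1 (modulus_ge0 s (snorm (f - g))).
move: (modu (snorm (f + g))) (modu (snorm (f - g))) => m n hn hm hmn.
have : p * (m + n - 2) <= e * b by move: hn hm hmn bp; lra.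
have eb : 0 <= e * b by rewrite mulr_ge0// ltW.
have [mn|mn] := leP (m + n - 2) 0; first by lra.
have : m + n - 2 <= p * (m + n - 2) by rewrite ler_peMl// ltW.
by lra.
Qed.

End function_space.

(** * Completeness of L_p *)

Section real_Lp.
Context d (T : measurableType d) (R : realType) (mu : {measure set T -> \bar R}).
Variables (p : R) (q1 : (1 <= p%:E)%E).
Hypothesis p1 : 1 < p.

Let p0 : 0 < p. Proof. exact: lt_trans p1. Qed.
Let pn0 : p != 0. Proof. by rewrite gt_eqF. Qed.

Implicit Types f g : LfunType mu q1.

Lemma measurable_norm_powR (F : T -> R) : measurable_fun setT F ->
  measurable_fun setT (fun t => (`|F t| `^ p)%:E).
Proof.
move=> mF; apply/measurable_EFinP; apply: (measurable_powR_comp p).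
exact: measurableT_comp.
Qed.

Lemma integral_powR_Lnorm (F : T -> R) :
  ('N[mu]_(p%:E)[EFin \o F] `^ p = \int[mu]_t (`|F t| `^ p)%:E)%E.
Proof. by rewrite powR_Lnorm. Qed.

Lemma measurable_Lfun f : measurable_fun setT f.
Proof. exact: measurable_funP. Qed.

Lemma Lp_norm_ge0 f : 0 <= Lp_norm f.
Proof. by rewrite fine_ge0// Lnorm_ge0. Qed.

Lemma Lp_norm_integral f : (\int[mu]_t (`|f t| `^ p)%:E = (Lp_norm f `^ p)%:E)%E.
Proof. by rewrite -integral_powR_Lnorm -finite_norm_fine. Qed.

Lemma Lfun_of_integral (F : T -> R) : measurable_fun setT F ->
  (\int[mu]_t (`|F t| `^ p)%:E < +oo)%E -> F \in Lfun mu p%:E.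
Proof.
move=> mF iF; apply/andP; split; rewrite inE//=.
by rewrite /finite_norm; apply: (@lty_poweRy _ _ p pn0); rewrite integral_powR_Lnorm.
Qed.

Lemma Lfun_dominated (F : T -> R) f : measurable_fun setT F ->
  (forall t, `|F t| <= `|f t|) -> F \in Lfun mu p%:E.
Proof.
move=> mF Ff; apply: Lfun_of_integral => //.
apply: (@le_lt_trans _ _ (\int[mu]_t (`|f t| `^ p)%:E)%E); last first.
  by rewrite Lp_norm_integral ltry.
apply: ge0_le_integral => //.
- exact: measurable_norm_powR.
- by apply: measurable_norm_powR; exact: measurable_Lfun.
- by move=> t _; rewrite lee_fin ler_powR2r.
Qed.

Lemma Lp_norm_le f g : (forall t, `|f t| <= `|g t|) -> Lp_norm f <= Lp_norm g.
Proof.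
move=> fg.
have : ((Lp_norm f `^ p)%:E <= (Lp_norm g `^ p)%:E)%E.
  rewrite -!Lp_norm_integral; apply: ge0_le_integral => //.
  - by apply: measurable_norm_powR; exact: measurable_Lfun.
  - by apply: measurable_norm_powR; exact: measurable_Lfun.
  - by move=> t _; rewrite lee_fin ler_powR2r.
rewrite lee_fin => h; rewrite leNgt; apply/negP => gf.
have := @gt0_ltr_powR R p p0 (Lp_norm g) (Lp_norm f).
by rewrite !nnegrE !Lp_norm_ge0 => /(_ isT isT gf); rewrite ltNge h.
Qed.

Lemma abs_Lfun_proof f : (fun t => `|f t|) \in Lfun mu p%:E.
Proof.
apply: (@Lfun_dominated _ f) => [|t]; last by rewrite normr_id.
by apply: measurableT_comp => //; exact: measurable_Lfun.
Qed.

Definition abs_Lfun f : LfunType mu q1 := Lfun_Sub q1 (abs_Lfun_proof f).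

Lemma Lp_norm_abs f : Lp_norm (abs_Lfun f) = Lp_norm f.
Proof. by apply/eqP; rewrite eq_le !Lp_norm_le//= => t /=; rewrite normr_id. Qed.

Section riesz_fischer.
Variables (u : nat -> LfunType mu q1) (c : R).
Hypothesis hu : forall n, Lp_norm (u n - u n.+1) <= c / 2 ^+ n.

Let G := fix G n : LfunType mu q1 :=
  if n is m.+1 then G m + abs_Lfun (u m - u m.+1) else 0.

Let GS n t : G n.+1 t = G n t + `|u n t - u n.+1 t|. Proof. by []. Qed.

Let G0 n t : 0 <= G n t.
Proof. by elim: n => [|n IH]; [rewrite /=|rewrite GS addr_ge0]. Qed.

Let G_homo t : nondecreasing_seq (fun n => G n t).
Proof. by apply/nondecreasing_seqP => n; rewrite GS lerDl. Qed.

Let c0 : 0 <= c.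
Proof. by have := hu 0; rewrite expr0 divr1; apply: le_trans; exact: Lp_norm_ge0. Qed.

Let norm_G n : Lp_norm (G n) <= c *+ 2.
Proof.
suff : Lp_norm (G n) <= c *+ 2 - c *+ 2 / 2 ^+ n.
  by move=> /le_trans; apply; rewrite gerBl divr_ge0 ?mulrn_wge0 ?exprn_ge0.
elim: n => [|n IH].
  by rewrite expr0 divr1 subrr /Lp_norm Lnorm0// gt_eqF// lte_fin.
rewrite (le_trans (Lp_normD _ _))// (le_trans (lerD IH (lexx _)))//.
rewrite -addrA lerD2l Lp_norm_abs exprS invfM.
by have := hu n; set i := (2 ^+ _)^-1; lra.
Qed.

Let dist_G t n k : `|u n t - u (n + k)%N t| <= G (n + k)%N t.
Proof.
suff : `|u n t - u (n + k)%N t| <= G (n + k)%N t - G n t.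
  by move=> /le_trans; apply; rewrite gerBl.
elim: k => [|k IH]; first by rewrite addn0 !subrr normr0.
rewrite addnS -(subrKA (u (n + k)%N t)) (le_trans (ler_normD _ _))// GS addrAC.
exact: lerD.
Qed.

Let h n t : \bar R := (`|G n t| `^ p)%:E.

Let mh n : measurable_fun setT (h n).
Proof. by apply: measurable_norm_powR; exact: measurable_Lfun. Qed.

Let h0 n t : (0 <= h n t)%E. Proof. by rewrite lee_fin powR_ge0. Qed.

Let h_homo t : nondecreasing_seq (h ^~ t).
Proof.
move=> m n mn; rewrite lee_fin ler_powR2r//.
by rewrite !ger0_norm//; exact: G_homo.
Qed.

(** The dominating function: [G n] bounds the distances between terms up to index [n], and the norms
    of the [G n] stay below [c *+ 2], so the monotone limit of their [p]-th powers is integrable. *)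
Let H t : \bar R := limn (h ^~ t).

Let h_le_H n t : (h n t <= H t)%E.
Proof.
rewrite /H; have /cvg_lim -> // := ereal_nondecreasing_cvgn (h_homo t).
by apply: ereal_sup_ubound; exists n.
Qed.

Let mH : measurable_fun setT H.
Proof.
apply: (@emeasurable_fun_cvg _ _ _ setT h H mh) => t _.
exact: ereal_nondecreasing_is_cvgn.
Qed.

Let integral_H : (\int[mu]_t H t < +oo)%E.
Proof.
rewrite monotone_convergence//.
  apply: (@le_lt_trans _ _ ((c *+ 2) `^ p)%:E); last exact: ltry.
  apply: lime_le.
    apply: ereal_nondecreasing_is_cvgn => m n mn; apply: ge0_le_integral => // t _.
    exact: h_homo.
  apply: nearW => n; rewrite /h Lp_norm_integral lee_fin ler_powR2r//.
  exact: Lp_norm_ge0.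
Qed.

Let H0 t : (0 <= H t)%E. Proof. exact: le_trans (h_le_H 0 t). Qed.

Let D : set T := [set t | (H t < +oo)%E].

Let mD : measurable D.
Proof. by rewrite -[D]setTI; exact: emeasurable_fun_infty_o. Qed.

Let aeD : {ae mu, forall t, D t}.
Proof.
have iH : mu.-integrable setT H.
  by apply/integrableP; split=> //; under eq_integral do rewrite gee0_abs//.
have := integrable_ae measurableT iH; apply: filterS => t /(_ I).
by rewrite ge0_fin_numE.
Qed.

Let bound t : R := fine (H t) `^ p^-1.

Let G_bound n t : D t -> G n t <= bound t.
Proof.
move=> Dt; rewrite -[leLHS](@powRr1 R)// -(mulfV pn0) powRrM.
rewrite ge0_ler_powR ?nnegrE ?invr_ge0 ?(ltW p0) ?powR_ge0 ?fine_ge0//.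
rewrite -lee_fin fineK ?ge0_fin_numE//.
by have := h_le_H n t; rewrite /h ger0_norm.
Qed.

(** Cut off to 0 where [H] is infinite, so that the limit exists everywhere and is measurable. *)
Let v n : T -> R := u n \_ D.

Let cvg_v t : cvgn (v ^~ t).
Proof.
have [Dt|nDt] := pselect (D t); last first.
  rewrite (_ : v ^~ t = fun=> 0); first exact: is_cvg_cst.
  by apply/funext => n; rewrite /v patchE memNset.
(* A sequence of bounded variation is the difference of two bounded nondecreasing sequences. *)
have -> : v ^~ t = (fun n => u n t + G n t) \- (fun n => G n t).
  by apply/funext => n; rewrite /v patchE mem_set//= addrK.
apply: is_cvgB.
  apply: nondecreasing_is_cvgn.
    apply/nondecreasing_seqP => n; rewrite GS.
    by have := ler_norm (u n t - u n.+1 t); lra.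
  exists (u 0%N t + bound t *+ 2) => _ [n _ <-].
  have := dist_G t 0 n; have := G_bound n Dt; rewrite add0n distrC => h1 h2.
  have := le_trans (ler_norm _) h2; lra.
apply: nondecreasing_is_cvgn; first exact: G_homo.
by exists (bound t) => _ [n _ <-]; exact: G_bound.
Qed.

Let l t : R := limn (v ^~ t).

Let ml : measurable_fun setT l.
Proof.
apply: (@measurable_fun_cvg _ _ _ _ v) => [n|t _]; last exact: cvg_v.
apply/measurable_restrict => //; rewrite setTI.
by apply: (measurable_funS measurableT) => //; exact: measurable_Lfun.
Qed.

Let dist_l n t : D t -> `|u n t - l t| <= bound t.
Proof.
move=> Dt; have cl := @cvg_v t.
have cn : `|u n t - v m t| @[m --> \oo] --> `|u n t - l t|.
  by apply: cvg_norm; apply: cvgB cl; exact: cvg_cst.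
rewrite -(cvg_lim _ cn)//; apply: limr_le; first by apply/cvg_ex; eexists; exact: cn.
exists n => // m /= nm; rewrite /v patchE mem_set//.
by have := dist_G t n (m - n); rewrite subnKC// => /le_trans; apply; exact: G_bound.
Qed.

Let dist_l_H n t : D t -> ((`|u n t - l t| `^ p)%:E <= H t)%E.
Proof.
move=> Dt; rewrite -(@fineK _ (H t)) ?ge0_fin_numE// lee_fin.
have -> : fine (H t) = bound t `^ p.
  by rewrite /bound -powRrM mulVf// powRr1// fine_ge0.
by rewrite ler_powR2r// dist_l.
Qed.

Let m_dist n : measurable_fun setT (fun t => u n t - l t).
Proof. by apply: measurable_funB => //; exact: measurable_Lfun. Qed.

Let cvg_integral : (\int[mu]_t (`|u n t - l t| `^ p)%:E)%E @[n --> \oo] --> 0%E.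
Proof.
have iH : mu.-integrable setT H.
  by apply/integrableP; split=> //; under eq_integral do rewrite gee0_abs//.
have [] := @dominated_convergence _ _ _ mu setT measurableT
  (fun n t => (`|u n t - l t| `^ p)%:E) (cst 0%E) H => //.
- by move=> n; exact: measurable_norm_powR.
- apply: filterS aeD => t Dt _.
  apply: cvg_EFin; first exact: nearW.
  have cl := @cvg_v t.
  apply/cvgrPdist_le => e e0; rewrite /=.
  have ep0 : 0 < e `^ p^-1 by exact: powR_gt0.
  have /cvgrPdist_le/(_ _ ep0)[N _ hN] := cl.
  exists N => // n /hN; rewrite /= /v patchE mem_set// distrC => hn.
  rewrite sub0r normrN ger0_norm ?powR_ge0//.
  rewrite (le_trans (ler_powR2r p1 _ hn))// -powRrM mulVf// powRr1// ltW//.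
- by apply: filterS aeD => t Dt n _; rewrite gee0_abs ?lee_fin ?powR_ge0//; exact: dist_l_H.
move=> _ + _; under eq_fun => n do (under eq_integral => t _ do
  rewrite sube0 gee0_abs ?lee_fin ?powR_ge0//).
by [].
Qed.

Lemma Lp_complete_cluster : exists f, forall e, 0 < e -> forall n,
  exists2 m, (n <= m)%N & Lp_norm (u m - f) <= e.
Proof.
have dL : (fun t => u 0%N t - l t) \in Lfun mu p%:E.
  apply: Lfun_of_integral => //; apply: le_lt_trans integral_H.
  apply: ae_ge0_le_integral => //.
  - exact: measurable_norm_powR.
  - by apply: filterS aeD => t Dt _; exact: dist_l_H.
(* The limit [l] enters L_p as [u 0 - (u 0 - l)], because it is [u 0 - l] that [H] dominates. *)
exists (u 0%N - Lfun_Sub q1 dL) => e e0 n.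
have ep0 : 0 < e `^ p by exact: powR_gt0.
have /fine_cvgP[_ /cvgrPdist_le/(_ _ ep0)[N _ hN]] := cvg_integral.
exists (maxn n N); first exact: leq_maxl.
have := hN _ (leq_maxr n N); rewrite /=; set m := maxn n N.
have -> : (\int[mu]_t (`|u m t - l t| `^ p)%:E)%E =
    (Lp_norm (u m - (u 0%N - Lfun_Sub q1 dL)) `^ p)%:E.
  rewrite -Lp_norm_integral; apply: eq_integral => t _.
  congr (_ `^ _)%:E; congr `|_|.
  by rewrite -[RHS]/(u m t - (u 0%N t - (u 0%N t - l t))); ring.
rewrite /= sub0r normrN ger0_norm ?powR_ge0// => hm.
rewrite leNgt; apply/negP => lt; have := gt0_ltr_powR p0 _ _ lt.
by rewrite !nnegrE (ltW e0) Lp_norm_ge0 => /(_ isT isT); rewrite ltNge hm.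
Qed.

End riesz_fischer.

End real_Lp.

(** * Convexity, smoothness and completeness of real L_p *)

Section Lp_real_geometry.
Context d (T : measurableType d) (R : realType) (mu : {measure set T -> \bar R}).
Variables (p : R) (q1 : (1 <= p%:E)%E).
Hypothesis p1 : 1 < p.

Let V := Seminormed (@Lp_normD d T R mu _ q1) (@Lp_normZ d T R mu _ q1)
  (@Lp_norm_eq0 d T R mu _ q1).
Let s := real_real_scalars R.

Let modulusE (x : R) : modulus s x = `|x|. Proof. by []. Qed.

Let measurable_val (f : V) : measurable_fun setT (fun t => modulus s ((f : LfunType mu q1) t)).
Proof. by apply: measurableT_comp => //; exact: measurable_Lfun. Qed.

Let integral_val (f : V) : (\int[mu]_t (modulus s ((f : LfunType mu q1) t) `^ p)%:E =
  (modulus s (snorm f) `^ p)%:E)%E.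
Proof.
rewrite modulusE [snorm f]/(Lp_norm f) ger0_norm ?Lp_norm_ge0//.
exact: (Lp_norm_integral p1).
Qed.

Let parallelogram (a b : R) :
  modulus s (a + b) ^+ 2 + modulus s (a - b) ^+ 2 = (modulus s a ^+ 2 + modulus s b ^+ 2) *+ 2.
Proof. by rewrite !modulusE !real_normK ?num_real//; ring. Qed.

Lemma Lp_real_rconvex : rconvex s (Lp_real mu q1).
Proof.
exact: (@Lp_rconvex _ _ _ mu _ p1 _ s V (fun f t => (f : LfunType mu q1) t)
  (fun _ _ _ => erefl) (fun _ _ _ => erefl) measurable_val integral_val parallelogram).
Qed.

Lemma Lp_real_rsmooth : rsmooth s (Lp_real mu q1).
Proof.
exact: (@Lp_rsmooth _ _ _ mu _ p1 _ s V (fun f t => (f : LfunType mu q1) t)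
  (fun _ _ _ => erefl) (fun _ _ _ => erefl) measurable_val integral_val parallelogram).
Qed.

Lemma Lp_real_rnorm (f : LfunType mu q1) :
  rnorm s (\pi_(sn_quot V)%qT f : Lp_real mu q1) = Lp_norm f.
Proof.
by rewrite /rnorm sn_quot_norm modulusE ger0_norm//; exact: Lp_norm_ge0.
Qed.

Lemma Lp_real_complete : complete_rnorm s (Lp_real mu q1).
Proof.
apply: complete_rnorm_cluster => u c hu.
have [|f hf] := @Lp_complete_cluster _ T R mu p q1 p1 (fun n => repr (u n) : V) c.
  move=> n; have := hu n; rewrite -{1}(reprK (u n)) -{1}(reprK (u n.+1)).
  by rewrite -sn_quotB Lp_real_rnorm.
exists (\pi_(sn_quot V)%qT f) => e e0 n; have [m nm hm] := hf e e0 n.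
by exists m => //; rewrite -(reprK (u m)) -sn_quotB Lp_real_rnorm.
Qed.

End Lp_real_geometry.

(** * Convexity, smoothness and completeness of complex L_p *)

Section Lp_complex_geometry.
Context d (T : measurableType d) (R : realType) (mu : {measure set T -> \bar R}).
Variables (p : R) (q1 : (1 <= p%:E)%E).
Hypothesis p1 : 1 < p.
Import ComplexField.Normc.

Let V := Seminormed (@cLp_normD d T R mu _ q1) (@cLp_normZ d T R mu _ q1)
  (@cLp_norm_eq0 d T R mu _ q1).
Let s := complex_real_scalars R.
Let p0 : 0 < p. Proof. exact: lt_trans p1. Qed.

Implicit Types f g : cLfunType mu q1.

Let cval f : T -> R[i] := cLfun_val f.

Let modulusE (z : R[i]) : modulus s z = normc z. Proof. by []. Qed.

Let cLfun_finite f : cfinite_norm mu p%:E (cval f).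
Proof. by have := valP f; rewrite inE. Qed.

Let measurable_normc (F : T -> R[i]) :
  measurable_fun setT (fun t => complex.Re (F t)) ->
  measurable_fun setT (fun t => complex.Im (F t)) ->
  measurable_fun setT (fun t => normc (F t)).
Proof.
move=> mRe mIm.
rewrite (_ : (fun _ => _) =
    fun t => Num.sqrt (complex.Re (F t) ^+ 2 + complex.Im (F t) ^+ 2)); last first.
  by apply/funext => t; case: (F t).
apply: (measurableT_comp (continuous_measurable_fun (@sqrt_continuous R))).
by apply: measurable_funD; exact: measurable_funX.
Qed.

Let measurable_val (f : V) : measurable_fun setT (fun t => modulus s (cval f t)).
Proof. by have [mr mi _] := cLfun_finite f; exact: measurable_normc. Qed.

Let modulus_Lfun f : (fun t => normc (cval f t)) \in Lfun mu p%:E.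
Proof.
by have [mr mi fin] := cLfun_finite f; apply/andP; split; rewrite inE//; exact: measurable_normc.
Qed.

Let modulus_snorm (f : V) : modulus s (snorm f) = Lp_norm (Lfun_Sub q1 (modulus_Lfun f)).
Proof.
have -> : snorm f = s (Lp_norm (Lfun_Sub q1 (modulus_Lfun f))) by [].
by rewrite modulus_emb ger0_norm// Lp_norm_ge0.
Qed.

Let integral_val (f : V) : (\int[mu]_t (modulus s (cval f t) `^ p)%:E =
  (modulus s (snorm f) `^ p)%:E)%E.
Proof.
rewrite modulus_snorm -(Lp_norm_integral p1); apply: eq_integral => t _ /=.
by rewrite ger0_norm// -modulusE modulus_ge0.
Qed.

Let parallelogram (a b : R[i]) :
  modulus s (a + b) ^+ 2 + modulus s (a - b) ^+ 2 = (modulus s a ^+ 2 + modulus s b ^+ 2) *+ 2.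
Proof.
rewrite !modulusE; case: a b => [a1 a2] [b1 b2] /=.
by rewrite !sqr_sqrtr ?addr_ge0 ?sqr_ge0//; ring.
Qed.

Lemma Lp_complex_rconvex : rconvex s (Lp_complex mu q1).
Proof.
exact: (@Lp_rconvex _ _ _ mu _ p1 _ s V cval
  (fun _ _ _ => erefl) (fun _ _ _ => erefl) measurable_val integral_val parallelogram).
Qed.

Lemma Lp_complex_rsmooth : rsmooth s (Lp_complex mu q1).
Proof.
exact: (@Lp_rsmooth _ _ _ mu _ p1 _ s V cval
  (fun _ _ _ => erefl) (fun _ _ _ => erefl) measurable_val integral_val parallelogram).
Qed.

Let Re_Lfun f : (fun t => complex.Re (cval f t)) \in Lfun mu p%:E.
Proof.
have [mr mi _] := cLfun_finite f.
apply: (@Lfun_dominated _ _ _ _ _ q1 p1 _ (Lfun_Sub q1 (modulus_Lfun f))) => // t.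
by rewrite /= [leRHS]ger0_norm ?Re_le_normc// -modulusE modulus_ge0.
Qed.

Let Im_Lfun f : (fun t => complex.Im (cval f t)) \in Lfun mu p%:E.
Proof.
have [mr mi _] := cLfun_finite f.
apply: (@Lfun_dominated _ _ _ _ _ q1 p1 _ (Lfun_Sub q1 (modulus_Lfun f))) => // t.
by rewrite /= [leRHS]ger0_norm ?Im_le_normc// -modulusE modulus_ge0.
Qed.

Let complex_cLfun (a b : LfunType mu q1) : (fun t => (a t +i* b t)%C) \in cLfun mu p%:E.
Proof.
rewrite inE; split.
- exact: (measurable_Lfun a).
- exact: (measurable_Lfun b).
have : (fun t => normc (a t +i* b t)%C) \in Lfun mu p%:E; last first.
  by move=> /sub_Lfun_finLfun; rewrite inE.
apply: (@Lfun_dominated _ _ _ _ _ q1 p1 _ (abs_Lfun p1 a + abs_Lfun p1 b)).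
  by apply: measurable_normc; exact: measurable_Lfun.
move=> t; rewrite ger0_norm -?modulusE ?modulus_ge0//.
apply: le_trans (normc_le_ReIm _) _; exact: ler_norm.
Qed.

(** The real and imaginary parts of a difference are dominated by its modulus, so both sequences of
    parts converge in real L_p, and their limits recombine. *)
Lemma Lp_complex_complete : complete_rnorm s (Lp_complex mu q1).
Proof.
pose re f : LfunType mu q1 := Lfun_Sub q1 (Re_Lfun f).
pose im f : LfunType mu q1 := Lfun_Sub q1 (Im_Lfun f).
have normB f g (r : cLfunType mu q1 -> LfunType mu q1) :
    (forall t, `|r f t - r g t| <= normc (cval f t - cval g t)) ->
    Lp_norm (r f - r g) <= rnorm s (\pi_(sn_quot V)%qT f - \pi_(sn_quot V)%qT g).
  move=> h; rewrite -sn_quotB /rnorm sn_quot_norm [X in modulus s X](_ : _ = snorm (f - g : V)) //.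
  rewrite modulus_snorm; apply: (Lp_norm_le p1) => t /=.
  by rewrite [leRHS]ger0_norm; [exact: h|rewrite -modulusE modulus_ge0].
have hre f g t : `|re f t - re g t| <= normc (cval f t - cval g t).
  by rewrite /= -raddfB; exact: Re_le_normc.
have him f g t : `|im f t - im g t| <= normc (cval f t - cval g t).
  by rewrite /= -raddfB; exact: Im_le_normc.
apply: complete_rnorm_cluster => u c hu.
pose w n : V := repr (u n).
have hw n : rnorm s (\pi_(sn_quot V)%qT (w n) - \pi_(sn_quot V)%qT (w n.+1)) <= c / 2 ^+ n.
  by rewrite !reprK.
pose W := Seminormed (@Lp_normD d T R mu _ q1) (@Lp_normZ d T R mu _ q1)
  (@Lp_norm_eq0 d T R mu _ q1).
have part (r : cLfunType mu q1 -> LfunType mu q1) :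
    (forall f g t, `|r f t - r g t| <= normc (cval f t - cval g t)) ->
    exists a : LfunType mu q1, forall n, Lp_norm (r (w n) - a) <= c *+ 2 / 2 ^+ n.
  move=> hr.
  have [|a ha] := @Lp_real_complete _ T R mu p q1 p1 (fun n => \pi_(sn_quot W)%qT (r (w n) : W)) c.
    by move=> n; rewrite -sn_quotB Lp_real_rnorm; apply: le_trans (hw n); exact: normB.
  exists (repr a) => n; have := ha n.
  by rewrite -{1}(reprK a) -sn_quotB Lp_real_rnorm.
have [a ha] := part re hre; have [b hb] := part im him.
pose l : cLfunType mu q1 := CLfun q1 (complex_cLfun a b).
exists (\pi_(sn_quot V)%qT (l : V)) => e e0 n.
have [N hN] := geometric_small (c *+ 2) (divr_gt0 e0 (ltr0Sn R 1)).
exists (maxn n N); first exact: leq_maxl.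
set m := maxn n N; have hm := hN m (leq_maxr _ _).
rewrite -(reprK (u m)) -sn_quotB /rnorm sn_quot_norm modulus_snorm.
apply: (@le_trans _ _ (Lp_norm (abs_Lfun p1 (re (w m) - a) + abs_Lfun p1 (im (w m) - b)))).
  apply: (Lp_norm_le p1) => t.
  rewrite [leRHS]ger0_norm ?addr_ge0//= ger0_norm -?modulusE ?modulus_ge0//.
  by have := normc_le_ReIm (cval (w m) t - (a t +i* b t)%C); rewrite !raddfB.
apply: le_trans (Lp_normD _ _) _; rewrite !Lp_norm_abs.
by have := ha m; have := hb m; lra.
Qed.

End Lp_complex_geometry.

(** * The numerical index of real L_p *)

Section signed_power.
Context (R : realType) (p : R).
Hypothesis p1 : 1 < p.
Implicit Types x c : R.

Let pB1 : 0 < p - 1. Proof. by rewrite subr_gt0. Qed.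
Let pB1n0 : p - 1 != 0. Proof. by rewrite gt_eqF. Qed.

(* sg(x) |x|^(p-1), in a visibly measurable form. *)
Definition signed_power x := Num.max x 0 `^ (p - 1) - Num.max (- x) 0 `^ (p - 1).

Lemma signed_power_ge0 x : 0 <= x -> signed_power x = x `^ (p - 1).
Proof.
move=> x0; rewrite /signed_power max_l// max_r ?oppr_le0//.
by rewrite powR0// subr0.
Qed.

Lemma signed_powerN x : signed_power (- x) = - signed_power x.
Proof. by rewrite /signed_power opprK opprB. Qed.

Lemma signed_power0 : signed_power 0 = 0.
Proof. by rewrite signed_power_ge0// powR0. Qed.

Lemma norm_signed_power x : `|signed_power x| = `|x| `^ (p - 1).
Proof.
have [x0|/ltW x0] := leP 0 x; first by rewrite signed_power_ge0// !ger0_norm ?powR_ge0.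
rewrite -(opprK x) signed_powerN !normrN signed_power_ge0 ?oppr_ge0//.
by rewrite ger0_norm ?powR_ge0// ler0_norm.
Qed.

Lemma signed_powerM c x : signed_power (c * x) = signed_power c * signed_power x.
Proof.
wlog x0 : x / 0 <= x => [h|].
  have [|/ltW x0] := leP 0 x; first exact: h.
  by have := h (- x); rewrite oppr_ge0 mulrN !signed_powerN mulrN => /(_ x0)/oppr_inj.
wlog c0 : c / 0 <= c => [h|].
  have [|/ltW c0] := leP 0 c; first exact: h.
  by have := h (- c); rewrite oppr_ge0 mulNr !signed_powerN mulNr => /(_ c0)/oppr_inj.
by rewrite !signed_power_ge0 ?mulr_ge0// powRM.
Qed.

Lemma signed_power_mul x : signed_power x * x = `|x| `^ p.
Proof.
have [x0|/ltW x0] := leP 0 x.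
  by rewrite signed_power_ge0// (powRB1_mulr p1)// ger0_norm.
rewrite -(opprK x) signed_powerN mulNr mulrN opprK signed_power_ge0 ?oppr_ge0//.
by rewrite (powRB1_mulr p1) ?oppr_ge0// opprK ler0_norm.
Qed.

Lemma signed_power_mul_norm x y : 0 <= x * y -> signed_power x * y = `|x| `^ (p - 1) * `|y|.
Proof.
move=> xy; rewrite -norm_signed_power -normrM ger0_norm//.
have [->|x0] := eqVneq x 0; first by rewrite signed_power0 mul0r.
have : 0 <= signed_power x * x * (x * y) by rewrite signed_power_mul mulr_ge0// powR_ge0.
have -> : signed_power x * x * (x * y) = x ^+ 2 * (signed_power x * y) by ring.
have x2 : 0 < x ^+ 2 by rewrite exprn_even_gt0.
by rewrite (pmulr_rge0 _ x2).
Qed.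

Lemma measurable_signed_power d (T : measurableType d) (F : T -> R) :
  measurable_fun setT F -> measurable_fun setT (fun t => signed_power (F t)).
Proof.
move=> mF; apply: measurable_funB; apply: measurable_powR_comp; apply: measurable_maxr => //.
exact: measurableT_comp.
Qed.

End signed_power.

Section real_Lp_index.
Context d (T : measurableType d) (R : realType) (mu : {measure set T -> \bar R}).
Variables (p : R) (q1 : (1 <= p%:E)%E).
Hypothesis p1 : 1 < p.

Let V := Seminormed (@Lp_normD d T R mu _ q1) (@Lp_normZ d T R mu _ q1)
  (@Lp_norm_eq0 d T R mu _ q1).
Let s := real_real_scalars R.
Local Notation L := (LfunType mu q1).
Local Notation X := (Lp_real mu q1).
Local Notation cls f := (\pi_(sn_quot V)%qT (f : V) : X).
Local Notation rep x := (repr (x : X) : L).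

Let p0 : 0 < p. Proof. exact: lt_trans p1. Qed.
Let pB1 : 0 < p - 1. Proof. by rewrite subr_gt0. Qed.

Implicit Types (a b f g h u : L) (W : T -> R) (x y : X).

(** With [g] in L_p, this bound puts [W] in the dual L_q and controls its norm, in terms of the
    exponent [p] alone. *)
Definition weight g W := measurable_fun setT W /\ forall t, `|W t| <= `|g t| `^ (p - 1).

Definition pairing W f : R := \int[mu]_t (W t * f t).

Let integrable_powR f : mu.-integrable setT (EFin \o (fun t => `|f t| `^ p)).
Proof.
apply/integrableP; split.
  by apply: measurable_norm_powR; exact: measurable_Lfun.
under eq_integral do rewrite /= ger0_norm ?powR_ge0//.
by rewrite (Lp_norm_integral p1) ltry.
Qed.

Let Rintegral_powR f : \int[mu]_t (`|f t| `^ p) = Lp_norm f `^ p.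
Proof. by rewrite /Rintegral (Lp_norm_integral p1). Qed.

Let young (a b : R) : 0 <= a -> 0 <= b -> p * (a `^ (p - 1) * b) <= b `^ p + (p - 1) * a `^ p.
Proof.
move=> a0 b0; have [->|an0] := eqVneq a 0.
  by rewrite !powR0 ?gt_eqF// mul0r !mulr0 addr0 powR_ge0.
have a_gt0 : 0 < a by rewrite lt_def an0.
have := tangent_powR p1 a_gt0 b0; have := powRB1_mulr p1 a0; nra.
Qed.

Let integrableMl (c : R) (F : T -> R) : mu.-integrable setT (EFin \o F) ->
  mu.-integrable setT (EFin \o (fun t => c * F t)).
Proof. by move=> iF; exact: (integrableZl measurableT c iF). Qed.

Let integrable_add (F G : T -> R) : mu.-integrable setT (EFin \o F) ->
  mu.-integrable setT (EFin \o G) -> mu.-integrable setT (EFin \o (fun t => F t + G t)).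
Proof. by move=> iF iG; exact: (integrableD measurableT iF iG). Qed.

Lemma weight_integrable g W f : weight g W ->
  mu.-integrable setT (EFin \o (fun t => W t * f t)).
Proof.
move=> [mW Wg].
have iY : mu.-integrable setT (EFin \o (fun t => p^-1 * (`|f t| `^ p + (p - 1) * `|g t| `^ p))).
  by apply: integrableMl; apply: integrable_add => //; exact: integrableMl.
apply: le_integrable iY => //.
  by apply/measurable_EFinP/measurable_funM => //; exact: measurable_Lfun.
move=> t _ /=; rewrite lee_fin normrM [leRHS]ger0_norm; last first.
  by rewrite mulr_ge0 ?invr_ge0 ?(ltW p0)// addr_ge0 ?mulr_ge0 ?powR_ge0// ltW.
rewrite ler_pdivlMl//; apply: le_trans (young (normr_ge0 (g t)) (normr_ge0 (f t))).
by rewrite ler_pM2l// ler_wpM2r.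
Qed.

Lemma pairing_young g W f : weight g W ->
  p * `|pairing W f| <= Lp_norm f `^ p + (p - 1) * Lp_norm g `^ p.
Proof.
move=> wW; have iWf := weight_integrable f wW; have [_ Wg] := wW.
have iWn : mu.-integrable setT (EFin \o (fun t => `|W t * f t|)).
  exact: integrable_abse iWf.
rewrite -!Rintegral_powR -RintegralZl// -RintegralD//; last exact: integrableMl.
apply: (@le_trans _ _ (p * \int[mu]_t `|W t * f t|)).
  by rewrite ler_pM2l// le_normr_Rintegral.
rewrite -RintegralZl//; apply: le_Rintegral => //.
- exact: integrableMl.
- by apply: integrable_add => //; exact: integrableMl.
move=> t _; rewrite normrM; apply: le_trans (young (normr_ge0 (g t)) (normr_ge0 (f t))).
by rewrite ler_pM2l// ler_wpM2r.
Qed.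

Lemma pairingP g W (c : R) f h : weight g W ->
  pairing W (c *: f + h) = c * pairing W f + pairing W h.
Proof.
move=> wW; rewrite /pairing -RintegralZl ?(weight_integrable _ wW)//.
rewrite -RintegralD//; last 2 first.
- by apply: integrableMl; exact: weight_integrable wW.
- exact: weight_integrable wW.
by apply: eq_Rintegral => t _ /=; rewrite mulrDr mulrCA.
Qed.

Lemma pairingD g W f h : weight g W -> pairing W (f + h) = pairing W f + pairing W h.
Proof. by move=> wW; rewrite -[f in LHS]scale1r (pairingP 1 _ _ wW) mul1r. Qed.

Lemma pairingZ g W (c : R) f : weight g W -> pairing W (c *: f) = c * pairing W f.
Proof.
move=> wW; have := pairingP c f 0 wW; rewrite addr0 => ->.
have := pairingP 0 f 0 wW; rewrite scale0r addr0 mul0r add0r.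
have := pairingP 1 0 0 wW; rewrite scale1r addr0 mul1r => /eqP.
by rewrite addrC -subr_eq subrr => /eqP <-; rewrite addr0.
Qed.

(** Replacing [f] by [2 ^+ n *: f] multiplies the pairing by [2 ^+ n] and leaves the right-hand side
    of [pairing_young] unchanged. *)
Lemma pairing_null g W f : weight g W -> Lp_norm f = 0 -> pairing W f = 0.
Proof.
move=> wW f0; suff h : forall n, `|pairing W f| <= 0 + (p^-1 * ((p - 1) * Lp_norm g `^ p)) / 2 ^+ n.
  by apply/eqP; rewrite -normr_le0; apply: le_geometric h.
move=> n; have := pairing_young (2 ^+ n *: f) wW.
rewrite Lp_normZ f0 mulr0 powR0 ?gt_eqF// add0r (pairingZ _ _ wW) normrM ger0_norm ?exprn_ge0//.
by rewrite add0r ler_pdivlMr ?exprn_gt0// ler_pdivlMl// [`|_| * _]mulrC.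
Qed.

(** Pairings are defined on functions; this makes them descend to classes. *)
Lemma pairing_rep g W f : weight g W -> pairing W (rep (cls f)) = pairing W f.
Proof.
move=> wW.
have : Lp_norm (rep (cls f) - f) = 0.
  by rewrite -(Lp_real_rnorm (rep (cls f) - f)) sn_quotB reprK subrr rnorm0.
move=> /(pairing_null wW); rewrite (pairingD _ _ wW) -scaleN1r (pairingZ _ _ wW) mulN1r.
by move=> /eqP; rewrite subr_eq0 => /eqP.
Qed.

Let pairing_linear g W (wW : weight g W) : linear (fun x : X => pairing W (rep x) : R^o).
Proof.
move=> a x y; rewrite -{1}(reprK x) -{1}(reprK y) -sn_quotZ -sn_quotD.
by rewrite (pairing_rep _ wW) (pairingP _ _ _ wW).
Qed.

Definition pairing_functional g W (wW : weight g W) : {linear X -> R^o} :=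
  mkLinear (pairing_linear wW).

Lemma pairing_le_norm g W f : weight g W -> Lp_norm g = 1 -> `|pairing W f| <= Lp_norm f.
Proof.
move=> wW g1; have := Lp_norm_ge0 f; rewrite le_eqVlt => /predU1P[/esym f0|f0].
  by rewrite (pairing_null wW f0) normr0 f0.
have inv0 : 0 < (Lp_norm f)^-1 by rewrite invr_gt0.
have n1 : Lp_norm ((Lp_norm f)^-1 *: f) = 1.
  by rewrite Lp_normZ gtr0_norm// mulVf// gt_eqF.
have := pairing_young ((Lp_norm f)^-1 *: f) wW.
rewrite n1 g1 powR1 mulr1 addrC subrK (pairingZ _ _ wW) normrM (gtr0_norm inv0).
by rewrite -[leRHS]mulr1 ler_pM2l// mulrC ler_pdivrMr// mul1r.
Qed.

Lemma weight_signed_power f : weight f (fun t => signed_power p (f t)).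
Proof.
split=> [|t]; last by rewrite (norm_signed_power p1).
by apply: measurable_signed_power; exact: measurable_Lfun.
Qed.

Lemma weight_norm_powR f : weight f (fun t => `|f t| `^ (p - 1)).
Proof.
split=> [|t]; last by rewrite ger0_norm// powR_ge0.
by apply: measurable_powR_comp; apply: measurableT_comp => //; exact: measurable_Lfun.
Qed.

Definition disjoint_const : R := 2 `^ p * (2 + 3 / `|2 `^ (p - 1) - 2|).

Lemma disjoint_const_ge0 : 0 <= disjoint_const.
Proof. by rewrite mulr_ge0 ?powR_ge0// addr_ge0// divr_ge0. Qed.

Section operator.
Variable A : {linear X -> X}.
Hypothesis A1 : forall x xs, dual_pair s x xs -> modulus s (xs (A x)) <= 1.
Hypothesis p2 : p != 2.

Local Notation "f ^#" := (fun t => signed_power p (f t)) (at level 2, format "f ^#").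
Let op f : L := rep (A (cls f)).

(** Representatives are additive only almost everywhere, which a pairing does not detect. *)
Let op_add W g f h : weight g W -> pairing W (op (f + h)) = pairing W (op f) + pairing W (op h).
Proof.
move=> wW; rewrite /op sn_quotD linearD/= -[A (cls f)]reprK -[A (cls h)]reprK -sn_quotD.
by rewrite (pairing_rep _ wW) (pairingD _ _ wW) !reprK.
Qed.

Let op_scale W g c f : weight g W -> pairing W (op (c *: f)) = c * pairing W (op f).
Proof.
move=> wW; rewrite /op sn_quotZ linearZZ -[A (cls f)]reprK -sn_quotZ.
by rewrite (pairing_rep _ wW) (pairingZ _ _ wW) !reprK.
Qed.

(** For [g = f / |f|], pairing with the signed power of [g] is a norm-one functional equal to 1 at
    [g], so the hypothesis on the numerical radius applies; both sides are homogeneous of degree [p]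
    in [f]. *)
Lemma pairing_index f : `|pairing f^# (op f)| <= Lp_norm f `^ p.
Proof.
have := Lp_norm_ge0 f; rewrite le_eqVlt => /predU1P[/esym f0|f0].
  have -> : pairing f^# (op f) = 0.
    rewrite /op (_ : cls f = 0).
      rewrite linear0; have := pairing_rep (0 : L) (weight_signed_power f).
      rewrite (_ : cls 0 = 0) => [->|]; last first.
        by apply/(@rnorm_eq0 _ _ s); rewrite Lp_real_rnorm /Lp_norm Lnorm0// eqe gt_eqF.
      apply: (pairing_null (weight_signed_power f)).
      by rewrite /Lp_norm Lnorm0// eqe gt_eqF.
    by apply/(@rnorm_eq0 _ _ s); rewrite Lp_real_rnorm.
  by rewrite normr0 powR_ge0.
set N := Lp_norm f in f0 *; have inv0 : 0 < N^-1 by rewrite invr_gt0.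
pose g := N^-1 *: f.
have g1 : Lp_norm g = 1 by rewrite Lp_normZ gtr0_norm// mulVf// gt_eqF.
have wg := weight_signed_power g.
have dp : dual_pair s (cls g) (pairing_functional wg).
  split.
  - by rewrite Lp_real_rnorm.
  - move=> x; rewrite -{2}(reprK x) Lp_real_rnorm; exact: (pairing_le_norm (rep x) wg g1).
  - rewrite -[LHS]/(pairing g^# (rep (cls g))) (pairing_rep _ wg).
    rewrite /pairing; under eq_Rintegral do rewrite (signed_power_mul p1).
    by rewrite Rintegral_powR g1 powR1.
have := A1 dp.
rewrite -[modulus _ _]/(`|pairing g^# (op g)|) (op_scale _ _ wg) normrM gtr0_norm//.
have -> : pairing g^# (op f) = N^-1 `^ (p - 1) * pairing f^# (op f).
  rewrite /pairing -RintegralZl//; last exact: weight_integrable (weight_signed_power f).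
  apply: eq_Rintegral => t _; rewrite -[g t]/(N^-1 * f t) (signed_powerM p1).
  by rewrite signed_power_ge0 ?(ltW inv0)// mulrA.
rewrite normrM ger0_norm ?powR_ge0// mulrA mulr_powRB1 ?(ltW inv0)//.
have -> : N^-1 `^ p = (N `^ p)^-1.
  apply: (mulfI (lt0r_neq0 (powR_gt0 p f0))).
  by rewrite -powRM ?(ltW f0) ?(ltW inv0)// !divff ?gt_eqF ?powR_gt0// powR1.
by rewrite ler_pdivrMl ?powR_gt0// mulr1.
Qed.

(* The odd part of t |-> <(a + t b)^#, A (a + t b)> is t <a^#, A b> + t^(p-1) <b^#, A a>; it is
   bounded at t = 1 and t = 2, and these two equations are independent because p <> 2. *)
Lemma pairing_disjoint a b : (forall t, a t = 0 \/ b t = 0) ->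
  `|pairing a^# (op (a + b))| <= disjoint_const * Lp_norm (a + b) `^ p.
Proof.
move=> ab; rewrite /disjoint_const.
pose D := 2 `^ (p - 1) - 2 : R.
have D0 : D != 0.
  have l2 : ln (2 : R) != 0 by rewrite gt_eqF// ln_gt0// ltr1n.
  rewrite subr_eq0; apply: contra_neq p2 => /(congr1 (@ln R)).
  by rewrite ln_powR -[RHS]mul1r => /(mulIf l2); lra.
rewrite -/D; set M := 2 `^ p * Lp_norm (a + b) `^ p.
have wa := weight_signed_power a; have wb := weight_signed_power b.
(* Disjoint supports give [|a + c b| <= 2 |a + b|] at every point. *)
have le2 (c : R) (h : L) : `|c| <= 2 -> (forall t, h t = a t + c * b t) -> Lp_norm h `^ p <= M.
  move=> c2 hE; rewrite /M -powRM ?Lp_norm_ge0//; apply: (ler_powR2r p1).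
    exact: Lp_norm_ge0.
  have -> : 2 * Lp_norm (a + b) = Lp_norm (2 *: (a + b)) by rewrite Lp_normZ ger0_norm.
  apply: (Lp_norm_le p1) => t; rewrite hE -[(2 *: (a + b)) t]/(2 * (a t + b t)).
  have [->|->] := ab t; rewrite ?add0r ?mulr0 ?addr0 !normrM (ger0_norm (ler0n R 2)).
    exact: ler_wpM2r.
  by rewrite ler_peMl// ler1n.
have phi c : `|c| <= 2 -> `|pairing a^# (op a) + c * pairing a^# (op b) +
    signed_power p c * (pairing b^# (op a) + c * pairing b^# (op b))| <= M.
  move=> c2; apply: le_trans (le2 c (a + c *: b) c2 (fun=> erefl)).
  apply: le_trans (pairing_index (a + c *: b)); rewrite le_eqVlt; apply/orP; left; apply/eqP.
  congr `|_|; set F := op (a + c *: b).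
  have -> : pairing (a + c *: b)^# F = pairing a^# F + signed_power p c * pairing b^# F.
    rewrite /pairing -RintegralZl//; last exact: weight_integrable wb.
    rewrite -RintegralD//; last 2 first.
    - exact: weight_integrable wa.
    - by apply: integrableMl; exact: weight_integrable wb.
    apply: eq_Rintegral => t _; rewrite -[(a + c *: b) t]/(a t + c * b t).
    have [->|->] := ab t.
      by rewrite add0r (signed_powerM p1) (signed_power0 p1) mul0r add0r mulrA.
    by rewrite mulr0 addr0 (signed_power0 p1) mul0r mulr0 addr0.
  by rewrite /F !(op_add _ _ wa) !(op_scale _ _ wa) !(op_add _ _ wb) !(op_scale _ _ wb).
have sp1 : signed_power p 1 = 1 :> R by rewrite signed_power_ge0// powR1.
have sp2 : signed_power p 2 = 2 `^ (p - 1) :> R by rewrite signed_power_ge0.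
have n1 : `|1| <= 2 :> R by rewrite normr1 ler1n.
have n2 : `|2| <= 2 :> R by rewrite ger0_norm.
have := phi 1 n1; have := phi (-1); rewrite normrN => /(_ n1).
have := phi 2 n2; have := phi (- 2); rewrite normrN => /(_ n2).
rewrite !signed_powerN sp1 sp2.
have := phi 0; rewrite normr0 (signed_power0 p1) => /(_ (ler0n _ _)).
have -> : pairing a^# (op (a + b)) = pairing a^# (op a) + pairing a^# (op b).
  by rewrite (op_add _ _ wa).
move: (pairing a^# (op a)) (pairing a^# (op b)) (pairing b^# (op a)) (pairing b^# (op b)).
move=> aa ab' ba bb; rewrite !mul0r !addr0 => /ler_normlP[h1 h2] /ler_normlP[h3 h4].
move=> /ler_normlP[h5 h6] /ler_normlP[h7 h8] /ler_normlP[h9 h10].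
(* The odd parts [ab' + ba] and [2 ab' + 2^(p-1) ba] are both bounded by [M]; subtracting twice the
   first from the second leaves [D * ba]. *)
have Dba : `|D| * `|ba| <= 3 * M.
  by rewrite -normrM ler_norml /D; apply/andP; split; lra.
have baM : `|ba| <= 3 / `|D| * M.
  by rewrite mulrAC ler_pdivlMr ?normr_gt0// mulrC.
have -> : 2 `^ p * (2 + 3 / `|D|) * Lp_norm (a + b) `^ p = 2 * M + 3 / `|D| * M by rewrite /M; ring.
have := ler_norm ba; have := ler_norm (- ba); rewrite normrN => h11 h12.
by rewrite ler_norml; apply/andP; split; lra.
Qed.

(** Split [f] by the sign of [f * F]: [a] lives where it is nonnegative and [b] where it is
    negative. Then [|f|^(p-1) |F|] is the difference of the signed pairings of [a] and [b], and each
    is controlled by [pairing_disjoint]. *)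
Lemma pairing_abs f :
  pairing (fun t => `|f t| `^ (p - 1)) (abs_Lfun p1 (op f)) <= 2 * disjoint_const * Lp_norm f `^ p.
Proof.
pose F := op f; pose B := [set t | 0 <= f t * F t].
have mB : measurable B.
  have mfF : measurable_fun setT (fun t => f t * F t).
    by apply: measurable_funM; exact: measurable_Lfun.
  have -> : B = (fun t => f t * F t) @^-1` [set` `[0, +oo[%R].
    by apply/seteqP; split => t; rewrite /B /= in_itv/= andbT.
  by rewrite -[X in measurable X]setTI; apply: mfF => //; exact: measurable_itv.
have aL : f \_ B \in Lfun mu p%:E.
  apply: (@Lfun_dominated _ _ _ _ _ q1 p1 _ f).
    apply/measurable_restrict => //; rewrite setTI.
    by apply: (measurable_funS measurableT) => //; exact: measurable_Lfun.
  by move=> t; rewrite patchE; case: ifPn => // _; rewrite normr0.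
pose a : L := Lfun_Sub q1 aL; pose b : L := f - a.
have aE t : a t = if t \in B then f t else 0 by rewrite /= patchE.
have bE t : b t = f t - a t by [].
have abf : a + b = f by rewrite addrC subrK.
have ab t : a t = 0 \/ b t = 0.
  by rewrite bE aE; case: ifPn => _; [right; rewrite subrr|left].
have ba t : b t = 0 \/ a t = 0 by case: (ab t); [right|left].
have wa := weight_signed_power a; have wb := weight_signed_power b.
have := pairing_disjoint ab; have := pairing_disjoint ba.
rewrite [b + a]addrC abf -/F => hb ha.
have -> : pairing (fun t => `|f t| `^ (p - 1)) (abs_Lfun p1 F) = pairing a^# F - pairing b^# F.
  rewrite /pairing -RintegralB//; last 2 first.
  - exact: weight_integrable wa.
  - exact: weight_integrable wb.
  apply: eq_Rintegral => t _; rewrite bE aE; case: ifPn.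
    rewrite inE => tB; rewrite subrr (signed_power0 p1) mul0r subr0.
    by rewrite (signed_power_mul_norm p1).
  rewrite notin_setE /B /= => /negP; rewrite -ltNge => tB.
  rewrite (signed_power0 p1) mul0r sub0r subr0.
  rewrite -mulNr -(signed_powerN p (f t)) (signed_power_mul_norm p1) ?normrN//.
  by rewrite mulNr oppr_ge0 ltW.
rewrite -mulrA mulr_natl mulr2n; apply: lerD; first exact: le_trans (ler_norm _) ha.
by rewrite -normrN in hb; exact: le_trans (ler_norm _) hb.
Qed.

Let pairing_mono g g' W W' f f' : weight g W -> weight g' W' ->
  (forall t, W t * f t <= W' t * f' t) -> pairing W f <= pairing W' f'.
Proof.
by move=> wW wW' h; apply: le_Rintegral => //;
  [exact: weight_integrable wW|exact: weight_integrable wW'].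
Qed.

(* u = (h + u/2) - (h - u/2), and both terms are comparable with h. *)
Lemma pairing_majorant h u : (forall t, `|u t| <= h t) ->
  pairing (fun t => `|h t| `^ (p - 1)) (abs_Lfun p1 (op u)) <=
    2 * (2 `^ (p - 1) * (2 * disjoint_const * (2 `^ p * Lp_norm h `^ p))).
Proof.
move=> uh; have h0 t : 0 <= h t by exact: le_trans (uh t).
have wh := weight_norm_powR h.
(* For [x] comparable with [h], the weight of [h] is exchanged for that of [x] at the cost
   [2^(p-1)], and the norm of [x] for that of [h] at the cost [2^p]. *)
have side (x : L) : (forall t, h t / 2 <= `|x t| <= 2 * h t) ->
    pairing (fun t => `|h t| `^ (p - 1)) (abs_Lfun p1 (op x)) <=
    2 `^ (p - 1) * (2 * disjoint_const * (2 `^ p * Lp_norm h `^ p)).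
  move=> hx; apply: (@le_trans _ _ (2 `^ (p - 1) *
      pairing (fun t => `|x t| `^ (p - 1)) (abs_Lfun p1 (op x)))).
    rewrite -(pairingZ _ _ (weight_norm_powR x)).
    apply: (pairing_mono wh (weight_norm_powR x)) => t.
    suff : `|h t| `^ (p - 1) * `|op x t| <= `|x t| `^ (p - 1) * (2 `^ (p - 1) * `|op x t|) by [].
    rewrite [leRHS]mulrCA [leRHS]mulrA; apply: ler_wpM2r => //.
    rewrite -powRM//; have /andP[hx1 _] := hx t.
    rewrite ge0_ler_powR ?nnegrE ?(ltW pB1) ?mulr_ge0// ger0_norm//; lra.
  rewrite ler_wpM2l ?powR_ge0//; apply: le_trans (pairing_abs x) _.
  rewrite ler_wpM2l ?mulr_ge0 ?disjoint_const_ge0// -powRM ?Lp_norm_ge0//.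
  apply: (ler_powR2r p1); first exact: Lp_norm_ge0.
  have -> : 2 * Lp_norm h = Lp_norm (2 *: h) by rewrite Lp_normZ ger0_norm.
  apply: (Lp_norm_le p1) => t; rewrite -[(2 *: h) t]/(2 * h t) [leRHS]ger0_norm ?mulr_ge0//.
  by have /andP[] := hx t.
pose y : L := h + 2^-1 *: u; pose z : L := h + (- 2^-1) *: u.
have hy t : h t / 2 <= `|y t| <= 2 * h t.
  rewrite -[y t]/(h t + 2^-1 * u t); have /ler_normlP[h1 h2] := uh t.
  rewrite ger0_norm; last by move: (h0 t); lra.
  by apply/andP; split; move: (h0 t); lra.
have hz t : h t / 2 <= `|z t| <= 2 * h t.
  rewrite -[z t]/(h t + (- 2^-1) * u t); have /ler_normlP[h1 h2] := uh t.
  rewrite ger0_norm; last by move: (h0 t); lra.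
  by apply/andP; split; move: (h0 t); lra.
have uE : u = y - z.
  apply/LfuneqP => t; rewrite -[(y - z) t]/((h t + 2^-1 * u t) - (h t + (- 2^-1) * u t)).
  by lra.
(* [op u] and [op y - op z] agree only almost everywhere; their difference is carried along as a
   third term whose pairing vanishes. *)
have null : Lp_norm (op u - (op y - op z)) = 0.
  rewrite -Lp_real_rnorm sn_quotB sn_quotB !reprK [in cls u]uE sn_quotB linearB/= subrr.
  by rewrite rnorm0.
have := @pairing_null h _ (abs_Lfun p1 (op u - (op y - op z))) wh.
rewrite Lp_norm_abs => /(_ null) pnull.
apply: le_trans (_ : _ <= pairing (fun t => `|h t| `^ (p - 1))
   (abs_Lfun p1 (op y) + abs_Lfun p1 (op z) + abs_Lfun p1 (op u - (op y - op z)))) _.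
  apply: (pairing_mono wh wh) => t; apply: ler_wpM2l; first exact: powR_ge0.
  suff : `|op u t| <= `|op y t| + `|op z t| + `|op u t - (op y t - op z t)| by [].
  rewrite -{1}(subrK (op y t - op z t) (op u t)) addrC (le_trans (ler_normD _ _))// lerD2r.
  by rewrite (le_trans (ler_normD _ _))// normrN.
rewrite !(pairingD _ _ wh) pnull addr0 mulr_natl mulr2n.
by rewrite lerD// side.
Qed.

(** Choose [c] so that [c * op f] has the norm of [f]. The majorant [h = |f| + c |op f|] then has
    norm at most twice that of [f]. As [h >= c |op f|], the pairing of [pairing_majorant] is at
    least [c^(p-1)] times the [p]-th power of the norm of [op f], which is the norm of [op f] times
    the [(p-1)]-th power of that of [f]; this power is cancelled at the end. *)
Lemma real_Lp_index x : rnorm s (A x) <=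
  (2 * (2 `^ (p - 1) * (2 * disjoint_const * 2 `^ p)) * 2 `^ p) * rnorm s x.
Proof.
rewrite -(reprK x) -[A _]reprK !Lp_real_rnorm; set f := repr x; rewrite -/(op f).
have K0 : 0 <= 2 * (2 `^ (p - 1) * (2 * disjoint_const * 2 `^ p)) * 2 `^ p.
  by rewrite !(mulr_ge0, powR_ge0, disjoint_const_ge0).
set K := 2 * _; have := Lp_norm_ge0 f; rewrite le_eqVlt => /predU1P[/esym f0|f0].
  rewrite f0 mulr0 /op (_ : cls f = 0); last first.
    by apply/(@rnorm_eq0 _ _ s); rewrite Lp_real_rnorm.
  by rewrite linear0 -Lp_real_rnorm reprK rnorm0.
have := Lp_norm_ge0 (op f); rewrite le_eqVlt => /predU1P[/esym F0|F0].
  by rewrite F0 mulr_ge0// ltW.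
have [c c0 cE] : exists2 c, 0 < c & c * Lp_norm (op f) = Lp_norm f.
  by exists (Lp_norm f / Lp_norm (op f)); rewrite ?divr_gt0// divfK// gt_eqF.
pose h : L := abs_Lfun p1 f + c *: abs_Lfun p1 (op f).
have hE t : h t = `|f t| + c * `|op f t| by [].
have fh t : `|f t| <= h t by rewrite hE lerDl mulr_ge0// ltW.
have hn : Lp_norm h <= 2 * Lp_norm f.
  rewrite (le_trans (Lp_normD _ _))// Lp_normZ !Lp_norm_abs gtr0_norm// cE.
  by rewrite mulr_natl mulr2n.
have := pairing_majorant fh.
have : c `^ (p - 1) * Lp_norm (op f) `^ p <=
    pairing (fun t => `|h t| `^ (p - 1)) (abs_Lfun p1 (op f)).
  rewrite -Rintegral_powR -RintegralZl//; apply: le_Rintegral => //.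
  - exact: integrableMl.
  - exact: weight_integrable (weight_norm_powR h).
  move=> t _; rewrite -(powRB1_mulr p1 (normr_ge0 (op f t))) mulrA -[abs_Lfun p1 _ t]/(`|op f t|).
  rewrite ler_wpM2r// -powRM ?(ltW c0)// ge0_ler_powR ?nnegrE ?(ltW pB1) ?mulr_ge0 ?(ltW c0)//.
  have ht : 0 <= h t by exact: le_trans (fh t).
  by rewrite (ger0_norm ht) hE lerDr.
move=> /le_trans h1 /h1 {h1}.
have -> : c `^ (p - 1) * Lp_norm (op f) `^ p = Lp_norm f `^ (p - 1) * Lp_norm (op f).
  rewrite -(powRB1_mulr p1 (ltW F0)) mulrA -powRM ?(ltW c0) ?(ltW F0)//.
  by rewrite cE.
have hp : Lp_norm h `^ p <= 2 `^ p * (Lp_norm f `^ (p - 1) * Lp_norm f).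
  rewrite (powRB1_mulr p1 (ltW f0)) -powRM ?(ltW f0)//.
  by apply: (ler_powR2r p1) => //; exact: Lp_norm_ge0.
have fp0 : 0 < Lp_norm f `^ (p - 1) by exact: powR_gt0.
move=> hm; rewrite -(ler_pM2l fp0); apply: le_trans hm _.
have K1 : 0 <= 2 * (2 `^ (p - 1) * (2 * disjoint_const * 2 `^ p)).
  by rewrite !(mulr_ge0, powR_ge0, disjoint_const_ge0).
have := ler_wpM2l K1 hp; rewrite /K.
move: (Lp_norm h `^ p) (Lp_norm f `^ (p - 1)) (Lp_norm f) (2 `^ p) (2 `^ (p - 1)) disjoint_const.
move=> a b c' e f' k; lra.
Qed.

End operator.

End real_Lp_index.

(** * The property BPBp-nu for the three classes of spaces *)

Theorem mainTheorem7 (R : realType) :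
  (forall X : completeNormedModType R[i],
     uniformly_smooth X -> uniformly_convex X -> BPBp_nu X)
  /\
  (forall (d : measure_display) (T : measurableType d)
     (mu : {measure set T -> \bar R}) (p : \bar R) (p1 : (1 <= p)%E),
     (1 < p)%E -> (p < +oo)%E -> BPBp_nu (Lp_complex mu p1))
  /\
  (forall (d : measure_display) (T : measurableType d)
     (mu : {measure set T -> \bar R}) (p : \bar R) (p1 : (1 <= p)%E),
     (1 < p)%E -> (p < +oo)%E -> (p != 2%:E)%E -> BPBp_nu (Lp_real mu p1)).
Proof.
split; [|split].
- move=> X smoothX convX; apply: complex_BPBp_nu.
  + exact: completeNormed_complete_rnorm.
  + exact: uniformly_smooth_rsmooth.
  + exact: uniformly_convex_rconvex.
- move=> d T mu [p| |]// q1 p1 _; rewrite lte_fin in p1.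
  apply: complex_BPBp_nu.
  + exact: Lp_complex_complete.
  + exact: Lp_complex_rsmooth.
  + exact: Lp_complex_rconvex.
- move=> d T mu [p| |]// q1 p1 _ p2; rewrite lte_fin in p1.
  have K0 : 0 <= 2 * (2 `^ (p - 1) * (2 * disjoint_const p * 2 `^ p)) * 2 `^ p.
    by rewrite !(mulr_ge0, powR_ge0, disjoint_const_ge0).
  have := @BPBp_nu_of_index R R (real_real_scalars R) (Lp_real mu q1)
    (Lp_real_rconvex mu q1 p1) (Lp_real_rsmooth mu q1 p1)
    (Lp_real_complete p1) (@complete_real R) _ K0.
  apply => A _ A1 h; exact: real_Lp_index.
Qed.
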